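(* Let $G$ be a locally elliptic group, $(\Phi,\Psi)$ a complementary pair of Young functions and $\omega$ an $L^\Phi$-weight on $G$ with $1/\omega\in L^\Psi(G)$. The following hold: (i) The Banach $*$-algebra $L^\Phi(G,\omega)$ is quasi-Hermitian, i.e. for every self-adjoint function $f\in C_c(G)\subseteq L^\Phi(G,\omega)$, $\sigma_{L^\Phi(G,\omega)}(f)\subseteq\mathbb{R}$. (ii) If $G$ is Hermitian and $\omega$ is sub-additive, then for all $f\in L^\Phi(G,\omega)$, $\sigma_{L^\Phi(G,\omega)}(f)=\sigma_{L^1(G)}(f)$. In particular, $L^\Phi(G,\omega)$ is Hermitian.
   Context: Locally elliptic groups: a locally compact group $G$ is locally elliptic if every compact subset of $G$ generates a relatively compact subgroup. By the paper's standing convention, such a $G$ is non-compact and is a countable increasing union of compact open subgroups. Such groups are unimodular; integration is with respect to a fixed Haar measure. Young functions: a Young function is a convex even function $\Phi:\mathbb{R}\to[0,\infty]$ with $\Phi(0)=0$ and $\lim_{x\to\infty}\Phi(x)=+\infty$. Its complementary Young function is $\Psi(y)=\sup\{x|y|-\Phi(x):x\ge0\}$, and $(\Phi,\Psi)$ is then called a complementary pair. Orlicz spaces: $L^\Phi(G)$ is the space of measurable $f:G\to\mathbb{C}$ (modulo a.e. equality) with $\int_G\Phi(\alpha|f|)\,dx<\infty$ for some $\alpha>0$, with norm $\|f\|_{L^\Phi(G)}=\sup\{\int_G|fg|\,dx:\int_G\Psi(|g|)\,dx\le1\}$. Weights: a weight on $G$ is a measurable function $\omega:G\to[1,\infty)$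 that is bounded on compact sets, satisfies $\omega(xy)\le\omega(x)\omega(y)$ and $\omega(x)=\omega(x^{-1})$. It is sub-additive if there is $C>0$ with $\omega(xy)\le C(\omega(x)+\omega(y))$ for all $x,y\in G$. $L^\Phi(G,\omega)=\{f\in L^\Phi(G):\|f\omega\|_{L^\Phi(G)}<\infty\}$ with norm $\|f\omega\|_{L^\Phi(G)}$. $\omega$ is an $L^\Phi$-weight if $L^\Phi(G,\omega)$ is a Banach $*$-algebra under convolution and the involution $f^*(x)=\overline{f(x^{-1})}$ (the norm being submultiplicative possibly only up to a constant, i.e. after passing to an equivalent norm). If $1/\omega\in L^\Psi(G)$ then $L^\Phi(G,\omega)\subseteq L^1(G)$. $\sigma_{\mathcal{A}}(x)$ is the spectrum of $x$ in the Banach algebra $\mathcal{A}$ (computed in the unitization if $\mathcal{A}$ has no identity). $x$ is self-adjoint if $x=x^*$. A Banach $*$-algebra is Hermitian if every self-adjoint element has real spectrum; a group $G$ is Hermitian if $L^1(G)$ is Hermitian. $C_c(G)$ is the space of compactly supported continuous functions. *)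

(* Defs.v *)
From HB Require Import structures.
From mathcomp Require Import all_boot all_order all_algebra.
From mathcomp Require Import complex.
From mathcomp Require Import all_classical all_reals all_analysis.

Set Implicit Arguments.
Unset Strict Implicit.
Unset Printing Implicit Defensive.

Import Order.TTheory GRing.Theory Num.Theory.
Import numFieldNormedType.Exports.

Local Open Scope classical_set_scope.
Local Open Scope complex_scope.
Local Open Scope ring_scope.

HB.mixin Record isTopologicalGroup G & PointedTopological G & Group G := {
  mulg_continuous : continuous (fun p : G * G => (p.1 * p.2)%g);
  invg_continuous : continuous (fun x : G => (x^-1)%g)
}.

(* The distinguished point plays no role; it is there only because the library
   requires measurable types to be pointed. *)
#[short(type="topologicalGroupType")]
HB.structure Definition TopologicalGroup :=
  {G of PointedTopological G & Group G & isTopologicalGroup G}.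

Section LocallyElliptic.
Variable G : topologicalGroupType.

Definition subgroup (H : set G) : Prop := group_closed (mem H).

Definition generated_subgroup (A : set G) : set G := smallest subgroup A.

Record locally_elliptic : Prop := {
  le_hausdorff : hausdorff_space G;
  le_locally_compact : locally_compact [set: G];
  le_generated : forall K : set G, compact K -> precompact (generated_subgroup K);
  le_noncompact : ~ compact [set: G];
  le_union : exists H : nat -> set G,
    [/\ forall n, [/\ subgroup (H n), compact (H n) & open (H n)],
        forall n, H n `<=` H n.+1 &
        \bigcup_n H n = [set: G]]
}.

End LocallyElliptic.

Notation borel G := (g_sigma_algebraType (@open G)).

Record haar_measure (R : realType) (G : topologicalGroupType)
    (mu : {measure set (borel G) -> \bar R}) : Prop := {
  haar_left_invariant : forall (x : G) (A : set (borel G)), measurable A ->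
    mu [set (x * y)%g | y in A] = mu A;
  haar_compact : forall K : set G, compact K -> (mu K < +oo)%E;
  haar_open : forall U : set G, open U -> U !=set0 -> (0 < mu U)%E;
  haar_outer_regular : forall A : set (borel G), measurable A ->
    mu A = ereal_inf [set mu U | U in [set U : set G | open U /\ A `<=` U]];
  haar_inner_regular : forall U : set G, open U ->
    mu U = ereal_sup [set mu K | K in [set K : set G | compact K /\ K `<=` U]]
}.

Section Young.
Variable R : realType.
Local Open Scope ereal_scope.

Record young_function (Phi : R -> \bar R) : Prop := {
  young_ge0 : forall x, 0 <= Phi x;
  young0 : Phi 0%R = 0;
  young_even : forall x, Phi (- x)%R = Phi x;
  (* 0 * +oo = 0 in \bar R *)
  young_convex : forall (t x y : R), (0 <= t <= 1)%R ->
    Phi (t * x + (1 - t) * y)%R <= t%:E * Phi x + (1 - t)%:E * Phi y;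
  young_cvg : Phi x @[x --> +oo%R] --> +oo
}.

Definition complementary_young (Phi : R -> \bar R) (y : R) : \bar R :=
  ereal_sup [set (x * `|y|)%:E - Phi x | x in [set x : R | (0 <= x)%R]].

Definition complementary_pair (Phi Psi : R -> \bar R) : Prop :=
  [/\ young_function Phi, young_function Psi & Psi = complementary_young Phi].

End Young.

(* The algebra described is the quotient of [mem] by [eqv]; function spaces
   modulo a.e. equality are presented in this way. The operations need not be
   meaningful outside [mem], and no axiom is imposed at this stage. *)
Record star_algebra (R : realType) := StarAlgebra {
  carrier :> lmodType R[i];
  mem_alg : set carrier;
  eqv : carrier -> carrier -> Prop;
  mul_alg : carrier -> carrier -> carrier;
  star : carrier -> carrier;
  norm_alg : carrier -> \bar R
}.

Arguments mem_alg {R} s x.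

Section StarAlgebra.
Variable R : realType.
Implicit Type A : star_algebra R.

Record banach_star_algebra A : Prop := {
  bsa_eqv_refl : forall x : A, eqv x x;
  bsa_eqv_sym : forall x y : A, eqv x y -> eqv y x;
  bsa_eqv_trans : forall x y z : A, eqv x y -> eqv y z -> eqv x z;
  bsa_mem0 : mem_alg A (0 : A);
  bsa_memD : forall (a : R[i]) (x y : A),
    mem_alg A x -> mem_alg A y -> mem_alg A (a *: x + y);
  bsa_memM : forall x y : A, mem_alg A x -> mem_alg A y -> mem_alg A (mul_alg x y);
  bsa_memS : forall x : A, mem_alg A x -> mem_alg A (star x);
  bsa_eqvD : forall (a : R[i]) (x x' y y' : A),
    mem_alg A x -> mem_alg A x' -> mem_alg A y -> mem_alg A y' ->
    eqv x x' -> eqv y y' -> eqv (a *: x + y) (a *: x' + y');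
  bsa_eqvM : forall x x' y y' : A,
    mem_alg A x -> mem_alg A x' -> mem_alg A y -> mem_alg A y' ->
    eqv x x' -> eqv y y' -> eqv (mul_alg x y) (mul_alg x' y');
  bsa_eqvS : forall x x' : A,
    mem_alg A x -> mem_alg A x' -> eqv x x' -> eqv (star x) (star x');
  bsa_eqv_norm : forall x x' : A,
    mem_alg A x -> mem_alg A x' -> eqv x x' -> norm_alg x = norm_alg x';
  bsa_mulA : forall x y z : A, mem_alg A x -> mem_alg A y -> mem_alg A z ->
    eqv (mul_alg x (mul_alg y z)) (mul_alg (mul_alg x y) z);
  bsa_mulDl : forall (a : R[i]) (x y z : A),
    mem_alg A x -> mem_alg A y -> mem_alg A z ->
    eqv (mul_alg (a *: x + y) z) (a *: mul_alg x z + mul_alg y z);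
  bsa_mulDr : forall (a : R[i]) (x y z : A),
    mem_alg A x -> mem_alg A y -> mem_alg A z ->
    eqv (mul_alg z (a *: x + y)) (a *: mul_alg z x + mul_alg z y);
  bsa_starD : forall (a : R[i]) (x y : A), mem_alg A x -> mem_alg A y ->
    eqv (star (a *: x + y)) (a^* *: star x + star y);
  bsa_starM : forall x y : A, mem_alg A x -> mem_alg A y ->
    eqv (star (mul_alg x y)) (mul_alg (star y) (star x));
  bsa_starK : forall x : A, mem_alg A x -> eqv (star (star x)) x;
  bsa_norm_fin : forall x : A, mem_alg A x -> (0 <= norm_alg x < +oo)%E;
  bsa_norm_eq0 : forall x : A, mem_alg A x -> norm_alg x = 0%E <-> eqv x 0;
  bsa_normZ : forall (a : R[i]) (x : A), mem_alg A x ->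
    norm_alg (a *: x) = ((Normc.normc a)%:E * norm_alg x)%E;
  bsa_normD : forall x y : A, mem_alg A x -> mem_alg A y ->
    (norm_alg (x + y) <= norm_alg x + norm_alg y)%E;
  bsa_normS : forall x : A, mem_alg A x -> norm_alg (star x) = norm_alg x;
  (* a constant is allowed: the norm need only be equivalent to a
     submultiplicative one *)
  bsa_normM : exists c : R, forall x y : A, mem_alg A x -> mem_alg A y ->
    (norm_alg (mul_alg x y) <= c%:E * (norm_alg x * norm_alg y))%E;
  bsa_complete : forall u : nat -> A, (forall n, mem_alg A (u n)) ->
    (forall e : R, 0 < e -> exists N, forall m n, (N <= m)%N -> (N <= n)%N ->
      (norm_alg (u m - u n) < e%:E)%E) ->
    exists2 x : A, mem_alg A x & norm_alg (u n - x) @[n --> \oo] --> 0%E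
}.

(* (a, x) stands for a + x *)
Definition unitization A : star_algebra R := @StarAlgebra R (R[i]^o * A)%type
  [set p | mem_alg A p.2]
  (fun p q => p.1 = q.1 /\ eqv p.2 q.2)
  (fun p q => (p.1 * q.1, p.1 *: q.2 + q.1 *: p.2 + mul_alg p.2 q.2))
  (fun p => (p.1^*, star p.2))
  (fun p => ((Normc.normc p.1)%:E + norm_alg p.2)%E).

Definition is_identity A (e : A) : Prop :=
  mem_alg A e /\
  forall x : A, mem_alg A x -> eqv (mul_alg e x) x /\ eqv (mul_alg x e) x.

Definition invertible A (e x : A) : Prop :=
  exists2 y : A, mem_alg A y & eqv (mul_alg x y) e /\ eqv (mul_alg y x) e.

Definition unital_spectrum A (e x : A) : set R[i] :=
  [set l | ~ invertible e (l *: e - x)].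

Definition spectrum A (x : A) : set R[i] :=
  [set l | (exists2 e : A, is_identity e & unital_spectrum e x l) \/
    (~ (exists e : A, is_identity e) /\
     unital_spectrum (A := unitization A) (1, 0) (0, x) l)].

Arguments spectrum : clear implicits.

Definition selfadjoint A (x : A) : Prop := eqv x (star x).

Definition real_numbers : set R[i] := [set l | complex.Im l = 0].

Definition hermitian_algebra A : Prop := forall x : A,
  mem_alg A x -> selfadjoint x -> spectrum A x `<=` real_numbers.

Definition quasi_hermitian A (S : set A) : Prop :=
  S `<=` mem_alg A /\
  forall x : A, S x -> selfadjoint x -> spectrum A x `<=` real_numbers.

End StarAlgebra.

Arguments spectrum {R} A x.
Arguments hermitian_algebra {R} A.
Arguments quasi_hermitian {R} A S.

Section Orlicz.
Variables (R : realType) (G : topologicalGroupType).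
Variable mu : {measure set (borel G) -> \bar R}.
Implicit Types (f g : G -> R[i]) (omega : G -> R) (Phi Psi : R -> \bar R).
Local Notation normc := (@Normc.normc R).

(* Measurability is with respect to Borel sets; every Haar-measurable function
   agrees a.e. with a Borel one. *)
Definition cmeasurable f : Prop :=
  measurable_fun [set: borel G] (fun x : borel G => complex.Re (f x)) /\
  measurable_fun [set: borel G] (fun x : borel G => complex.Im (f x)).

Definition cintegrable f : Prop :=
  cmeasurable f /\ (\int[mu]_x (normc (f x))%:E < +oo)%E.

Definition cintegral f : R[i] :=
  (\int[mu]_x complex.Re (f x)) +i* (\int[mu]_x complex.Im (f x)).

Definition aeeq f g : Prop :=
  {ae mu, forall x : borel G, f x = g x}.

Definition convolution f g : G -> R[i] :=
  fun x => cintegral (fun y => f y * g (y^-1 * x)%g).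

(* No modular function occurs, since locally elliptic groups are unimodular. *)
Definition involution f : G -> R[i] := fun x => (f (x^-1)%g)^*.

Definition group_algebra : star_algebra R := @StarAlgebra R (G -> R[i])
  [set f | cintegrable f] aeeq convolution involution
  (fun f => \int[mu]_x (normc (f x))%:E)%E.

Definition hermitian_group : Prop := hermitian_algebra group_algebra.

Definition orlicz_space Phi : set (G -> R[i]) :=
  [set f | cmeasurable f /\
    exists2 a : R, 0 < a & (\int[mu]_x Phi (a * normc (f x))%R < +oo)%E].

(* The norm of L^Phi is defined through the complementary function Psi. *)
Definition orlicz_norm Psi f : \bar R :=
  ereal_sup [set (\int[mu]_x (normc (f x * g x))%:E)%E | g in
    [set g | cmeasurable g /\ (\int[mu]_x Psi (normc (g x)) <= 1)%E]].

Record weight omega : Prop := {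
  weight_ge1 : forall x, 1 <= omega x;
  weight_measurable : measurable_fun [set: borel G] (omega : borel G -> R);
  weight_bounded : forall K : set G, compact K ->
    exists M : R, forall x, K x -> omega x <= M;
  weight_mul : forall x y, omega (x * y)%g <= omega x * omega y;
  weight_inv : forall x, omega (x^-1)%g = omega x
}.

Definition subadditive_weight omega : Prop :=
  exists2 c : R, 0 < c & forall x y, omega (x * y)%g <= c * (omega x + omega y).

Definition weighted_norm Psi omega f : \bar R :=
  orlicz_norm Psi (fun x => f x * (omega x)%:C).

Definition orlicz_algebra Phi Psi omega : star_algebra R :=
  @StarAlgebra R (G -> R[i])
    [set f | orlicz_space Phi f /\ (weighted_norm Psi omega f < +oo)%E]
    aeeq convolution involution (weighted_norm Psi omega).

(* The second clause says that the convolution integrals converge a.e., so that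
   [convolution] does not rely on the default value of divergent integrals. *)
Record orlicz_weight Phi Psi omega : Prop := {
  ow_weight : weight omega;
  ow_convolvable : forall f g,
    mem_alg (orlicz_algebra Phi Psi omega) f ->
    mem_alg (orlicz_algebra Phi Psi omega) g ->
    {ae mu, forall x : borel G, cintegrable (fun y => f y * g (y^-1 * x)%g)};
  ow_banach : banach_star_algebra (orlicz_algebra Phi Psi omega)
}.

Definition Cc : set (G -> R[i]) :=
  [set f | continuous (f : G -> R[i]^o) /\ compact (closure [set x | f x != 0])].

End Orlicz.

Arguments Cc : clear implicits.

(* Main.v *)
From HB Require Import structures.
Require Import Defs.
From mathcomp Require Import all_boot all_order all_algebra.
From mathcomp Require Import complex finmap.
From mathcomp Require Import all_classical all_reals all_analysis.
From mathcomp Require Import measurable_realfun ring lra.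

Set Implicit Arguments.
Unset Strict Implicit.
Unset Printing Implicit Defensive.

Import Order.TTheory GRing.Theory Num.Theory.
Import numFieldNormedType.Exports.

Local Open Scope classical_set_scope.
Local Open Scope ring_scope.

(** A number [l <> 0] lies outside the spectrum of [f] exactly when [f] has a
    quasi-inverse, an element [p] with [l p - f * p = f = l p - p * f]; this
    holds with or without an identity ([spectrum_neq0P]), and the value [0] is
    moved to [1] by adding the identity, if there is one ([spectrum0_unitalP]).
    Both parts of the theorem thus ask for quasi-inverses in the weighted Orlicz
    algebra [A]. They are sums of Neumann series, and the whole point is to show
    that the weighted norms of the terms decrease geometrically
    ([neumann_series]).

    For the first part, let [f] be bounded, supported in a compact open subgroup
    [H], and self-adjoint at every point; a function of [Cc] that is
    self-adjoint almost everywhere agrees almost everywhere with such an [f],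
    for some [H]. Convolution by [f] is a bounded symmetric operator on L^2, so
    the square of the norm of [i s g + f * g] is the sum of those of [s g] and
    of [f * g] ([norm2_shift]). When [Im l <> 0], a suitable real [s] makes
    [(i s + f) / (l + i s)] a contraction of L^2. Everything takes place on [H],
    which has finite measure, so that the geometric decay passes from L^2 to the
    uniform norm and from there to [A] ([bounded_memA]), which gives
    [bounded_selfadjoint_quasi_invertible].

    For the second part, subadditivity of the weight yields the differential
    inequality [|f * g|_A <= c (|f|_A |g|_1 + |f|_1 |g|_A)] ([wnorm_conv_le]).
    So an element of small L^1 norm has powers that decrease geometrically in
    [A], and a quasi-inverse in [A] ([small_quasi_inverse]). As [A] is dense in
    L^1, a quasi-inverse in L^1 of an element of [A] is approximated by an
    element of [A], and the error is corrected within [A]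
    ([quasi_invertible_descent]). The two algebras have identities at the same
    time: an identity of L^1 forces points to have positive measure
    ([identity_charges_points]), and then the normalized indicator of the
    neutral element is an identity of both. Equality of the spectra follows
    ([eq_spectrum]), and real spectra in L^1 are real in [A].

    All of this rests on Tonelli's theorem for convolutions. The group need not
    have a countable base, hence [(x, y) |-> f y * g (y^-1 x)] need not be
    measurable for the product sigma-algebra. Inner regularity of the Haar
    measure still gives the theorem for indicators of open sets, which are
    approximated from inside by countable unions of rectangles
    ([open_rectangles]), and Dynkin's theorem extends it to all Borel sets
    ([borel_tonelli]). Invariance under inversion and right translation
    ([haar_preimage_inv], [haar_integral_right]) and Young's inequality in L^1
    ([conv_L1_le]) are consequences. *)

(** * Borel sets and continuous maps *)

Section BorelSets.

Lemma borel_open (X : ptopologicalType) (U : set X) :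
  open U -> measurable (U : set (borel X)).
Proof. by move=> oU; apply: sub_sigma_algebra. Qed.

Lemma borel_closed (X : ptopologicalType) (U : set X) :
  closed U -> measurable (U : set (borel X)).
Proof. by rewrite -openC -[U in measurable U]setCK => /borel_open/measurableC. Qed.

Lemma borel_continuous (X Y : ptopologicalType) (f : X -> Y) :
  continuous f -> measurable_fun [set: borel X] (f : borel X -> borel Y).
Proof.
move=> cf; apply: (measurability (@open Y : set (set (borel Y))) erefl).
move=> _ [U oU <-]; rewrite setTI; apply: borel_open.
by apply: open_comp => // x _; exact: cf.
Qed.

Lemma borel_continuousR (R : realType) (X : ptopologicalType) (f : X -> R) :
  continuous f -> measurable_fun [set: borel X] (f : borel X -> R).
Proof.
move=> cf; apply: (measurability _ (RGenOpens.measurableE R)).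
move=> _ [_ [a [b ->]] <-]; rewrite setTI; apply: borel_open.
by apply: open_comp => [x _|]; [exact: cf|exact: interval_open].
Qed.

Lemma pair_l_continuous (X Y : ptopologicalType) (x : X) :
  continuous (fun y : Y => (x, y)).
Proof. by move=> y; apply: cvg_pair; [exact: cvg_cst|exact: cvg_id]. Qed.

Lemma pair_r_continuous (X Y : ptopologicalType) (y : Y) :
  continuous (fun x : X => (x, y)).
Proof. by move=> x; apply: cvg_pair; [exact: cvg_id|exact: cvg_cst]. Qed.

End BorelSets.

Lemma open_pointwise (X : topologicalType) (A : set X) :
  (forall x, A x -> exists2 V, open_nbhs x V & V `<=` A) -> open A.
Proof.
move=> AV; rewrite openE => x /AV[V xV VA].
exact: filterS VA (open_nbhs_nbhs xV).
Qed.

Section Tube.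
Variables X Y : topologicalType.

(** The tube lemma, for a compact set in the second factor. *)
Lemma tube (U : set (X * Y)) (L : set Y) (x : X) : open U -> compact L ->
  (forall y, L y -> U (x, y)) ->
  exists2 V : set X, open_nbhs x V & V `*` L `<=` U.
Proof.
move=> oU /compact_near_coveringP cL LU.
have : \forall x' \near x, L `<=` (fun y => U (x', y)).
  apply: (cL X (nbhs x) (fun x' y => U (x', y))) => y Ly.
  have : nbhs (x, y) U by apply: open_nbhs_nbhs; split => //; exact: LU.
  move=> [[A B] [/= nA nB] AB]; exists (B, A); first by split.
  by move=> [y' x'] [/= By Ax]; apply: AB; split.
rewrite /prop_near1 nbhsE => -[V xV VU]; exists V => // -[x' y'] [/= Vx Ly].
exact: (VU x').
Qed.

End Tube.

(** * Functions for which Tonelli's theorem holds *)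

Section EReal.
Variable R : realType.
Implicit Types a b c : \bar R.
Local Open Scope ereal_scope.

Lemma ge0_le_fin_num a b : 0 <= a -> a <= b -> b < +oo -> a \is a fin_num.
Proof. by move=> a0 ab bT; rewrite (ge0_fin_numE a0) (le_lt_trans ab bT). Qed.

Lemma sub_fin a b c : 0 <= a -> 0 <= b -> c < +oo -> a + b = c -> a = c - b.
Proof.
move=> a0 b0 cy abc; rewrite -abc addeK//.
by apply: ge0_le_fin_num cy => //; rewrite -abc leeDr.
Qed.

End EReal.

Section TonelliClass.
Variables (R : realType) (X : ptopologicalType).
Variable mu : {measure set (borel X) -> \bar R}.
Local Open Scope ereal_scope.
Implicit Types F : X * X -> \bar R.

(** The conclusion of Tonelli's theorem, taken as a property of [F].
    Measurability for the product sigma-algebra is not part of it: without a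
    countable base the Borel sets of [X * X] need not lie in that
    sigma-algebra. *)
Record tonelli F : Prop := {
  tonelli_ge0 : forall p, 0 <= F p;
  tonelli_secl : forall x, measurable_fun [set: borel X] (fun y : borel X => F (x, y));
  tonelli_secr : forall y, measurable_fun [set: borel X] (fun x : borel X => F (x, y));
  tonelli_intl : measurable_fun [set: borel X]
    (fun x : borel X => \int[mu]_y F (x, y));
  tonelli_intr : measurable_fun [set: borel X]
    (fun y : borel X => \int[mu]_x F (x, y));
  tonelliE : \int[mu]_x \int[mu]_y F (x, y) = \int[mu]_y \int[mu]_x F (x, y)
}.

Lemma tonelliD F1 F2 : tonelli F1 -> tonelli F2 ->
  tonelli (fun p => F1 p + F2 p).
Proof.
move=> [F1p F1l F1r F1L F1R F1E] [F2p F2l F2r F2L F2R F2E].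
have L x : \int[mu]_y (F1 (x, y) + F2 (x, y)) =
    \int[mu]_y F1 (x, y) + \int[mu]_y F2 (x, y) by rewrite ge0_integralD.
have R' y : \int[mu]_x (F1 (x, y) + F2 (x, y)) =
    \int[mu]_x F1 (x, y) + \int[mu]_x F2 (x, y) by rewrite ge0_integralD.
split.
- by move=> p; exact: adde_ge0.
- by move=> x; exact: emeasurable_funD.
- by move=> y; exact: emeasurable_funD.
- by under eq_fun do rewrite L; exact: emeasurable_funD.
- by under eq_fun do rewrite R'; exact: emeasurable_funD.
- under eq_integral do rewrite L; under [in RHS]eq_integral do rewrite R'.
  rewrite ge0_integralD; [|exact: measurableT
    |by move=> x _; exact: integral_ge0|exact: F1L
    |by move=> x _; exact: integral_ge0|exact: F2L].
  rewrite [in RHS]ge0_integralD; [|exact: measurableT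
    |by move=> x _; exact: integral_ge0|exact: F1R
    |by move=> x _; exact: integral_ge0|exact: F2R].
  by rewrite F1E F2E.
Qed.

Lemma tonelliZ (c : R) F : (0 <= c)%R -> tonelli F ->
  tonelli (fun p => c%:E * F p).
Proof.
move=> c0 [Fp Fl Fr FL FR FE].
have L x : \int[mu]_y (c%:E * F (x, y)) = c%:E * \int[mu]_y F (x, y).
  by rewrite ge0_integralZl.
have R' y : \int[mu]_x (c%:E * F (x, y)) = c%:E * \int[mu]_x F (x, y).
  by rewrite ge0_integralZl.
split.
- by move=> p; rewrite mule_ge0.
- by move=> x; exact: measurable_funeM.
- by move=> y; exact: measurable_funeM.
- by under eq_fun do rewrite L; exact: measurable_funeM.
- by under eq_fun do rewrite R'; exact: measurable_funeM.
- under eq_integral do rewrite L; under [in RHS]eq_integral do rewrite R'.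
  rewrite ge0_integralZl; [|exact: measurableT|exact: FL
    |by move=> x _; exact: integral_ge0|by rewrite lee_fin].
  rewrite [in RHS]ge0_integralZl; [|exact: measurableT|exact: FR
    |by move=> x _; exact: integral_ge0|by rewrite lee_fin].
  by rewrite FE.
Qed.

(** Monotone convergence makes the class stable under the increasing limits of
    lambda-systems and of approximations by simple functions. *)
Lemma tonelli_lim (F_ : (X * X -> \bar R)^nat) F :
  (forall n, tonelli (F_ n)) -> (forall p, nondecreasing_seq (F_ ^~ p)) ->
  (forall p, F_ n p @[n --> \oo] --> F p) -> tonelli F.
Proof.
move=> tF nd cF.
have FE : F = (fun p => limn (F_ ^~ p)).
  by apply/funext => p; apply/esym/cvg_lim => //; exact: cF.
have L x : \int[mu]_y F (x, y) = limn (fun n => \int[mu]_y F_ n (x, y)).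
  rewrite FE monotone_convergence//.
  - by move=> n; exact: (tonelli_secl (tF n)).
  - by move=> n y _; exact: (tonelli_ge0 (tF n)).
have R' y : \int[mu]_x F (x, y) = limn (fun n => \int[mu]_x F_ n (x, y)).
  rewrite FE monotone_convergence//.
  - by move=> n; exact: (tonelli_secr (tF n)).
  - by move=> n x _; exact: (tonelli_ge0 (tF n)).
have ndL x : nondecreasing_seq (fun n => \int[mu]_y F_ n (x, y)).
  move=> m n mn; apply: ge0_le_integral => //.
  - by move=> y _; exact: (tonelli_ge0 (tF m)).
  - exact: (tonelli_secl (tF m)).
  - exact: (tonelli_secl (tF n)).
  - by move=> y _; exact: (nd (x, y) _ _ mn).
have ndR y : nondecreasing_seq (fun n => \int[mu]_x F_ n (x, y)).
  move=> m n mn; apply: ge0_le_integral => //.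
  - by move=> x _; exact: (tonelli_ge0 (tF m)).
  - exact: (tonelli_secr (tF m)).
  - exact: (tonelli_secr (tF n)).
  - by move=> x _; exact: (nd (x, y) _ _ mn).
have cvg_nd (u : (\bar R)^nat) : nondecreasing_seq u -> u n @[n --> \oo] --> limn u.
  by move=> ndu; apply: ereal_nondecreasing_is_cvgn.
split.
- move=> p; rewrite FE; apply: lime_ge; first exact: ereal_nondecreasing_is_cvgn.
  by apply: nearW => n; exact: (tonelli_ge0 (tF n)).
- move=> x; apply: (emeasurable_fun_cvg (fun n (y : borel X) => F_ n (x, y))).
    by move=> n; exact: (tonelli_secl (tF n)).
  by move=> y _; exact: cF.
- move=> y; apply: (emeasurable_fun_cvg (fun n (x : borel X) => F_ n (x, y))).
    by move=> n; exact: (tonelli_secr (tF n)).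
  by move=> x _; exact: cF.
- apply: (emeasurable_fun_cvg (fun n (x : borel X) => \int[mu]_y F_ n (x, y))).
    by move=> n; exact: (tonelli_intl (tF n)).
  by move=> x _; rewrite L; exact: cvg_nd.
- apply: (emeasurable_fun_cvg (fun n (y : borel X) => \int[mu]_x F_ n (x, y))).
    by move=> n; exact: (tonelli_intr (tF n)).
  by move=> y _; rewrite R'; exact: cvg_nd.
- under eq_integral do rewrite L; under [in RHS]eq_integral do rewrite R'.
  transitivity (limn (fun n => \int[mu]_x \int[mu]_y F_ n (x, y))).
    apply: monotone_convergence => //.
    + by move=> n; exact: (tonelli_intl (tF n)).
    + by move=> n x _; apply: integral_ge0 => y _; exact: (tonelli_ge0 (tF n)).
  under eq_fun do rewrite (tonelliE (tF _)).
  apply/esym/monotone_convergence => //.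
  + by move=> n; exact: (tonelli_intr (tF n)).
  + by move=> n y _; apply: integral_ge0 => x _; exact: (tonelli_ge0 (tF n)).
Qed.

(** Where its integrals are finite, [F1] can be subtracted on both sides; with
    [tonelli_lim] this is what Dynkin's theorem asks for. *)
Lemma tonelliB F1 F2 : tonelli F1 -> tonelli F2 ->
  (forall p, F1 p <= F2 p) -> (forall p, F2 p < +oo) ->
  (forall x, \int[mu]_y F2 (x, y) < +oo) ->
  (forall y, \int[mu]_x F2 (x, y) < +oo) ->
  \int[mu]_x \int[mu]_y F2 (x, y) < +oo ->
  tonelli (fun p => F2 p - F1 p).
Proof.
move=> [F1p F1l F1r F1L F1R F1E] [F2p F2l F2r F2L F2R F2E] le12 F2fin fin2L fin2R fin2.
have F1fin p : F1 p \is a fin_num by exact: ge0_le_fin_num (F1p p) (le12 p) (F2fin p).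
have D0 p : 0 <= F2 p - F1 p by rewrite sube_ge0 ?F1fin// le12.
have DE p : F2 p - F1 p + F1 p = F2 p by rewrite (subeK _ (F1fin p)).
have ml x : measurable_fun [set: borel X] (fun y : borel X => F2 (x, y) - F1 (x, y)).
  exact: emeasurable_funB.
have mr y : measurable_fun [set: borel X] (fun x : borel X => F2 (x, y) - F1 (x, y)).
  exact: emeasurable_funB.
have L x : \int[mu]_y (F2 (x, y) - F1 (x, y)) =
    \int[mu]_y F2 (x, y) - \int[mu]_y F1 (x, y).
  apply: sub_fin; [exact: integral_ge0|exact: integral_ge0|exact: fin2L|].
  rewrite -ge0_integralD; [|exact: measurableT|by []|exact: ml|by []|exact: F1l].
  by apply: eq_integral => y _; rewrite DE.
have R' y : \int[mu]_x (F2 (x, y) - F1 (x, y)) =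
    \int[mu]_x F2 (x, y) - \int[mu]_x F1 (x, y).
  apply: sub_fin; [exact: integral_ge0|exact: integral_ge0|exact: fin2R|].
  rewrite -ge0_integralD; [|exact: measurableT|by []|exact: mr|by []|exact: F1r].
  by apply: eq_integral => x _; rewrite DE.
have mL : measurable_fun [set: borel X]
    (fun x : borel X => \int[mu]_y (F2 (x, y) - F1 (x, y))).
  by under eq_fun do rewrite L; exact: emeasurable_funB.
have mR : measurable_fun [set: borel X]
    (fun y : borel X => \int[mu]_x (F2 (x, y) - F1 (x, y))).
  by under eq_fun do rewrite R'; exact: emeasurable_funB.
split; [exact: D0|exact: ml|exact: mr|exact: mL|exact: mR|].
have DL x : \int[mu]_y (F2 (x, y) - F1 (x, y)) + \int[mu]_y F1 (x, y) =
    \int[mu]_y F2 (x, y).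
  rewrite L subeK//; apply: ge0_le_fin_num (fin2L x); first exact: integral_ge0.
  by apply: ge0_le_integral; [exact: measurableT|by []|exact: F1l|exact: F2l|by []].
have DR y : \int[mu]_x (F2 (x, y) - F1 (x, y)) + \int[mu]_x F1 (x, y) =
    \int[mu]_x F2 (x, y).
  rewrite R' subeK//; apply: ge0_le_fin_num (fin2R y); first exact: integral_ge0.
  by apply: ge0_le_integral; [exact: measurableT|by []|exact: F1r|exact: F2r|by []].
have intD0l x : setT x -> 0 <= \int[mu]_y (F2 (x, y) - F1 (x, y)).
  by move=> _; exact: integral_ge0.
have intD0r y : setT y -> 0 <= \int[mu]_x (F2 (x, y) - F1 (x, y)).
  by move=> _; exact: integral_ge0.
have int10l x : setT x -> 0 <= \int[mu]_y F1 (x, y).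
  by move=> _; exact: integral_ge0.
have int10r y : setT y -> 0 <= \int[mu]_x F1 (x, y).
  by move=> _; exact: integral_ge0.
transitivity (\int[mu]_x \int[mu]_y F2 (x, y) - \int[mu]_x \int[mu]_y F1 (x, y)).
  apply: sub_fin fin2 _; [exact: integral_ge0|exact: integral_ge0|].
  rewrite -ge0_integralD; [|exact: measurableT|exact: intD0l|exact: mL|exact: int10l|exact: F1L].
  by apply: eq_integral => x _; rewrite DL.
rewrite F1E F2E; apply/esym; apply: sub_fin; [exact: integral_ge0|exact: integral_ge0|by rewrite -F2E|].
rewrite -ge0_integralD; [|exact: measurableT|exact: intD0r|exact: mR|exact: int10r|exact: F1R].
by apply: eq_integral => y _; rewrite DR.
Qed.

End TonelliClass.

(** * Sections of open sets *)

Section OpenSections.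
Variables (R : realType) (X : ptopologicalType).
Variable mu : {measure set (borel X) -> \bar R}.
Hypothesis hX : hausdorff_space X.
Hypothesis inner : forall U : set X, open U ->
  mu U = ereal_sup [set mu K | K in [set K : set X | compact K /\ K `<=` U]].
Local Open Scope ereal_scope.

Definition rectangles : set (set (X * X)) :=
  [set E | exists A B : set (borel X), [/\ measurable A, measurable B & E = A `*` B]].

Lemma compact_borel (K : set X) : compact K -> measurable (K : set (borel X)).
Proof. by move=> cK; apply: borel_closed; exact: compact_closed. Qed.

Lemma inner_lt (U : set X) (a : \bar R) : open U -> a < mu U ->
  exists K, [/\ compact K, K `<=` U & a < mu K].
Proof.
move=> oU; rewrite inner// => /ereal_sup_gt[_ [K [cK KU] <-] aK].
by exists K; split.
Qed.

(** [K j] misses at most [1 / (j + 1)] of the measure of [U]. *)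
Lemma inner_exhaust (U : set X) : open U -> mu U < +oo ->
  exists K : nat -> set X, [/\ forall j, compact (K j), forall j, K j `<=` U &
    mu (U `\` \bigcup_j K j) = 0].
Proof.
move=> oU Uoo.
have Ufin : mu U \is a fin_num by rewrite ge0_fin_numE.
have /choice[K HK] (j : nat) : exists K, [/\ compact K, K `<=` U &
    mu U - (j.+1%:R^-1)%:E < mu K].
  by apply: inner_lt => //; rewrite lte_subel_addr// lteDl// lte_fin invr_gt0.
have mK j : measurable (K j : set (borel X)).
  by apply: compact_borel; have [] := HK j.
have mU : measurable (U : set (borel X)) by exact: borel_open.
exists K; split; [by move=> j; have [] := HK j|by move=> j; have [] := HK j|].
apply/eqP; rewrite eq_le measure_ge0 andbT; apply/lee_addgt0Pr => e e0.
rewrite add0e; have [j] := ltr_add_invr e0; rewrite add0r => je.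
apply: (@le_trans _ _ (mu (U `\` K j))).
  apply: le_measure; rewrite ?inE.
  - by apply: measurableD => //; exact: bigcupT_measurable.
  - exact: measurableD.
  - by apply: setDS; exact: bigcup_sup.
have [_ KU ltK] := HK j.
rewrite measureD//.
rewrite (setIidr KU) lee_subel_addl//.
move: ltK; rewrite lte_subel_addr// => /ltW/le_trans; apply.
by rewrite leeD2l// lee_fin ltW.
Qed.

(** A compact slice above [x] inside an open set persists above a
    neighbourhood of [x]. This is where rectangles inside [U] come from; it
    also makes the measure of sections lower semicontinuous
    ([open_section_gt]). *)
Lemma section_gt_rect (U : set (X * X)) (x : X) (a : \bar R) : open U ->
  a < mu (xsection U x) ->
  exists V L : set X, [/\ open V, V x, compact L, V `*` L `<=` U & a < mu L].
Proof.
move=> oU aU.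
have oUx : open (xsection U x).
  by rewrite xsectionE; apply: open_comp => // y _; exact: pair_l_continuous.
have [L [cL LU aL]] := inner_lt oUx aU.
have [|V [oV Vx] VU] := @tube _ _ U L x oU cL.
  by move=> y /LU/xsectionP.
by exists V, L; split.
Qed.

Lemma open_section_gt (U : set (X * X)) (a : \bar R) : open U ->
  open [set x | a < mu (xsection U x)].
Proof.
move=> oU; apply: open_pointwise => x /=.
move=> /(section_gt_rect oU)[V [L [oV Vx cL VL aL]]]; exists V => //.
move=> x' Vx' /=; apply: (lt_le_trans aL); apply: le_measure; rewrite ?inE.
- exact: compact_borel.
- apply: borel_open; rewrite xsectionE.
  by apply: open_comp => // y _; exact: pair_l_continuous.
- by move=> y Ly; apply/xsectionP; apply: VL; split.
Qed.

(** Finitely many of the rectangles of [section_gt_rect] suffice above the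
    compact set [K]. *)
Lemma compact_section_gt (U : set (X * X)) (K : set X) (a : \bar R) : open U ->
  compact K -> (forall x, K x -> a < mu (xsection U x)) ->
  exists D : set (X * X), [/\ <<s rectangles >> D, D `<=` U &
    forall x, K x -> a < mu (xsection D x)].
Proof.
move=> oU; rewrite compact_cover => cK aU.
have /choice[VL HVL] (x : X) : exists VL : set X * set X, K x ->
    [/\ open VL.1, VL.1 x, compact VL.2, VL.1 `*` VL.2 `<=` U & a < mu VL.2].
  have [Kx|nKx] := pselect (K x); last by exists (set0, set0).
  by have [V [L H]] := section_gt_rect oU (aU x Kx); exists (V, L).
have [|x Kx|D' D'K KD'] := cK X K (fun x => (VL x).1).
- by move=> x /HVL[].
- by exists x => //; have [] := HVL x Kx.
have D'K' x : [set` D'] x -> K x by move=> /D'K; rewrite inE.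
pose S : measurableType _ := g_sigma_algebraType rectangles.
have mrect x : [set` D'] x -> measurable ((VL x).1 `*` (VL x).2 : set S).
  move=> /D'K'/HVL[oV _ cL _ _]; apply: sub_sigma_algebra.
  exists (VL x).1, (VL x).2; split => //; first exact: borel_open.
  exact: compact_borel.
exists (\bigcup_(x in [set` D']) ((VL x).1 `*` (VL x).2)); split.
- have := @fin_bigcup_measurable _ S _ [set` D'] (fun x => (VL x).1 `*` (VL x).2).
  by apply => //; exact: finite_fset.
- by move=> p [x /= xD']; have [_ _ _ + _] := HVL x (D'K' x xD'); apply.
- move=> x /KD'[z zD' Vzx]; have [oV Vz cL VLU aL] := HVL z (D'K' z zD').
  apply: (lt_le_trans aL); apply: le_measure; rewrite ?inE.
  + exact: compact_borel.
  + rewrite xsectionE preimage_bigcup; apply: fin_bigcup_measurable.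
      exact: finite_fset.
    move=> i /= iD'; have [_ _ ciL _ _] := HVL i (D'K' i iD').
    rewrite -xsectionE.
    have [xV|xV] := boolP (x \in (VL i).1).
      by rewrite in_xsectionX//; exact: compact_borel.
    by rewrite notin_xsectionX.
  + by move=> y Ly; apply/xsectionP; exists z.
Qed.

End OpenSections.

(** * A lambda-system of sets for which Tonelli's theorem holds *)

Section Indicators.
Variables (R : realType) (T : Type).
Implicit Types A B : set T.

Lemma le_indic A B p : A `<=` B -> (\1_A p <= \1_B p :> R)%R.
Proof.
move=> AB; rewrite !indicE ler_nat; have [|//] := boolP (p \in A).
by rewrite inE => /AB pB; rewrite mem_set.
Qed.

Lemma indicB A B p : B `<=` A -> (\1_(A `\` B) p = \1_A p - \1_B p :> R)%R.
Proof.
move=> BA; rewrite !indicE in_setD; have [|] := boolP (p \in B).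
  by rewrite inE => /BA pA; rewrite mem_set//= subrr.
by rewrite subr0 andbT.
Qed.

Lemma cvg_indic_bigcup (F : nat -> set T) p : nondecreasing_seq F ->
  (\1_(F n) p)%:E @[n --> \oo] --> (\1_(\bigcup_n F n) p : R)%:E.
Proof.
move=> ndF; have [[n _ Fnp]|nF] := pselect ((\bigcup_n F n) p).
  apply: cvg_near_cst; near=> m; rewrite !indicE.
  have nm : (n <= m)%N by near: m; exists n.
  rewrite !mem_set//; first by exists n.
  by move/subsetPset : (ndF _ _ nm); apply.
apply: cvg_near_cst; near=> m; rewrite !indicE !memNset// => Fm.
by apply: nF; exists m.
Unshelve. all: by end_near. Qed.

End Indicators.

Section TonelliSets.
Variables (R : realType) (X : ptopologicalType).
Variable mu : {measure set (borel X) -> \bar R}.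
Local Open Scope ereal_scope.

Lemma int_indic_secl (E : set (X * X)) x : measurable (xsection E x : set (borel X)) ->
  \int[mu]_y (\1_E (x, y))%:E = mu (xsection E x).
Proof.
move=> mE; rewrite -[xsection E x]setIT -integral_indic//.
apply: eq_integral => y _; congr (_%:E); rewrite !indicE; congr (_%:R).
by rewrite mem_xsection.
Qed.

Lemma int_indic_secr (E : set (X * X)) y : measurable (ysection E y : set (borel X)) ->
  \int[mu]_x (\1_E (x, y))%:E = mu (ysection E y).
Proof.
move=> mE; rewrite -[ysection E y]setIT -integral_indic//.
apply: eq_integral => x _; congr (_%:E); rewrite !indicE; congr (_%:R).
by rewrite mem_ysection.
Qed.

Lemma tonelli_rect (A B : set (borel X)) : measurable A -> measurable B ->
  tonelli mu (fun p => (\1_(A `*` B) p)%:E).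
Proof.
move=> mA mB.
have rectE (x y : borel X) :
    (\1_(A `*` B) (x, y))%:E = (\1_A x)%:E * (\1_B y)%:E :> \bar R.
  by rewrite -EFinM !indicE in_setX; case: (_ \in A); case: (_ \in B); rewrite /= ?mulr1 ?mulr0.
have mindic (C : set (borel X)) : measurable C ->
    measurable_fun [set: borel X] (fun x : borel X => (\1_C x)%:E : \bar R).
  by move=> mC; apply/measurable_EFinP; exact: measurable_indic.
have L x : \int[mu]_y (\1_(A `*` B) (x, y))%:E = (\1_A x)%:E * mu B.
  under eq_integral do rewrite rectE.
  rewrite ge0_integralZl; [|exact: measurableT|exact: mindic
    |by move=> y _; rewrite lee_fin|by rewrite lee_fin].
  by rewrite integral_indic// setIT.
have R' y : \int[mu]_x (\1_(A `*` B) (x, y))%:E = mu A * (\1_B y)%:E.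
  under eq_integral do rewrite rectE.
  rewrite ge0_integralZr; [|exact: measurableT|exact: mindic
    |by move=> x _; rewrite lee_fin|by rewrite lee_fin].
  by rewrite integral_indic// setIT.
split.
- by move=> p; rewrite lee_fin.
- move=> x; under eq_fun do rewrite rectE.
  by apply: measurable_funeM; exact: mindic.
- move=> y; under eq_fun do rewrite rectE muleC.
  by apply: measurable_funeM; exact: mindic.
- under eq_fun do rewrite L muleC.
  by apply: measurable_funeM; exact: mindic.
- under eq_fun do rewrite R'.
  by apply: measurable_funeM; exact: mindic.
- under eq_integral do rewrite L; under [in RHS]eq_integral do rewrite R'.
  rewrite ge0_integralZr; [|exact: measurableT|exact: mindic
    |by move=> x _; rewrite lee_fin|exact: measure_ge0].
  rewrite ge0_integralZl; [|exact: measurableT|exact: mindic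
    |by move=> x _; rewrite lee_fin|exact: measure_ge0].
  by rewrite !integral_indic// !setIT.
Qed.

Variable H : set X.
Hypothesis oH : open H.
Hypothesis Hoo : mu H < +oo.

(** Cutting with [H * H] makes all the integrals finite, so that the class is
    stable under proper differences. *)
Definition tonelli_sets : set (set (X * X)) :=
  [set E | tonelli mu (fun p => (\1_(E `&` (H `*` H)) p)%:E)].

Lemma tonelli_sets_lambda : lambda_system setT tonelli_sets.
Proof.
have mH : measurable (H : set (borel X)) by exact: borel_open.
have THH : tonelli mu (fun p => (\1_(H `*` H) p)%:E) by exact: tonelli_rect.
have le1 (E : set (X * X)) p : (\1_(E `&` (H `*` H)) p)%:E <= (\1_(H `*` H) p)%:E :> \bar R.
  by rewrite lee_fin; apply: le_indic => q [].
have finL x : \int[mu]_y (\1_(H `*` H) (x, y))%:E < +oo.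
  rewrite int_indic_secl; have [xH|xH] := boolP (x \in H).
  - by rewrite in_xsectionX.
  - by rewrite notin_xsectionX// measure0.
  - by rewrite in_xsectionX.
  - by rewrite notin_xsectionX.
have finR y : \int[mu]_x (\1_(H `*` H) (x, y))%:E < +oo.
  rewrite int_indic_secr; have [yH|yH] := boolP (y \in H).
  - by rewrite in_ysectionX.
  - by rewrite notin_ysectionX// measure0.
  - by rewrite in_ysectionX.
  - by rewrite notin_ysectionX.
have fin2 : \int[mu]_x \int[mu]_y (\1_(H `*` H) (x, y))%:E < +oo.
  have -> : (fun x => \int[mu]_y (\1_(H `*` H) (x, y))%:E) =
      (fun x => (mu H) * (\1_H x)%:E).
    apply/funext => x /=; rewrite int_indic_secl ?indicE; have [xH|xH] := boolP (x \in H).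
    - by rewrite in_xsectionX// mule1.
    - by rewrite notin_xsectionX// measure0 mule0.
    - by rewrite in_xsectionX.
    - by rewrite notin_xsectionX.
  rewrite ge0_integralZl; [|exact: measurableT|
    by apply/measurable_EFinP; exact: measurable_indic
    |by move=> x _; rewrite lee_fin|exact: measure_ge0].
  by rewrite integral_indic// setIT lte_mul_pinfty// ge0_fin_numE.
split; [by move=> A _ x _|by rewrite /tonelli_sets /= setTI| |].
- move=> A B BA TA TB; rewrite /tonelli_sets /=.
  have -> : (fun p => (\1_((A `\` B) `&` (H `*` H)) p)%:E : \bar R) =
     (fun p => (\1_(A `&` (H `*` H)) p)%:E - (\1_(B `&` (H `*` H)) p)%:E).
    apply/funext => p; rewrite -EFinB -indicB; last exact: setSI.
    suff -> : (A `\` B) `&` (H `*` H) = (A `&` (H `*` H)) `\` (B `&` (H `*` H)) by [].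
    apply/seteqP; split => q.
      by move=> [[Aq nBq] HHq]; split => // -[].
    by move=> [[Aq HHq] nBHq]; split => //; split => // Bq; apply: nBHq.
  have le1' p : (\1_(A `&` (H `*` H)) p)%:E <= (\1_(H `*` H) p)%:E :> \bar R.
    exact: le1.
  have intL x : \int[mu]_y (\1_(A `&` (H `*` H)) (x, y))%:E <=
      \int[mu]_y (\1_(H `*` H) (x, y))%:E.
    apply: ge0_le_integral; [exact: measurableT|by move=> y _; rewrite lee_fin
      |exact: (tonelli_secl TA)|exact: (tonelli_secl THH)|by []].
  have intR y : \int[mu]_x (\1_(A `&` (H `*` H)) (x, y))%:E <=
      \int[mu]_x (\1_(H `*` H) (x, y))%:E.
    apply: ge0_le_integral; [exact: measurableT|by move=> x _; rewrite lee_fin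
      |exact: (tonelli_secr TA)|exact: (tonelli_secr THH)|by []].
  apply: tonelliB; [exact: TB|exact: TA| | | | |].
  + by move=> p; rewrite lee_fin; apply: le_indic; exact: setSI.
  + by move=> p; rewrite ltry.
  + by move=> x; exact: le_lt_trans (intL x) (finL x).
  + by move=> y; exact: le_lt_trans (intR y) (finR y).
  + apply: le_lt_trans fin2; apply: ge0_le_integral; first exact: measurableT.
    * by move=> x _; apply: integral_ge0 => y _; rewrite lee_fin.
    * exact: (tonelli_intl TA).
    * exact: (tonelli_intl THH).
    * by [].
- move=> F ndF TF; rewrite /tonelli_sets /=.
  apply: (@tonelli_lim _ _ _ (fun n p => (\1_(F n `&` (H `*` H)) p)%:E)) => //.
  + move=> p m n mn; rewrite lee_fin; apply: le_indic; apply: setSI.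
    by move/subsetPset: (ndF _ _ mn).
  + move=> p; rewrite setI_bigcupl; apply: cvg_indic_bigcup => m n mn.
    apply/subsetPset; apply: setSI.
    by move/subsetPset: (ndF _ _ mn).
Qed.

End TonelliSets.

(** * Tonelli's theorem for regular Borel measures *)

Section BorelTonelli.
Variables (R : realType) (X : ptopologicalType).
Variable mu : {measure set (borel X) -> \bar R}.
Hypothesis hX : hausdorff_space X.
Hypothesis inner : forall U : set X, open U ->
  mu U = ereal_sup [set mu K | K in [set K : set X | compact K /\ K `<=` U]].
Local Open Scope ereal_scope.

Lemma lt_rat_lt (a b : \bar R) : 0 <= a -> a < b ->
  exists q : rat, a < (ratr q)%:E < b.
Proof.
case: a => // [a|] _; last by rewrite ltNge leey.
case: b => [b| |]//.
- by rewrite lte_fin => /rat_in_itvoo[q /itvP qab]; exists q; rewrite !lte_fin !qab.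
- have /rat_in_itvoo[q /itvP qab] : (a < a + 1)%R by rewrite ltrDl.
  by move=> _; exists q; rewrite lte_fin qab ltry.
Qed.

Lemma rectangles_setI_closed : setI_closed (@rectangles X).
Proof.
move=> _ _ [A [B [mA mB ->]]] [C [D [mC mD ->]]].
exists (A `&` C), (B `&` D); split; [exact: measurableI|exact: measurableI|].
by rewrite setXI.
Qed.

(** Dynkin's theorem, the rectangles being stable under intersection. *)
Lemma rectangles_tonelli_sets (H : set X) : open H -> mu H < +oo ->
  <<s (@rectangles X) >> `<=` tonelli_sets mu H.
Proof.
move=> oH Hoo; apply: lambda_system_subset.
- exact: rectangles_setI_closed.
- exact: tonelli_sets_lambda.
- move=> _ [A [B [mA mB ->]]]; rewrite /tonelli_sets /= -setXI.
  by apply: tonelli_rect; apply: measurableI => //; exact: borel_open.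
- by [].
Qed.

Lemma open_xsection (U : set (X * X)) (x : X) : open U -> open (xsection U x).
Proof.
by move=> oU; rewrite xsectionE; apply: open_comp => // y _; exact: pair_l_continuous.
Qed.

Lemma open_ysection (U : set (X * X)) (y : X) : open U -> open (ysection U y).
Proof.
by move=> oU; rewrite ysectionE; apply: open_comp => // x _; exact: pair_r_continuous.
Qed.

Lemma measurable_open_section (U : set (X * X)) : open U ->
  measurable_fun [set: borel X] (fun x : borel X => mu (xsection U x)).
Proof.
move=> oU; apply: (measurability _ (ErealGenOInfty.measurableE R)).
move=> _ [_ [a ->] <-]; rewrite setTI preimage_itvoy; apply: borel_open.
exact: open_section_gt.
Qed.

(** The sets where the section measure of [U] exceeds a rational are open, so up
    to null sets they are exhausted by countably many compact sets, and each of
    these only involves finitely many rectangles inside [U]. *)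
Lemma open_rectangles (H : set X) (U : set (X * X)) :
  open H -> mu H < +oo -> open U -> U `<=` H `*` H ->
  exists W : set (X * X), [/\ <<s (@rectangles X) >> W, W `<=` U &
    {ae mu, forall x : borel X, mu (xsection U x) = mu (xsection W x)}].
Proof.
move=> oH Hoo oU UH.
pose r (k : nat) : R := ratr (odflt 0%R (@choice.unpickle rat k)).
pose O k := H `&` [set x | (r k)%:E < mu (xsection U x)].
have oO q : open (O q) by apply: openI => //; exact: open_section_gt.
have Ooo q : mu (O q) < +oo.
  apply: le_lt_trans Hoo; apply: le_measure; rewrite ?inE; last by move=> x [].
  - exact: borel_open.
  - exact: borel_open.
have /choice[K HK] q := inner_exhaust hX inner (oO q) (Ooo q).
have HD (qj : nat * nat) : exists D : set (X * X), [/\ <<s (@rectangles X) >> D, D `<=` U &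
    forall x, K qj.1 qj.2 x -> (r qj.1)%:E < mu (xsection D x)].
  have [cK KO _] := HK qj.1.
  apply: (compact_section_gt hX inner oU (cK qj.2)).
  by move=> x /KO[].
have /choice[D {}HD] := HD.
pose S : measurableType _ := g_sigma_algebraType (@rectangles X).
pose W := \bigcup_j \bigcup_q D (q, j).
have mW : <<s (@rectangles X) >> W.
  apply: (@bigcupT_measurable _ S) => j.
  by apply: (@bigcupT_measurable _ S) => q; have [] := HD (q, j).
have WU : W `<=` U by move=> p [j _ [q _]]; have [_ + _] := HD (q, j); apply.
exists W; split => //.
pose N q := O q `\` \bigcup_j K q j.
have mN q : measurable (N q : set (borel X)).
  apply: measurableD; first exact: borel_open.
  apply: bigcupT_measurable => j; apply: compact_borel => //.
  by have [+ _ _] := HK q; apply.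
have N0 q : mu (N q) = 0 by have [] := HK q.
have msec (E : set (X * X)) x : <<s (@rectangles X) >> E ->
    measurable (xsection E x : set (borel X)).
  move=> sE; rewrite xsectionE -[X in measurable X]setTI.
  have : measurable_fun [set: borel X] ((fun y => (x, y)) : borel X -> S).
    apply: (measurability (@rectangles X : set (set S)) erefl).
    move=> _ [_ [A [B [mA mB ->]] <-]]; rewrite setTI -xsectionE.
    have [xA|xA] := boolP (x \in A); first by rewrite in_xsectionX.
    by rewrite notin_xsectionX.
  by apply => //; exact: sE.
have mU x : measurable (xsection U x : set (borel X)).
  by apply: borel_open; exact: open_xsection.
have NN : mu.-negligible (\bigcup_q N q).
  by apply: negligible_bigcup => q; exists (N q); split; [exact: mN|exact: N0|].
apply: negligibleS NN => x /=; apply: contra_notP => nN.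
apply/eqP; rewrite eq_le; apply/andP; split; last first.
  by apply: le_measure; rewrite ?inE; [exact: msec|exact: mU|exact: le_xsection].
rewrite leNgt; apply/negP => /(lt_rat_lt (measure_ge0 _ _))[q /andP[Wq qU]].
have rq : r (choice.pickle q) = ratr q by rewrite /r choice.pickleK.
have Ox : O (choice.pickle q) x.
  split; last by rewrite /= rq.
  have [[y /xsectionP/UH[]//]|U0] := pselect (exists y, xsection U x y).
  have U0' : xsection U x = set0 by apply/seteqP; split => // y Uy; apply: U0; exists y.
  by move: (lt_trans Wq qU); rewrite U0' measure0 ltNge measure_ge0.
have [j Kj] : exists j, K (choice.pickle q) j x.
  apply: contrapT => nK; apply: nN; exists (choice.pickle q) => //; split => // -[j _ Kj].
  by apply: nK; exists j.
have [mD _ /(_ _ Kj)] := HD (choice.pickle q, j).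
rewrite /= rq => qD.
suff : (ratr q)%:E < mu (xsection W x) by rewrite ltNge (ltW Wq).
apply: (lt_le_trans qD); apply: le_measure; rewrite ?inE; [exact: msec|exact: msec|].
by apply: le_xsection => p Dp; exists j => //; exists (choice.pickle q).
Qed.

Definition swap_set (U : set (X * X)) : set (X * X) := [set p | U (p.2, p.1)].

Lemma ysection_swap (U : set (X * X)) y : ysection U y = xsection (swap_set U) y.
Proof. by rewrite ysectionE xsectionE. Qed.

Lemma open_swap (U : set (X * X)) : open U -> open (swap_set U).
Proof.
by move=> oU; apply: open_comp => // p _; apply: cvg_pair; [exact: cvg_snd|exact: cvg_fst].
Qed.

(** Replacing [U] by the set [W] of [open_rectangles] preserves the integral
    on the left, allows the exchange, and can only decrease the integral on
    the right. Applied to [U] with its two factors swapped, this gives the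
    opposite inequality. *)
Lemma le_iterated_open (H : set X) (U : set (X * X)) :
  open H -> mu H < +oo -> open U -> U `<=` H `*` H ->
  \int[mu]_x \int[mu]_y (\1_U (x, y))%:E <= \int[mu]_y \int[mu]_x (\1_U (x, y))%:E.
Proof.
move=> oH Hoo oU UH.
have [W [sW WU UW]] := open_rectangles oH Hoo oU UH.
have /= := rectangles_tonelli_sets oH Hoo sW.
rewrite /tonelli_sets /= setIidl; last exact: subset_trans UH.
move=> TW.
have mR (y : borel X) : measurable_fun [set: borel X]
    (fun x : borel X => (\1_U (x, y))%:E : \bar R).
  apply/measurable_EFinP.
  rewrite (_ : (fun x : borel X => _) = \1_(ysection U y) :> (borel X -> R)); last first.
    by apply/funext => x; rewrite !indicE mem_ysection.
  by apply: measurable_indic; apply: borel_open; exact: open_ysection.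
have RU (y : borel X) : \int[mu]_x (\1_U (x, y))%:E = mu (ysection U y).
  by rewrite int_indic_secr//; apply: borel_open; exact: open_ysection.
have LU (x : borel X) : \int[mu]_y (\1_U (x, y))%:E = mu (xsection U x).
  by rewrite int_indic_secl//; by apply: borel_open; exact: open_xsection.
apply: (@le_trans _ _ (\int[mu]_x \int[mu]_y (\1_W (x, y))%:E)).
  apply: ae_ge0_le_integral => //.
  - by move=> x _; apply: integral_ge0 => y _; rewrite lee_fin.
  - under eq_fun do rewrite LU; exact: measurable_open_section.
  - by move=> x _; apply: integral_ge0 => y _; rewrite lee_fin.
  - exact: (tonelli_intl TW).
  - apply: filterS UW => x /= UW _; rewrite LU UW.
    rewrite int_indic_secl//.
    have := tonelli_secl TW x => /measurable_EFinP/(_ measurableT [set 1%R] (measurable_set1 _)).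
    rewrite setTI; congr measurable; apply/seteqP; split => y /=.
      by rewrite indicE => /eqP; rewrite pnatr_eq1 eqb1 => /set_mem Wxy; apply/xsectionP.
    by move=> /xsectionP Wxy; rewrite indicE mem_set.
rewrite (tonelliE TW); apply: ge0_le_integral => //.
- by move=> y _; apply: integral_ge0 => x _; rewrite lee_fin.
- exact: (tonelli_intr TW).
- under eq_fun do rewrite RU ysection_swap.
  by apply: measurable_open_section; exact: open_swap.
- move=> y _; apply: ge0_le_integral => //.
  + exact: (tonelli_secr TW).
  + by move=> x _; rewrite lee_fin; exact: le_indic.
Qed.

Lemma tonelli_open (H : set X) (U : set (X * X)) :
  open H -> mu H < +oo -> open U -> U `<=` H `*` H ->
  tonelli mu (fun p => (\1_U p)%:E).
Proof.
move=> oH Hoo oU UH.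
have mL x : measurable (xsection U x : set (borel X)).
  by apply: borel_open; exact: open_xsection.
have mR y : measurable (ysection U y : set (borel X)).
  by apply: borel_open; exact: open_ysection.
split.
- by move=> p; rewrite lee_fin.
- move=> x; apply/measurable_EFinP.
  rewrite (_ : (fun y : borel X => _) = \1_(xsection U x) :> (borel X -> R)).
    exact: measurable_indic.
  by apply/funext => y; rewrite !indicE mem_xsection.
- move=> y; apply/measurable_EFinP.
  rewrite (_ : (fun x : borel X => _) = \1_(ysection U y) :> (borel X -> R)).
    exact: measurable_indic.
  by apply/funext => x; rewrite !indicE mem_ysection.
- under eq_fun do rewrite int_indic_secl//.
  exact: measurable_open_section.
- under eq_fun do rewrite int_indic_secr// ysection_swap.
  by apply: measurable_open_section; exact: open_swap.
- apply: le_anti; rewrite (le_iterated_open oH Hoo oU UH) /=.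
  have sUH : swap_set U `<=` H `*` H by move=> [x y] /UH[].
  exact: (le_iterated_open oH Hoo (open_swap oU) sUH).
Qed.

Lemma open_rect (A B : set X) : open A -> open B -> open (A `*` B).
Proof.
move=> oA oB; rewrite (_ : A `*` B = fst @^-1` A `&` snd @^-1` B)//.
by apply: openI; apply: open_comp => // p _; [exact: cvg_fst|exact: cvg_snd].
Qed.

(** Dynkin's theorem once more, the open sets being stable under
    intersection. *)
Lemma borel_tonelli_sets (H : set X) (E : set (X * X)) : open H -> mu H < +oo ->
  measurable (E : set (borel (X * X)%type)) -> tonelli_sets mu H E.
Proof.
move=> oH Hoo; apply: lambda_system_subset.
- by move=> A B; exact: openI.
- exact: tonelli_sets_lambda.
- move=> U oU; apply: (tonelli_open oH Hoo) => //.
  by apply: openI => //; exact: open_rect.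
- by [].
Qed.

Variable H : nat -> set X.
Hypothesis oH : forall n, open (H n).
Hypothesis Hoo : forall n, mu (H n) < +oo.
Hypothesis ndH : forall n, H n `<=` H n.+1.
Hypothesis HT : \bigcup_n H n = setT.

Lemma exhaustion_nondecreasing : nondecreasing_seq H.
Proof. by apply/nondecreasing_seqP => n; apply/subsetPset; exact: ndH. Qed.

Lemma borel_tonelli_indic (E : set (X * X)) :
  measurable (E : set (borel (X * X)%type)) -> tonelli mu (fun p => (\1_E p)%:E).
Proof.
move=> mE.
have ndHH : nondecreasing_seq (fun n => E `&` (H n `*` H n)).
  move=> m n mn; apply/subsetPset => -[x y] [Exy [/= Hx Hy]]; split => //.
  by have /subsetPset Hmn := exhaustion_nondecreasing mn; split; exact: Hmn.
have EHH : \bigcup_n (E `&` (H n `*` H n)) = E.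
  apply/seteqP; split => [p [n _ []//]|[x y] Exy].
  have [n _ Hx] : (\bigcup_n H n) x by rewrite HT.
  have [m _ Hy] : (\bigcup_n H n) y by rewrite HT.
  have /subsetPset nM := exhaustion_nondecreasing (leq_maxl n m).
  have /subsetPset mM := exhaustion_nondecreasing (leq_maxr n m).
  by exists (maxn n m) => //; split => //; split; [exact: nM|exact: mM].
apply: (@tonelli_lim _ _ _ (fun n p => (\1_(E `&` (H n `*` H n)) p)%:E)).
- by move=> n; exact: borel_tonelli_sets.
- move=> p m n mn; rewrite lee_fin; apply: le_indic.
  by have /subsetPset := ndHH _ _ mn.
- by move=> p; rewrite -[in X in _ --> X]EHH; exact: cvg_indic_bigcup.
Qed.

Import HBNNSimple.

(** Tonelli's theorem for Borel functions on the product. When [X] has no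
    countable base the Borel sets of the product need not be generated by
    rectangles; regularity of the measure takes the place of countability. *)
Theorem borel_tonelli (F : X * X -> \bar R) :
  measurable_fun [set: borel (X * X)%type] (F : borel (X * X)%type -> \bar R) ->
  (forall p, 0 <= F p) -> tonelli mu F.
Proof.
move=> mF F0.
pose F_ := nnsfun_approx (measurableT : measurable [set: borel (X * X)%type]) mF.
apply: (@tonelli_lim _ _ _ (fun n p => (F_ n p)%:E)).
- move=> n.
  rewrite (_ : (fun p => _) = (fun p => \sum_(k \in range (F_ n))
      (k%:E * (\1_(F_ n @^-1` [set k]) p)%:E))); last first.
    by apply/funext => p; rewrite fimfunE -fsumEFin//.
  rewrite (_ : (fun p => _) = (fun p => \sum_(k <- fset_set (range (F_ n)))
      (k%:E * (\1_(F_ n @^-1` [set k]) p)%:E))); last first.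
    by apply/funext => p; rewrite fsbig_finite.
  elim: (fset_set _ : seq R) => [|k s IHs].
    under eq_fun do rewrite big_nil.
    have := borel_tonelli_indic measurable0.
    by under eq_fun do rewrite indic0.
  under eq_fun do rewrite big_cons.
  apply: tonelliD; last exact: IHs.
  have [k0|k0] := leP 0%R k.
    apply: (tonelliZ k0); apply: borel_tonelli_indic.
    by rewrite -[X in measurable X]setTI; exact: measurable_funP.
  rewrite preimage_nnfun0//.
  have := borel_tonelli_indic measurable0.
  by under eq_fun do rewrite indic0; under [in X in _ -> X]eq_fun do rewrite indic0 mule0.
- by move=> p m n mn; rewrite lee_fin; by have := nd_nnsfun_approx measurableT mF mn => /lefP; exact.
- by move=> p; apply: cvg_nnsfun_approx.
Qed.

End BorelTonelli.

(** * Haar measure: Tonelli's theorem and unimodularity *)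

HB.instance Definition _ (X Y : ptopologicalType) := Pointed.on (X * Y)%type.

Lemma borel_comp (X Y : ptopologicalType) d (T : measurableType d) (f : Y -> T)
  (h : X -> Y) : measurable_fun [set: borel Y] (f : borel Y -> T) -> continuous h ->
  measurable_fun [set: borel X] ((f \o h) : borel X -> T).
Proof.
by move=> mf /borel_continuous mh; exact: (measurableT_comp mf mh).
Qed.

Section Haar.
Variables (R : realType) (G : topologicalGroupType).
Variable mu : {measure set (borel G) -> \bar R}.
Hypothesis mu_haar : haar_measure mu.
Local Open Scope ereal_scope.

Lemma mulg_left_continuous (z : G) : continuous (fun x : G => (z * x)%g).
Proof.
move=> x; apply: (@continuous_comp _ _ _ (fun y => (z, y)) (fun p : G * G => (p.1 * p.2)%g)).
  exact: pair_l_continuous.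
exact: mulg_continuous.
Qed.

Lemma mulg_right_continuous (z : G) : continuous (fun x : G => (x * z)%g).
Proof.
move=> x; apply: (@continuous_comp _ _ _ (fun y => (y, z)) (fun p : G * G => (p.1 * p.2)%g)).
  exact: pair_r_continuous.
exact: mulg_continuous.
Qed.

Lemma ldiv_continuous : continuous (fun p : G * G => (p.2^-1 * p.1)%g).
Proof.
move=> p; apply: (@continuous_comp _ _ _ (fun q : G * G => (q.2^-1, q.1)%g)
  (fun q : G * G => (q.1 * q.2)%g)); last exact: mulg_continuous.
apply: cvg_pair; last exact: cvg_fst.
by apply: (@continuous_comp _ _ _ snd (fun x : G => x^-1%g)); [exact: cvg_snd|exact: invg_continuous].
Qed.

Lemma rdiv_continuous : continuous (fun p : G * G => (p.1 * p.2^-1)%g).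
Proof.
move=> p; apply: (@continuous_comp _ _ _ (fun q : G * G => (q.1, q.2^-1)%g)
  (fun q : G * G => (q.1 * q.2)%g)); last exact: mulg_continuous.
apply: cvg_pair; first exact: cvg_fst.
by apply: (@continuous_comp _ _ _ snd (fun x : G => x^-1%g)); [exact: cvg_snd|exact: invg_continuous].
Qed.

Section BorelComp.
Context d (T : measurableType d).
Variable f : G -> T.
Hypothesis mf : measurable_fun [set: borel G] (f : borel G -> T).

Lemma borel_comp_inv : measurable_fun [set: borel G] ((fun x => f x^-1%g) : borel G -> T).
Proof. exact: (@borel_comp G G _ _ _ _ mf (@invg_continuous G)). Qed.

Lemma borel_comp_left z :
  measurable_fun [set: borel G] ((fun x => f (z * x)%g) : borel G -> T).
Proof. exact: (@borel_comp G G _ _ _ _ mf (@mulg_left_continuous z)). Qed.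

Lemma borel_comp_right z :
  measurable_fun [set: borel G] ((fun x => f (x * z)%g) : borel G -> T).
Proof. exact: (@borel_comp G G _ _ _ _ mf (@mulg_right_continuous z)). Qed.

Lemma borel_comp_fst : measurable_fun [set: borel (G * G)%type]
  ((fun p => f p.1) : borel (G * G)%type -> T).
Proof.
by apply: (@borel_comp ((G * G)%type : ptopologicalType) G _ _ _ fst mf) => p; exact: cvg_fst.
Qed.

Lemma borel_comp_snd : measurable_fun [set: borel (G * G)%type]
  ((fun p => f p.2) : borel (G * G)%type -> T).
Proof.
by apply: (@borel_comp ((G * G)%type : ptopologicalType) G _ _ _ snd mf) => p; exact: cvg_snd.
Qed.

Lemma borel_comp_ldiv : measurable_fun [set: borel (G * G)%type]
  ((fun p => f (p.2^-1 * p.1)%g) : borel (G * G)%type -> T).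
Proof. exact: (@borel_comp ((G * G)%type : ptopologicalType) G _ _ _ _ mf ldiv_continuous). Qed.

Lemma borel_comp_rdiv : measurable_fun [set: borel (G * G)%type]
  ((fun p => f (p.1 * p.2^-1)%g) : borel (G * G)%type -> T).
Proof. exact: (@borel_comp ((G * G)%type : ptopologicalType) G _ _ _ _ mf rdiv_continuous). Qed.

End BorelComp.

Lemma ge0_integral_invariant (phi : G -> G) (f : G -> \bar R) : continuous phi ->
  (forall A : set (borel G), measurable A -> mu (phi @^-1` A) = mu A) ->
  measurable_fun [set: borel G] (f : borel G -> \bar R) -> (forall x, 0 <= f x) ->
  \int[mu]_x f (phi x) = \int[mu]_x f x.
Proof.
move=> cphi mu_phi mf f0.
have mphi := borel_continuous cphi.
transitivity (\int[pushforward mu (phi : borel G -> borel G)]_x f x).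
  by rewrite (ge0_integral_pushforward mphi) ?preimage_setT.
apply: eq_measure_integral => A mA _; exact: mu_phi.
Qed.

Lemma haar_preimage_left (z : G) (A : set (borel G)) : measurable A ->
  mu ((fun x : G => (z * x)%g) @^-1` A) = mu A.
Proof.
move=> mA; rewrite -[RHS](haar_left_invariant mu_haar z^-1%g mA); congr (mu _).
apply/seteqP; split => [x /= zx|_ [x Ax <-]] /=.
  by exists (z * x)%g => //; rewrite mulgA mulVg mul1g.
by rewrite mulgA mulgV mul1g.
Qed.

Lemma haar_integral_left (z : G) (f : G -> \bar R) :
  measurable_fun [set: borel G] (f : borel G -> \bar R) -> (forall x, 0 <= f x) ->
  \int[mu]_x f (z * x)%g = \int[mu]_x f x.
Proof.
apply: (@ge0_integral_invariant (fun x => (z * x)%g)); first exact: mulg_left_continuous.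
exact: haar_preimage_left.
Qed.

Variable H : nat -> set G.
Hypothesis Hsub : forall n, subgroup (H n).
Hypothesis Hcpt : forall n, compact (H n).
Hypothesis Hop : forall n, open (H n).
Hypothesis Hnd : forall n, H n `<=` H n.+1.
Hypothesis HT : \bigcup_n H n = setT.
Hypothesis hG : hausdorff_space G.

Lemma subgroup1 (K : set G) : subgroup K -> K 1%g.
Proof. by move=> [/set_mem]. Qed.

Lemma subgroupV (K : set G) x : subgroup K -> K x -> K x^-1%g.
Proof. by move=> /group_closedV KV Kx; apply/set_mem/KV/mem_set. Qed.

Lemma subgroupM (K : set G) x y : subgroup K -> K x -> K y -> K (x * y)%g.
Proof.
move=> /group_closedM KM Kx Ky; apply/set_mem.
by apply: (KM x y); exact: mem_set.
Qed.

Lemma haar_tonelli (F : G * G -> \bar R) :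
  measurable_fun [set: borel (G * G)%type] (F : borel (G * G)%type -> \bar R) ->
  (forall p, 0 <= F p) -> tonelli mu F.
Proof.
apply: (@borel_tonelli _ _ _ hG (haar_inner_regular mu_haar) H) => //.
by move=> n; exact: haar_compact.
Qed.

(** Computing the measure of the pairs [(x, y)] of elements of a compact open
    subgroup with [y^-1 x] in [A] in the two possible orders compares [A] with
    [A^-1]. *)
Lemma haar_preimage_inv_sub (A : set (borel G)) n : measurable A -> A `<=` H n ->
  mu ((fun x : G => x^-1%g) @^-1` A) = mu A.
Proof.
move=> mA AH.
pose HH : set (borel G) := H n.
have mHH : measurable HH by apply: borel_open; exact: Hop.
have mAi : measurable_fun [set: borel G] (\1_A : borel G -> R).
  exact: measurable_indic.
have mHi : measurable_fun [set: borel G] (\1_HH : borel G -> R).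
  exact: measurable_indic.
have mAV : measurable ((fun x : G => x^-1%g) @^-1` A : set (borel G)).
  rewrite -[X in measurable X]setTI.
  by apply: (@borel_continuous G G _ (@invg_continuous G)).
pose F (p : G * G) : \bar R := (\1_HH p.1 * \1_HH p.2 * \1_A (p.2^-1 * p.1)%g)%:E.
have : tonelli mu F.
  apply: haar_tonelli => [|p]; last by rewrite lee_fin !mulr_ge0.
  apply/measurable_EFinP; apply: measurable_funM; first apply: measurable_funM.
  - exact: borel_comp_fst mHi.
  - exact: borel_comp_snd mHi.
  - exact: borel_comp_ldiv mAi.
move=> /tonelliE.
have mH0 : 0 < mu HH.
  apply: (haar_open mu_haar); first exact: Hop.
  by exists 1%g; apply: subgroup1; exact: Hsub.
have mHoo : mu HH < +oo by apply: (haar_compact mu_haar); exact: Hcpt.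
have HS : subgroup HH by exact: Hsub.
have HHM x y : HH x -> (y \in HH) = ((x * y)%g \in HH).
  move=> Hx; apply/idP/idP; rewrite !inE => ?; first exact: subgroupM.
  by rewrite -(mulKg x y); apply: subgroupM => //; exact: subgroupV.
have -> : \int[mu]_x \int[mu]_y F (x, y) = mu ((fun x : G => x^-1%g) @^-1` A) * mu HH.
  rewrite -[X in _ * mu X]setIT -integral_indic// -ge0_integralZl; [|exact: measurableT|exact/measurable_EFinP|by move=> t _; rewrite lee_fin|exact: measure_ge0].
  apply: eq_integral => x _.
  rewrite -(haar_integral_left x); last 2 first.
  - rewrite /F /=; apply/measurable_EFinP; apply: measurable_funM => /=.
      by apply: measurable_funM; [exact: measurable_cst|exact: mHi].
    exact: (borel_comp_inv (borel_comp_right mAi x)).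
  - by move=> y; rewrite lee_fin !mulr_ge0.
  have [Hx|nHx] := boolP (x \in HH); last first.
    rewrite indicE (negbTE nHx) mule0 integral0_eq// => y _.
    by rewrite /F /= !indicE (negbTE nHx) !mul0r.
  rewrite indicE Hx mule1 -[X in mu X]setIT -integral_indic//; apply: eq_integral => y _.
  rewrite /F /= !indicE Hx mul1r -(HHM x y (set_mem Hx)) invgM -mulgA mulVg mulg1.
  have [Ay|nAy] := boolP (y^-1%g \in A); rewrite ?mulr0.
    rewrite !mem_set ?mulr1//=; first exact: set_mem.
    by rewrite -(invgK y); apply: subgroupV => //; apply: AH; exact: set_mem.
  by rewrite memNset// => /= Ay; move: nAy; rewrite mem_set.
have -> : \int[mu]_y \int[mu]_x F (x, y) = mu A * mu HH.
  rewrite -[X in _ * mu X]setIT -integral_indic// -ge0_integralZl; [|exact: measurableT|exact/measurable_EFinP|by move=> t _; rewrite lee_fin|exact: measure_ge0].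
  apply: eq_integral => y _.
  rewrite -(haar_integral_left y); last 2 first.
  - rewrite /F /=; apply/measurable_EFinP; apply: measurable_funM => /=.
      by apply: measurable_funM; [exact: mHi|exact: measurable_cst].
    exact: (borel_comp_left mAi).
  - by move=> x; rewrite lee_fin !mulr_ge0.
  have [Hy|nHy] := boolP (y \in HH); last first.
    rewrite indicE (negbTE nHy) mule0 integral0_eq// => x _.
    by rewrite /F /= !indicE (negbTE nHy) mulr0 mul0r.
  rewrite indicE Hy mule1 -[X in mu X]setIT -integral_indic//; apply: eq_integral => x _.
  rewrite /F /= !indicE Hy mulr1 -(HHM y x (set_mem Hy)) mulKg.
  have [Ax|nAx] := boolP (x \in A); rewrite ?mulr0//.
  by rewrite mem_set ?mulr1//; apply: AH; exact: set_mem.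
have mHf : mu HH \is a fin_num by rewrite ge0_fin_numE.
move=> e; apply/eqP; rewrite eq_le.
by rewrite -(lee_pmul2r mHf mH0) e lexx /= -(lee_pmul2r mHf mH0) e lexx.
Qed.

(** Exhaustion of [G] by the compact open subgroups; inversion invariance is
    unimodularity. *)
Lemma haar_preimage_inv (A : set (borel G)) : measurable A ->
  mu ((fun x : G => x^-1%g) @^-1` A) = mu A.
Proof.
move=> mA; pose B n : set (borel G) := A `&` H n.
have mB n : measurable (B n) by apply: measurableI => //; apply: borel_open; exact: Hop.
have mV (C : set (borel G)) : measurable C ->
    measurable ((fun x : G => x^-1%g) @^-1` C : set (borel G)).
  move=> mC; rewrite -[X in measurable X]setTI.
  by apply: (@borel_continuous G G _ (@invg_continuous G)).
have ndB : nondecreasing_seq B.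
  by apply/nondecreasing_seqP => n; apply/subsetPset; apply: setIS; exact: Hnd.
have BA : \bigcup_n B n = A by rewrite /B -setI_bigcupr HT setIT.
have cB := @nondecreasing_cvg_mu _ _ _ mu _ mB (bigcupT_measurable _ mB) ndB.
have mBV n : measurable ((fun x : G => x^-1%g) @^-1` B n : set (borel G)) by exact: mV.
have ndBV : nondecreasing_seq (fun n => (fun x : G => x^-1%g) @^-1` B n).
  move=> m n mn; apply/subsetPset; apply: preimage_subset.
  by apply/subsetPset; exact: ndB.
have cBV := @nondecreasing_cvg_mu _ _ _ mu _ mBV (bigcupT_measurable _ mBV) ndBV.
rewrite -[in LHS]BA -[in RHS]BA preimage_bigcup.
rewrite -(cvg_lim _ cB)// -(cvg_lim _ cBV)//; congr (limn _).
apply/funext => n /=; rewrite (@haar_preimage_inv_sub _ n)//.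
exact: subIsetr.
Qed.

Lemma haar_integral_inv (f : G -> \bar R) :
  measurable_fun [set: borel G] (f : borel G -> \bar R) -> (forall x, 0 <= f x) ->
  \int[mu]_x f (x^-1)%g = \int[mu]_x f x.
Proof.
apply: (@ge0_integral_invariant (fun x => x^-1)%g); first exact: invg_continuous.
exact: haar_preimage_inv.
Qed.

(** A right translation is a left translation conjugated by the inversion. *)
Lemma haar_integral_right (z : G) (f : G -> \bar R) :
  measurable_fun [set: borel G] (f : borel G -> \bar R) -> (forall x, 0 <= f x) ->
  \int[mu]_x f (x * z)%g = \int[mu]_x f x.
Proof.
move=> mf f0; rewrite -haar_integral_inv//; last exact: borel_comp_right.
rewrite -[RHS]haar_integral_inv// -[RHS](haar_integral_left z^-1%g)//.
  by apply: eq_integral => x _; rewrite invgM invgK.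
exact: borel_comp_inv.
Qed.

End Haar.

(** * Complex-valued integrals *)

Section Normc.
Variable R : realType.
Local Notation normc := (@Normc.normc R).
Implicit Types z w : R[i].

Lemma normc_ge0 z : 0 <= normc z.
Proof. by case: z => a b; exact: sqrtr_ge0. Qed.

Lemma normc_sqr z : normc z ^+ 2 = complex.Re z ^+ 2 + complex.Im z ^+ 2.
Proof. by case: z => a b; rewrite /= sqr_sqrtr// addr_ge0// sqr_ge0. Qed.

Lemma normc_geRe z : `|complex.Re z| <= normc z.
Proof.
rewrite -(@ler_pXn2r _ 2) ?nnegrE ?normr_ge0 ?normc_ge0//.
by rewrite normc_sqr real_normK ?num_real// lerDl sqr_ge0.
Qed.

Lemma normc_geIm z : `|complex.Im z| <= normc z.
Proof.
rewrite -(@ler_pXn2r _ 2) ?nnegrE ?normr_ge0 ?normc_ge0//.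
by rewrite normc_sqr real_normK ?num_real// lerDr sqr_ge0.
Qed.

Lemma normc_real (r : R) : normc r%:C%C = `|r|.
Proof. by rewrite /= expr0n/= addr0 sqrtr_sqr. Qed.

Lemma normc_conj z : normc (z^*)%C = normc z.
Proof. by case: z => a b /=; rewrite sqrrN. Qed.

Lemma normcD z w : normc (z + w) <= normc z + normc w.
Proof. exact: le_normcD. Qed.

Lemma normcM z w : normc (z * w) = normc z * normc w.
Proof. exact: Normc.normcM. Qed.

Lemma normcN z : normc (- z) = normc z.
Proof. by case: z => a b /=; rewrite !sqrrN. Qed.

Lemma normc0 : normc 0 = 0.
Proof. by rewrite /= expr0n/= addr0 sqrtr0. Qed.

Lemma normc1 : normc 1 = 1.
Proof. by rewrite /= expr0n/= addr0 expr1n sqrtr1. Qed.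

Lemma ReD z w : complex.Re (z + w) = complex.Re z + complex.Re w.
Proof. by case: z; case: w. Qed.

Lemma ImD z w : complex.Im (z + w) = complex.Im z + complex.Im w.
Proof. by case: z; case: w. Qed.

Lemma ReM z w :
  complex.Re (z * w) = complex.Re z * complex.Re w - complex.Im z * complex.Im w.
Proof. by case: z; case: w. Qed.

Lemma ImM z w :
  complex.Im (z * w) = complex.Re z * complex.Im w + complex.Im z * complex.Re w.
Proof. by case: z; case: w. Qed.

Lemma eqcP z w : complex.Re z = complex.Re w -> complex.Im z = complex.Im w -> z = w.
Proof. by case: z; case: w => a b c d /= -> ->. Qed.

Lemma normc_eq0 z : normc z = 0 -> z = 0.
Proof. exact: Normc.eq0_normc. Qed.

End Normc.

Section ComplexFunctions.
Context d (T : measurableType d) (R : realType).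
Local Notation normc := (@Normc.normc R).
Implicit Types f g : T -> R[i].

(** Stated on an arbitrary measurable space because both [G] and [G * G] are
    needed. On [G], [cmfun], [cintable] and [cint] are convertible to
    [cmeasurable], [cintegrable] and [cintegral]. *)
Definition cmfun f : Prop :=
  measurable_fun setT (fun x => complex.Re (f x)) /\
  measurable_fun setT (fun x => complex.Im (f x)).

Lemma cmfun_cst c : cmfun (fun=> c).
Proof. by split; exact: measurable_cst. Qed.

Lemma cmfunD f g : cmfun f -> cmfun g -> cmfun (fun x => f x + g x).
Proof.
move=> [fR fI] [gR gI]; split.
  by under eq_fun do rewrite ReD; exact: measurable_funD.
by under eq_fun do rewrite ImD; exact: measurable_funD.
Qed.

Lemma cmfunM f g : cmfun f -> cmfun g -> cmfun (fun x => f x * g x).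
Proof.
move=> [fR fI] [gR gI]; split.
  by under eq_fun do rewrite ReM; apply: measurable_funB; exact: measurable_funM.
by under eq_fun do rewrite ImM; apply: measurable_funD; exact: measurable_funM.
Qed.

Lemma cmfunJ f : cmfun f -> cmfun (fun x => (f x)^*%C).
Proof.
move=> [fR fI]; split.
  by rewrite (_ : (fun x => _) = (fun x => complex.Re (f x)))//; apply/funext => x; case: (f x).
rewrite (_ : (fun x => _) = (fun x => - complex.Im (f x))).
  exact: measurable_funN.
by apply/funext => x; case: (f x).
Qed.

Lemma cmfun_real (f : T -> R) : measurable_fun setT f -> cmfun (fun x => (f x)%:C%C).
Proof. by move=> mf; split => //=; exact: measurable_cst. Qed.

Lemma cmfun_normc f : cmfun f -> measurable_fun setT (fun x => normc (f x)).
Proof.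
move=> [fR fI].
rewrite (_ : (fun x => _) = (fun x => Num.sqrt (complex.Re (f x) ^+ 2 + complex.Im (f x) ^+ 2))).
  apply: (measurableT_comp (continuous_measurable_fun (@sqrt_continuous R))).
  by apply: measurable_funD; apply: measurable_funX.
by apply/funext => x; case: (f x).
Qed.

Lemma cmfun_enormc f : cmfun f -> measurable_fun setT (fun x => (normc (f x))%:E).
Proof. by move=> mf; apply/measurable_EFinP; exact: cmfun_normc. Qed.

Variable mu : {measure set T -> \bar R}.

Definition cintable f := cmfun f /\ (\int[mu]_x (normc (f x))%:E < +oo)%E.

Definition cint f : R[i] :=
  ((\int[mu]_x complex.Re (f x)) +i* (\int[mu]_x complex.Im (f x)))%C.

Lemma cintable_Re f : cintable f -> mu.-integrable setT (EFin \o (fun x => complex.Re (f x))).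
Proof.
move=> [mf fi]; apply/integrableP; split; first by apply/measurable_EFinP; have [] := mf.
apply: le_lt_trans fi; apply: ge0_le_integral => //.
- by apply/measurable_EFinP; apply: measurableT_comp => //; have [] := mf.
- exact: cmfun_enormc.
- by move=> x _; rewrite /= lee_fin normc_geRe.
Qed.

Lemma cintable_Im f : cintable f -> mu.-integrable setT (EFin \o (fun x => complex.Im (f x))).
Proof.
move=> [mf fi]; apply/integrableP; split; first by apply/measurable_EFinP; have [] := mf.
apply: le_lt_trans fi; apply: ge0_le_integral => //.
- by apply/measurable_EFinP; apply: measurableT_comp => //; have [] := mf.
- exact: cmfun_enormc.
- by move=> x _; rewrite /= lee_fin normc_geIm.
Qed.

Lemma cintableZ c f : cintable f -> cintable (fun x => c * f x).
Proof.
move=> [mf fi]; split; first by apply: cmfunM => //; exact: cmfun_cst.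
under eq_integral do rewrite normcM EFinM.
rewrite ge0_integralZl_EFin; [|exact: measurableT
  |by move=> x _; rewrite lee_fin normc_ge0|exact: cmfun_enormc|exact: normc_ge0].
by rewrite lte_mul_pinfty// lee_fin normc_ge0.
Qed.

Lemma cintableD f g : cintable f -> cintable g -> cintable (fun x => f x + g x).
Proof.
move=> [mf fi] [mg gi]; split; first exact: cmfunD.
apply: (@le_lt_trans _ _ (\int[mu]_x ((normc (f x))%:E + (normc (g x))%:E))%E).
  apply: ge0_le_integral => //.
  - by move=> x _; rewrite lee_fin normc_ge0.
  - by apply: cmfun_enormc; exact: cmfunD.
  - by apply: emeasurable_funD; exact: cmfun_enormc.
  - by move=> x _; rewrite -EFinD lee_fin normcD.
rewrite ge0_integralD; [|exact: measurableT
  |by move=> x _; rewrite lee_fin normc_ge0|exact: cmfun_enormc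
  |by move=> x _; rewrite lee_fin normc_ge0|exact: cmfun_enormc].
exact: lte_add_pinfty.
Qed.

Lemma cintD f g : cintable f -> cintable g -> cint (fun x => f x + g x) = cint f + cint g.
Proof.
move=> fi gi; apply: eqcP; rewrite ?ReD ?ImD /=.
- under eq_Rintegral do rewrite ReD.
  by rewrite RintegralD//; exact: cintable_Re.
- under eq_Rintegral do rewrite ImD.
  by rewrite RintegralD//; exact: cintable_Im.
Qed.

Lemma cintZ c f : cintable f -> cint (fun x => c * f x) = c * cint f.
Proof.
move=> fi; have fR := cintable_Re fi; have fI := cintable_Im fi.
have Z (r : R) h : mu.-integrable setT (EFin \o h) ->
    mu.-integrable setT (EFin \o (fun x => r * h x)).
  by move=> hi; exact: (integrableZl _ r hi).
apply: eqcP; rewrite ?ReM ?ImM /=.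
- under eq_Rintegral do rewrite ReM.
  by rewrite RintegralB//= ?RintegralZl//; exact: Z.
- under eq_Rintegral do rewrite ImM.
  by rewrite RintegralD//= ?RintegralZl//; exact: Z.
Qed.

Lemma eq_cint f g : f =1 g -> cint f = cint g.
Proof. by move=> fg; congr cint; apply/funext. Qed.

(** The integral [I] is rotated to the positive axis:
    [|I|^2 = Re (I^* * I)] is the integral of [Re (I^* * f)]. *)
Lemma normc_cint f : cmfun f -> ((normc (cint f))%:E <= \int[mu]_x (normc (f x))%:E)%E.
Proof.
move=> mf; have [fi|] := ltP (\int[mu]_x (normc (f x))%:E)%E +oo%E; last first.
  by rewrite leye_eq => /eqP ->; rewrite leey.
have {}fi : cintable f by split.
set I := cint f; have [->|I0] := eqVneq (normc I) 0.
  by apply: integral_ge0 => x _; rewrite lee_fin normc_ge0.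
have Ipos : 0 < normc I by rewrite lt_neqAle eq_sym I0 normc_ge0.
rewrite -(@lee_pmul2l _ (normc I)%:E)// -ge0_integralZl_EFin; [|exact: measurableT
  |by move=> x _; rewrite lee_fin normc_ge0|exact: cmfun_enormc|exact: normc_ge0].
have Ifi : cintable (fun x => (I^*)%C * f x) by exact: cintableZ.
have -> : ((normc I)%:E * (normc I)%:E = \int[mu]_x (complex.Re ((I^*)%C * f x))%:E)%E.
  have fin : (\int[mu]_x (complex.Re ((I^*)%C * f x))%:E)%E \is a fin_num.
    exact: (integrable_fin_num _ (cintable_Re Ifi)).
  rewrite -(fineK fin) -EFinM; congr EFin.
  transitivity (complex.Re (cint (fun x => (I^*)%C * f x))); last by [].
  by rewrite cintZ// -/I -expr2 normc_sqr; case: (I) => a b /=; ring.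
apply: le_integral => //.
- exact: cintable_Re.
- apply/integrableP; split.
    by under eq_fun do rewrite -EFinM; apply/measurable_EFinP; apply: measurable_funM => //; exact: cmfun_normc.
  under eq_integral do rewrite -EFinM /= ger0_norm ?mulr_ge0 ?normc_ge0//.
  have [_] := cintableZ I fi.
  by under eq_integral do rewrite normcM.
- move=> x _; rewrite lee_fin -(normc_conj I) -normcM.
  by apply: le_trans (normc_geRe _); exact: ler_norm.
Qed.

End ComplexFunctions.

(** * Convolution of nonnegative functions *)

Section LocallyEllipticHaar.
Variables (R : realType) (G : topologicalGroupType).
Variable mu : {measure set (borel G) -> \bar R}.
Hypothesis G_le : locally_elliptic G.
Hypothesis mu_haar : haar_measure mu.
Local Open Scope ereal_scope.

Lemma le_tonelli (F : G * G -> \bar R) :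
  measurable_fun [set: borel (G * G)%type] (F : borel (G * G)%type -> \bar R) ->
  (forall p, 0 <= F p) -> tonelli mu F.
Proof.
have [H [HP Hnd HT]] := le_union G_le.
by apply: (@haar_tonelli _ _ _ mu_haar H) => //;
  [move=> n; have [] := HP n|move=> n; have [] := HP n|exact: le_hausdorff].
Qed.

Lemma le_preimage_inv (A : set (borel G)) : measurable A ->
  mu ((fun x : G => x^-1%g) @^-1` A) = mu A.
Proof.
have [H [HP Hnd HT]] := le_union G_le.
by apply: (@haar_preimage_inv _ _ _ mu_haar H) => //;
  [move=> n; have [] := HP n|move=> n; have [] := HP n|move=> n; have [] := HP n|exact: le_hausdorff].
Qed.

Lemma le_integral_inv (f : G -> \bar R) :
  measurable_fun [set: borel G] (f : borel G -> \bar R) -> (forall x, 0 <= f x) ->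
  \int[mu]_x f (x^-1)%g = \int[mu]_x f x.
Proof.
apply: (@ge0_integral_invariant _ _ _ (fun x => x^-1)%g); first exact: invg_continuous.
exact: le_preimage_inv.
Qed.

Lemma le_integral_right (z : G) (f : G -> \bar R) :
  measurable_fun [set: borel G] (f : borel G -> \bar R) -> (forall x, 0 <= f x) ->
  \int[mu]_x f (x * z)%g = \int[mu]_x f x.
Proof.
have [H [HP Hnd HT]] := le_union G_le.
by apply: (@haar_integral_right _ _ _ mu_haar H) => //;
  [move=> n; have [] := HP n|move=> n; have [] := HP n|move=> n; have [] := HP n|exact: le_hausdorff].
Qed.

Lemma borel_comp_mul (f : G -> R) (mf : measurable_fun [set: borel G] (f : borel G -> R)) :
  measurable_fun [set: borel (G * G)%type]
    ((fun p => f (p.1 * p.2)%g) : borel (G * G)%type -> R).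
Proof.
exact: (@borel_comp ((G * G)%type : ptopologicalType) G _ _ _ _ mf (@mulg_continuous G)).
Qed.

Lemma borel_comp_mulC (f : G -> R) (mf : measurable_fun [set: borel G] (f : borel G -> R)) :
  measurable_fun [set: borel (G * G)%type]
    ((fun p => f (p.2 * p.1)%g) : borel (G * G)%type -> R).
Proof.
apply: (@borel_comp ((G * G)%type : ptopologicalType) G _ _ _
  (fun p => (p.2 * p.1)%g) mf).
move=> p; apply: (@continuous_comp _ _ _ (fun q : G * G => (q.2, q.1))
  (fun q : G * G => (q.1 * q.2)%g)); last exact: mulg_continuous.
by apply: cvg_pair; [exact: cvg_snd|exact: cvg_fst].
Qed.

Section NonnegativeConvolution.
Variables u v w : G -> R.
Hypothesis m_u : measurable_fun [set: borel G] (u : borel G -> R).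
Hypothesis mv : measurable_fun [set: borel G] (v : borel G -> R).
Hypothesis mw : measurable_fun [set: borel G] (w : borel G -> R).
Hypothesis u0 : forall x, (0 <= u x)%R.
Hypothesis v0 : forall x, (0 <= v x)%R.
Hypothesis w0 : forall x, (0 <= w x)%R.

(** The substitution of [x y^-1] for [y], by invariance under inversion and
    left translation. *)
Lemma nonneg_conv_flip x :
  \int[mu]_y (u y * v (y^-1 * x)%g)%:E = \int[mu]_y (u (x * y^-1)%g * v y)%:E.
Proof.
rewrite -(haar_integral_left mu_haar x) -1?le_integral_inv; last 4 first.
- apply/measurable_EFinP; apply: measurable_funM.
    exact: (borel_comp_left m_u x).
  by under eq_fun do rewrite invgM -mulgA mulVg mulg1; exact: (borel_comp_inv mv).
- by move=> y; rewrite lee_fin mulr_ge0.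
- apply/measurable_EFinP; apply: measurable_funM => //.
  exact: (borel_comp_inv (borel_comp_right mv x)).
- by move=> y; rewrite lee_fin mulr_ge0.
by apply: eq_integral => y _; rewrite invgM !invgK -mulgA mulVg mulg1.
Qed.

(** Exchange the integrals and then translate [x] by [y]: the variable [y] is
    left in [u] and in a translate of [w]. [nonneg_conv_tonelli_r] is the
    mirror image. *)
Lemma nonneg_conv_tonelli_l :
  \int[mu]_x ((w x)%:E * \int[mu]_y (u y * v (y^-1 * x)%g)%:E) =
  \int[mu]_y ((u y)%:E * \int[mu]_x (w (y * x)%g * v x)%:E).
Proof.
pose F (p : G * G) : \bar R := (w p.1 * (u p.2 * v (p.2^-1 * p.1)%g))%:E.
have TF : tonelli mu F.
  apply: le_tonelli => [|p]; last by rewrite lee_fin !mulr_ge0.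
  apply/measurable_EFinP; apply: measurable_funM; first exact: (borel_comp_fst mw).
  by apply: measurable_funM; [exact: (borel_comp_snd m_u)|exact: (borel_comp_ldiv mv)].
transitivity (\int[mu]_x \int[mu]_y F (x, y)).
  apply: eq_integral => x _; rewrite -ge0_integralZl; [by []|exact: measurableT|
    |by move=> y _; rewrite lee_fin mulr_ge0|by rewrite lee_fin].
  apply/measurable_EFinP; apply: measurable_funM => //.
  exact: (borel_comp_inv (borel_comp_right mv x)).
rewrite (tonelliE TF); apply: eq_integral => y _.
rewrite -(@haar_integral_left _ _ _ mu_haar y (fun x => F (x, y))); last 2 first.
- exact: (tonelli_secr TF y).
- by move=> x; exact: (tonelli_ge0 TF).
rewrite -ge0_integralZl; [|exact: measurableT|
  |by move=> x _; rewrite lee_fin mulr_ge0|by rewrite lee_fin].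
  by apply: eq_integral => x _; rewrite /F /= mulKg -EFinM mulrCA.
by apply/measurable_EFinP; apply: measurable_funM => //; exact: (borel_comp_left mw y).
Qed.

Lemma nonneg_conv_tonelli_r :
  \int[mu]_x ((w x)%:E * \int[mu]_y (u y * v (y^-1 * x)%g)%:E) =
  \int[mu]_y ((v y)%:E * \int[mu]_x (w (x * y)%g * u x)%:E).
Proof.
pose F (p : G * G) : \bar R := (w p.1 * (u (p.1 * p.2^-1)%g * v p.2))%:E.
have TF : tonelli mu F.
  apply: le_tonelli => [|p]; last by rewrite lee_fin !mulr_ge0.
  apply/measurable_EFinP; apply: measurable_funM; first exact: (borel_comp_fst mw).
  by apply: measurable_funM; [exact: (borel_comp_rdiv m_u)|exact: (borel_comp_snd mv)].
transitivity (\int[mu]_x \int[mu]_y F (x, y)).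
  apply: eq_integral => x _; rewrite nonneg_conv_flip.
  rewrite -ge0_integralZl; [by []|exact: measurableT|
    |by move=> y _; rewrite lee_fin mulr_ge0|by rewrite lee_fin].
  apply/measurable_EFinP; apply: measurable_funM => //.
  exact: (borel_comp_inv (borel_comp_left m_u x)).
rewrite (tonelliE TF); apply: eq_integral => y _.
rewrite -(@le_integral_right y (fun x => F (x, y))); last 2 first.
- exact: (tonelli_secr TF y).
- by move=> x; exact: (tonelli_ge0 TF).
rewrite -ge0_integralZl; [|exact: measurableT|
  |by move=> x _; rewrite lee_fin mulr_ge0|by rewrite lee_fin].
  by apply: eq_integral => x _; rewrite /F /= mulgK -EFinM mulrA mulrC.
by apply/measurable_EFinP; apply: measurable_funM => //; exact: (borel_comp_right mw y).
Qed.

(** In the application [w] is a test function of the Orlicz norm, as are its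
    translates, [v] carries the weight, and [K] is the norm of [v]. *)
Lemma nonneg_conv_le_l (K : \bar R) : 0 <= K ->
  (forall y, \int[mu]_x (w (y * x)%g * v x)%:E <= K) ->
  \int[mu]_x ((w x)%:E * \int[mu]_y (u y * v (y^-1 * x)%g)%:E) <=
  \int[mu]_y (u y)%:E * K.
Proof.
move=> K0 hK; rewrite nonneg_conv_tonelli_l.
have inner0 y : 0 <= \int[mu]_x (w (y * x)%g * v x)%:E.
  by apply: integral_ge0 => x _; rewrite lee_fin mulr_ge0.
rewrite -ge0_integralZr; [|exact: measurableT|exact/measurable_EFinP
  |by move=> y _; rewrite lee_fin|exact: K0].
apply: ge0_le_integral; first exact: measurableT.
- by move=> y _; rewrite mule_ge0 ?lee_fin.
- apply: emeasurable_funM; first exact/measurable_EFinP.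
  have TF : tonelli mu (fun p => (w (p.2 * p.1)%g * v p.1)%:E).
    apply: le_tonelli => [|p]; last by rewrite lee_fin mulr_ge0.
    apply/measurable_EFinP; apply: measurable_funM; first exact: (borel_comp_mulC mw).
    exact: (borel_comp_fst mv).
  exact: (tonelli_intr TF).
- by apply: emeasurable_funM; [exact/measurable_EFinP|exact: measurable_cst].
- by move=> y _; rewrite lee_wpmul2l ?lee_fin.
Qed.

Lemma nonneg_conv_le_r (K : \bar R) : 0 <= K ->
  (forall y, \int[mu]_x (w (x * y)%g * u x)%:E <= K) ->
  \int[mu]_x ((w x)%:E * \int[mu]_y (u y * v (y^-1 * x)%g)%:E) <=
  K * \int[mu]_y (v y)%:E.
Proof.
move=> K0 hK; rewrite nonneg_conv_tonelli_r muleC.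
have inner0 y : 0 <= \int[mu]_x (w (x * y)%g * u x)%:E.
  by apply: integral_ge0 => x _; rewrite lee_fin mulr_ge0.
rewrite -ge0_integralZr; [|exact: measurableT|exact/measurable_EFinP
  |by move=> y _; rewrite lee_fin|exact: K0].
apply: ge0_le_integral; first exact: measurableT.
- by move=> y _; rewrite mule_ge0 ?lee_fin.
- apply: emeasurable_funM; first exact/measurable_EFinP.
  have TF : tonelli mu (fun p => (w (p.1 * p.2)%g * u p.1)%:E).
    apply: le_tonelli => [|p]; last by rewrite lee_fin mulr_ge0.
    apply/measurable_EFinP; apply: measurable_funM; first exact: (borel_comp_mul mw).
    exact: (borel_comp_fst m_u).
  exact: (tonelli_intr TF).
- by apply: emeasurable_funM; [exact/measurable_EFinP|exact: measurable_cst].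
- by move=> y _; rewrite lee_wpmul2l ?lee_fin.
Qed.

Lemma measurable_nonneg_conv : measurable_fun [set: borel G]
  (fun x : borel G => \int[mu]_y (u y * v (y^-1 * x)%g)%:E).
Proof.
pose F (p : G * G) := (u p.2 * v (p.2^-1 * p.1)%g)%:E.
suff TF : tonelli mu F by exact: (tonelli_intl TF).
apply: le_tonelli => [|p]; last by rewrite lee_fin mulr_ge0.
apply/measurable_EFinP; apply: measurable_funM; first exact: (borel_comp_snd m_u).
exact: (borel_comp_ldiv mv).
Qed.

End NonnegativeConvolution.

Lemma measurable_section_integral (h : G * G -> R) :
  measurable_fun [set: borel (G * G)%type] (h : borel (G * G)%type -> R) ->
  measurable_fun [set: borel G] (fun x : borel G => fine (\int[mu]_y (h (x, y))%:E)).
Proof.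
move=> mh; have mh' : measurable_fun [set: borel (G * G)%type]
  ((fun p => (h p)%:E) : borel (G * G)%type -> \bar R) by apply/measurable_EFinP.
have Tp := le_tonelli (measurable_funepos mh') (fun p => funepos_ge0 _ p).
have Tn := le_tonelli (measurable_funeneg mh') (fun p => funeneg_ge0 _ p).
apply: (measurableT_comp (@fine_measurable R _ measurableT)).
rewrite (_ : (fun x => _) = (fun x : borel G =>
    \int[mu]_y (fun p => (h p)%:E)^\+ (x, y) - \int[mu]_y (fun p => (h p)%:E)^\- (x, y))).
  by apply: emeasurable_funB; [exact: (tonelli_intl Tp)|exact: (tonelli_intl Tn)].
apply/funext => x; rewrite integralE; congr (_ - _); apply: eq_integral => y _.
  by rewrite !funeposE.
by rewrite !funenegE.
Qed.

End LocallyEllipticHaar.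

(** * Convolution in L^1 *)

Section Convolution.
Variables (R : realType) (G : topologicalGroupType).
Variable mu : {measure set (borel G) -> \bar R}.
Hypothesis G_le : locally_elliptic G.
Hypothesis mu_haar : haar_measure mu.
Local Notation normc := (@Normc.normc R).
Local Notation "f \conv g" := (convolution mu f g) (at level 40).
Implicit Types f g h : G -> R[i].

Lemma conv_integrand_measurable f g x : cmeasurable f -> cmeasurable g ->
  cmeasurable (fun y => f y * g (y^-1 * x)%g).
Proof.
move=> mf mg; apply: cmfunM => //; split.
  exact: (borel_comp_inv (borel_comp_right mg.1 x)).
exact: (borel_comp_inv (borel_comp_right mg.2 x)).
Qed.

Lemma conv_measurable f g : cmeasurable f -> cmeasurable g -> cmeasurable (f \conv g).
Proof.
move=> mf mg.
have mF : @cmfun _ (borel (G * G)%type) R (fun p => f p.2 * g (p.2^-1 * p.1)%g).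
  apply: cmfunM.
    by split; [exact: (borel_comp_snd mf.1)|exact: (borel_comp_snd mf.2)].
  by split; [exact: (borel_comp_ldiv mg.1)|exact: (borel_comp_ldiv mg.2)].
split; [exact: (measurable_section_integral G_le mu_haar mF.1)|
  exact: (measurable_section_integral G_le mu_haar mF.2)].
Qed.

Lemma normc_conv f g x : cmeasurable f -> cmeasurable g ->
  ((normc ((f \conv g) x))%:E <= \int[mu]_y (normc (f y) * normc (g (y^-1 * x)%g))%:E)%E.
Proof.
move=> mf mg; apply: (le_trans (normc_cint _ (conv_integrand_measurable x mf mg))).
by under eq_integral do rewrite normcM.
Qed.

Section Young.
Variables f g : G -> R[i].
Hypotheses (mf : cmeasurable f) (mg : cmeasurable g).
Local Open Scope ereal_scope.

Lemma conv_double_integral :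
  \int[mu]_x \int[mu]_y (normc (f y) * normc (g (y^-1 * x)%g))%:E =
  (\int[mu]_x (normc (f x))%:E) * \int[mu]_x (normc (g x))%:E.
Proof.
have mnf := cmfun_normc mf; have mng := cmfun_normc mg.
have := @nonneg_conv_tonelli_l _ _ _ G_le mu_haar (fun x => normc (f x))
  (fun x => normc (g x)) (cst 1%R) mnf mng (measurable_cst _)
  (fun x => normc_ge0 _) (fun x => normc_ge0 _) (fun=> ler01).
under eq_integral do rewrite mul1e; move=> ->.
under eq_integral do under eq_integral do rewrite mul1r.
rewrite ge0_integralZr; [by []|exact: measurableT|exact: cmfun_enormc
  |by move=> x _; rewrite lee_fin normc_ge0|].
by apply: integral_ge0 => x _; rewrite lee_fin normc_ge0.
Qed.

Lemma measurable_conv_normc : measurable_fun [set: borel G]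
  (fun x : borel G => \int[mu]_y (normc (f y) * normc (g (y^-1 * x)%g))%:E).
Proof.
exact: (measurable_nonneg_conv G_le mu_haar (cmfun_normc mf) (cmfun_normc mg)
  (fun x => normc_ge0 _) (fun x => normc_ge0 _)).
Qed.

(** Young's inequality. *)
Lemma conv_L1_le : \int[mu]_x (normc ((convolution mu f g) x))%:E <=
  (\int[mu]_x (normc (f x))%:E) * \int[mu]_x (normc (g x))%:E.
Proof.
rewrite -conv_double_integral; apply: ge0_le_integral => //.
- by move=> x _; rewrite lee_fin normc_ge0.
- exact: (cmfun_enormc (conv_measurable mf mg)).
- exact: measurable_conv_normc.
- by move=> x _; exact: normc_conv.
Qed.

End Young.

Lemma conv_cintegrable f g : cintegrable mu f -> cintegrable mu g ->
  cintegrable mu (f \conv g).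
Proof.
move=> [mf fi] [mg gi]; split; first exact: conv_measurable.
apply: (le_lt_trans (conv_L1_le mf mg)).
rewrite lte_mul_pinfty//; first by apply: integral_ge0 => x _; rewrite lee_fin normc_ge0.
by rewrite ge0_fin_numE//; apply: integral_ge0 => x _; rewrite lee_fin normc_ge0.
Qed.

Lemma conv_ae_cintegrable f g : cintegrable mu f -> cintegrable mu g ->
  {ae mu, forall x : borel G, cintegrable mu (fun y => f y * g (y^-1 * x)%g)}.
Proof.
move=> [mf fi] [mg gi].
have int0 h : (0 <= \int[mu]_x (normc (h x))%:E)%E.
  by apply: integral_ge0 => x _; rewrite lee_fin normc_ge0.
have : mu.-integrable [set: borel G] (fun x : borel G =>
    \int[mu]_y (normc (f y) * normc (g (y^-1 * x)%g))%:E)%E.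
  apply/integrableP; split; first exact: measurable_conv_normc.
  under eq_integral => x _.
    rewrite gee0_abs; last by apply: integral_ge0 => y _; rewrite lee_fin mulr_ge0 ?normc_ge0.
    over.
  rewrite conv_double_integral// lte_mul_pinfty//.
  by rewrite ge0_fin_numE.
move=> /(integrable_ae measurableT); apply: filterS => x /(_ Logic.I) fin.
split; first exact: (conv_integrand_measurable x mf mg).
under eq_integral do rewrite normcM.
by rewrite -ge0_fin_numE//; apply: integral_ge0 => y _; rewrite lee_fin mulr_ge0 ?normc_ge0.
Qed.

Lemma conv_linear_l (a : R[i]) f g h : cintegrable mu f -> cintegrable mu g ->
  cintegrable mu h ->
  {ae mu, forall x : borel G, ((fun t => a * f t + g t) \conv h) x =
    a * (f \conv h) x + (g \conv h) x}.
Proof.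
move=> fi gi hi; have := conv_ae_cintegrable fi hi; have := conv_ae_cintegrable gi hi.
apply: filterS2 => x ghx fhx.
rewrite -[LHS]/(cint mu (fun y => (a * f y + g y) * h (y^-1 * x)%g)).
rewrite -[RHS]/(a * cint mu (fun y => f y * h (y^-1 * x)%g) +
  cint mu (fun y => g y * h (y^-1 * x)%g)).
rewrite -cintZ// -cintD//; last exact: cintableZ.
by apply: eq_cint => y; rewrite mulrDl mulrA.
Qed.

Lemma conv_linear_r (a : R[i]) f g h : cintegrable mu f -> cintegrable mu g ->
  cintegrable mu h ->
  {ae mu, forall x : borel G, (h \conv (fun t => a * f t + g t)) x =
    a * (h \conv f) x + (h \conv g) x}.
Proof.
move=> fi gi hi; have := conv_ae_cintegrable hi fi; have := conv_ae_cintegrable hi gi.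
apply: filterS2 => x hgx hfx.
rewrite -[LHS]/(cint mu (fun y => h y * (a * f (y^-1 * x)%g + g (y^-1 * x)%g))).
rewrite -[RHS]/(a * cint mu (fun y => h y * f (y^-1 * x)%g) +
  cint mu (fun y => h y * g (y^-1 * x)%g)).
rewrite -cintZ// -cintD//; last exact: cintableZ.
by apply: eq_cint => y; rewrite mulrDr mulrCA.
Qed.

End Convolution.

(** * Young functions *)

Section YoungFunctions.
Variable R : realType.
Local Open Scope ereal_scope.
Implicit Types Phi Psi : R -> \bar R.

Lemma young_scale Phi (t x : R) : young_function Phi -> (0 <= t <= 1)%R ->
  Phi (t * x)%R <= t%:E * Phi x.
Proof.
move=> YPhi t01; have := young_convex YPhi x 0%R t01.
by rewrite mulr0 addr0 (young0 YPhi) mule0 adde0.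
Qed.

Lemma young_le Phi (x y : R) : young_function Phi -> (0 <= x)%R -> (x <= y)%R ->
  Phi x <= Phi y.
Proof.
move=> YPhi x0 xy; have [->|x_neq0] := eqVneq x 0%R.
  by rewrite (young0 YPhi) (young_ge0 YPhi).
have x_gt0 : (0 < x)%R by rewrite lt_neqAle eq_sym x_neq0.
have y_gt0 : (0 < y)%R by exact: lt_le_trans xy.
have t01 : (0 <= x / y <= 1)%R by rewrite divr_ge0 ?(ltW y_gt0)//= ler_pdivrMr ?mul1r.
have := young_scale y YPhi t01; rewrite divfK ?gt_eqF// => /le_trans; apply.
have := young_ge0 YPhi y; case: (Phi y) => [r r0| _|//]; last by rewrite leey.
by rewrite -EFinM lee_fin ler_piMl//; case/andP: t01.
Qed.

(** A Young function is nondecreasing on the nonnegative numbers, so that its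
    superlevel sets there are intervals. *)
Lemma young_measurable Phi : young_function Phi ->
  measurable_fun [set: R] (fun x : R => Phi (Num.max 0%R x)).
Proof.
move=> YPhi; apply: (measurability _ (ErealGenOInfty.measurableE R)).
move=> _ [_ [a ->] <-]; rewrite setTI preimage_itvoy.
apply: is_interval_measurable => x y /= ax ay z /andP[xz zy].
apply: (lt_le_trans ax); apply: (young_le YPhi); first by rewrite le_max lexx.
by rewrite ge_max !le_max lexx xz orbT.
Qed.

(** Otherwise [Psi] would nowhere be positive, whereas it tends to
    infinity. *)
Lemma young_finite Phi Psi : complementary_pair Phi Psi ->
  exists2 a : R, (0 < a)%R & Phi a < +oo.
Proof.
move=> [YPhi YPsi PsiE]; apply: contrapT => nofin.
have Phioo (a : R) : (0 < a)%R -> Phi a = +oo.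
  by move=> a0; apply/eqP; rewrite -leye_eq leNgt; apply/negP => fin; apply: nofin; exists a.
have Psi0 y : Psi y <= 0.
  rewrite PsiE; apply: ge_ereal_sup => _ [x /= x0 <-].
  have [->|x_neq0] := eqVneq x 0%R; first by rewrite mul0r (young0 YPhi) sube0.
  by rewrite Phioo ?leNye// lt_neqAle eq_sym x_neq0.
have /cvgeyPgt/(_ 0%R)[M [_ MP]] := young_cvg YPsi.
have ltM : (M < `|M| + 1)%R by rewrite (le_lt_trans (ler_norm M))// ltrDl.
by have := MP _ ltM; rewrite /= ltNge Psi0.
Qed.

(** Young's inequality. *)
Lemma complementary_ge Phi Psi (a y : R) : complementary_pair Phi Psi ->
  (0 <= a)%R -> Phi a < +oo -> (a * `|y|)%:E <= Psi y + Phi a.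
Proof.
move=> [YPhi YPsi PsiE] a0 afin.
have Pfin : Phi a \is a fin_num by rewrite ge0_fin_numE// (young_ge0 YPhi).
rewrite -(leeBlDr _ _ Pfin).
by rewrite PsiE; apply: ereal_sup_ubound; exists a.
Qed.

End YoungFunctions.

(** * The weighted Orlicz norm of a convolution *)

Section OrliczNorm.
Variables (R : realType) (G : topologicalGroupType).
Variable mu : {measure set (borel G) -> \bar R}.
Hypothesis G_le : locally_elliptic G.
Hypothesis mu_haar : haar_measure mu.
Variables (Phi Psi : R -> \bar R) (omega : G -> R).
Hypothesis PhiPsi : complementary_pair Phi Psi.
Hypothesis Womega : weight omega.
Local Notation normc := (@Normc.normc R).
Local Notation A := (orlicz_algebra mu Phi Psi omega).
Local Notation wnorm := (weighted_norm mu Psi omega).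
Implicit Types f g h : G -> R[i].
Local Open Scope ereal_scope.

(** The test functions in the definition of [orlicz_norm]. *)
Definition dual_ball : set (G -> R[i]) :=
  [set h | cmeasurable h /\ \int[mu]_x Psi (normc (h x)) <= 1].

Lemma omega_gt0 x : (0 < omega x)%R.
Proof. by apply: lt_le_trans (weight_ge1 Womega x); exact: ltr01. Qed.

Lemma omega_ge0 x : (0 <= omega x)%R.
Proof. exact/ltW/omega_gt0. Qed.

Lemma wnorm_integrandE f h x :
  normc (f x * (omega x)%:C%C * h x)%R = (normc (f x) * omega x * normc (h x))%R.
Proof. by rewrite !normcM normc_real ger0_norm// omega_ge0. Qed.

Lemma wnorm_le f c : (forall h, dual_ball h ->
    \int[mu]_x (normc (f x) * omega x * normc (h x))%:E <= c) -> wnorm f <= c.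
Proof.
move=> hc; apply: ge_ereal_sup => _ [h hh <-].
by under eq_integral do rewrite wnorm_integrandE; exact: hc.
Qed.

Lemma wnorm_ge f h : dual_ball h ->
  \int[mu]_x (normc (f x) * omega x * normc (h x))%:E <= wnorm f.
Proof.
move=> hh; apply: ereal_sup_ubound; exists h => //.
by under eq_integral do rewrite wnorm_integrandE.
Qed.

Lemma cmeasurable_young (Upsilon : R -> \bar R) h : young_function Upsilon -> cmeasurable h ->
  measurable_fun [set: borel G] (fun x : borel G => Upsilon (normc (h x))).
Proof.
move=> YU mh; rewrite (_ : (fun x => _) =
    (fun r => Upsilon (Num.max 0%R r)) \o (fun x : borel G => normc (h x))).
  exact: (measurableT_comp (young_measurable YU) (cmfun_normc mh)).
by apply/funext => x /=; rewrite max_r// normc_ge0.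
Qed.

Lemma Psi_young : young_function Psi. Proof. by have [] := PhiPsi. Qed.
Lemma Phi_young : young_function Phi. Proof. by have [] := PhiPsi. Qed.

Lemma dual_ball0 : dual_ball (fun=> 0%R).
Proof.
split; first exact: cmfun_cst.
by rewrite integral0_eq// => x _; rewrite normc0 (young0 Psi_young).
Qed.

Lemma wnorm_ge0 f : 0 <= wnorm f.
Proof.
apply: le_trans (wnorm_ge f dual_ball0); apply: integral_ge0 => x _.
by rewrite lee_fin !mulr_ge0 ?normc_ge0 ?omega_ge0.
Qed.

Lemma dual_ball_left y h : dual_ball h -> dual_ball (fun x => h (y * x)%g).
Proof.
move=> [mh hle]; split.
  by split; [exact: (borel_comp_left mh.1 y)|exact: (borel_comp_left mh.2 y)].
rewrite (haar_integral_left mu_haar y (f := fun x => Psi (normc (h x))))//.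
  exact: (cmeasurable_young Psi_young mh).
by move=> x; exact: (young_ge0 Psi_young).
Qed.

Lemma dual_ball_right y h : dual_ball h -> dual_ball (fun x => h (x * y)%g).
Proof.
move=> [mh hle]; split.
  by split; [exact: (borel_comp_right mh.1 y)|exact: (borel_comp_right mh.2 y)].
rewrite (le_integral_right G_le mu_haar y (f := fun x => Psi (normc (h x))))//.
  exact: (cmeasurable_young Psi_young mh).
by move=> x; exact: (young_ge0 Psi_young).
Qed.

Lemma memA_measurable f : mem_alg A f -> cmeasurable f.
Proof. by move=> [[]]. Qed.

(** By subadditivity the weight of a product is shared between the two factors;
    each of the two resulting double integrals is estimated by integrating first
    the factor that carries the weight, against a translate of the test
    function. *)
Lemma wnorm_conv_le c f g : (0 <= c)%R ->
  (forall x y, omega (x * y)%g <= c * (omega x + omega y))%R ->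
  cmeasurable f -> cmeasurable g ->
  wnorm (convolution mu f g) <= c%:E *
    (wnorm f * \int[mu]_x (normc (g x))%:E + \int[mu]_x (normc (f x))%:E * wnorm g).
Proof.
move=> c0 omega_sub mf mg; apply: wnorm_le => h hh.
have [mh _] := hh.
have mnf := cmfun_normc mf; have mng := cmfun_normc mg; have mnh := cmfun_normc mh.
have mw := weight_measurable Womega.
have mfw : measurable_fun [set: borel G] (fun x : borel G => normc (f x) * omega x)%R.
  exact: measurable_funM.
have mgw : measurable_fun [set: borel G] (fun x : borel G => normc (g x) * omega x)%R.
  exact: measurable_funM.
have f0 x : (0 <= normc (f x) * omega x)%R by rewrite mulr_ge0 ?normc_ge0 ?omega_ge0.
have g0 x : (0 <= normc (g x) * omega x)%R by rewrite mulr_ge0 ?normc_ge0 ?omega_ge0.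
have nf0 x : (0 <= normc (f x))%R by exact: normc_ge0.
have ng0 x : (0 <= normc (g x))%R by exact: normc_ge0.
have nh0 x : (0 <= normc (h x))%R by exact: normc_ge0.
pose T1 := \int[mu]_x ((normc (h x))%:E *
  \int[mu]_y (normc (f y) * omega y * normc (g (y^-1 * x)%g))%:E).
pose T2 := \int[mu]_x ((normc (h x))%:E *
  \int[mu]_y (normc (f y) * (normc (g (y^-1 * x)%g) * omega (y^-1 * x)%g))%:E).
have T1le : T1 <= wnorm f * \int[mu]_x (normc (g x))%:E.
  apply: (nonneg_conv_le_r G_le mu_haar mfw mng mnh f0 ng0 nh0 (wnorm_ge0 f)) => y.
  under eq_integral do rewrite mulrC.
  exact: (wnorm_ge f (dual_ball_right y hh)).
have T2le : T2 <= \int[mu]_x (normc (f x))%:E * wnorm g.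
  apply: (nonneg_conv_le_l G_le mu_haar mnf mgw mnh nf0 g0 nh0 (wnorm_ge0 g)) => y.
  under eq_integral do rewrite mulrC.
  exact: (wnorm_ge g (dual_ball_left y hh)).
have m1 := measurable_nonneg_conv G_le mu_haar mfw mng f0 ng0.
have m2 := measurable_nonneg_conv G_le mu_haar mnf mgw nf0 g0.
have i1 x : 0 <= \int[mu]_y (normc (f y) * omega y * normc (g (y^-1 * x)%g))%:E.
  by apply: integral_ge0 => y _; rewrite lee_fin mulr_ge0.
have i2 x : 0 <= \int[mu]_y (normc (f y) * (normc (g (y^-1 * x)%g) * omega (y^-1 * x)%g))%:E.
  by apply: integral_ge0 => y _; rewrite lee_fin mulr_ge0.
have mh1 : measurable_fun [set: borel G] (fun x : borel G => (normc (h x))%:E *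
  \int[mu]_y (normc (f y) * omega y * normc (g (y^-1 * x)%g))%:E).
  by apply: emeasurable_funM => //; exact/measurable_EFinP.
have mh2 : measurable_fun [set: borel G] (fun x : borel G => (normc (h x))%:E *
  \int[mu]_y (normc (f y) * (normc (g (y^-1 * x)%g) * omega (y^-1 * x)%g))%:E).
  by apply: emeasurable_funM => //; exact/measurable_EFinP.
have h1 x : setT x -> 0 <= (normc (h x))%:E *
  \int[mu]_y (normc (f y) * omega y * normc (g (y^-1 * x)%g))%:E.
  by move=> _; rewrite mule_ge0 ?lee_fin.
have h2 x : setT x -> 0 <= (normc (h x))%:E *
  \int[mu]_y (normc (f y) * (normc (g (y^-1 * x)%g) * omega (y^-1 * x)%g))%:E.
  by move=> _; rewrite mule_ge0 ?lee_fin.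
apply: (@le_trans _ _ (c%:E * (T1 + T2))); last first.
  by apply: lee_wpmul2l; rewrite ?lee_fin//; exact: leeD.
rewrite -ge0_integralD; [|exact: measurableT|exact: h1|exact: mh1|exact: h2|exact: mh2].
rewrite -ge0_integralZl; [|exact: measurableT|exact: emeasurable_funD
  |by move=> x _; rewrite adde_ge0 ?h1 ?h2|by rewrite lee_fin].
apply: ge0_le_integral; first exact: measurableT.
- by move=> x _; rewrite lee_fin !mulr_ge0 ?normc_ge0 ?omega_ge0.
- apply/measurable_EFinP; apply: measurable_funM => //; apply: measurable_funM => //.
  exact: (cmfun_normc (conv_measurable G_le mu_haar mf mg)).
- by apply: measurable_funeM; exact: emeasurable_funD.
move=> x _; rewrite mulrC EFinM -ge0_muleDr ?i1 ?i2// muleCA.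
apply: lee_wpmul2l; first by rewrite lee_fin normc_ge0.
have mc := conv_integrand_measurable x mf mg.
have mo : measurable_fun [set: borel G] (fun y : borel G => omega (y^-1 * x)%g).
  exact: (borel_comp_inv (borel_comp_right mw x)).
have mgx : measurable_fun [set: borel G] (fun y : borel G => normc (g (y^-1 * x)%g)).
  exact: (borel_comp_inv (borel_comp_right mng x)).
rewrite -ge0_integralD; [|exact: measurableT
  |by move=> y _; rewrite lee_fin !mulr_ge0 ?omega_ge0//
  |by apply/measurable_EFinP; exact: measurable_funM
  |by move=> y _; rewrite lee_fin !mulr_ge0 ?omega_ge0//
  |by apply/measurable_EFinP; apply: measurable_funM => //; exact: measurable_funM].
rewrite -ge0_integralZl; [|exact: measurableT
  |by apply: emeasurable_funD; apply/measurable_EFinP; apply: measurable_funM => //; exact: measurable_funM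
  |by move=> y _; rewrite adde_ge0 ?lee_fin ?mulr_ge0 ?omega_ge0//|by rewrite lee_fin].
rewrite EFinM; apply: (@le_trans _ _ ((\int[mu]_y (normc (f y) * normc (g (y^-1 * x)%g))%:E) * (omega x)%:E)).
  by apply: lee_wpmul2r; [rewrite lee_fin omega_ge0|exact: normc_conv].
rewrite -ge0_integralZr; [|exact: measurableT
  |by apply/measurable_EFinP; exact: measurable_funM
  |by move=> y _; rewrite lee_fin !mulr_ge0 ?omega_ge0//|by rewrite lee_fin omega_ge0].
apply: ge0_le_integral; first exact: measurableT.
- by move=> y _; rewrite -EFinM lee_fin !mulr_ge0 ?omega_ge0//.
- apply: emeasurable_funM; last exact: measurable_cst.
  by apply/measurable_EFinP; exact: measurable_funM.
- apply: measurable_funeM; apply: emeasurable_funD; apply/measurable_EFinP.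
    by apply: measurable_funM => //; exact: measurable_funM.
  by apply: measurable_funM => //; exact: measurable_funM.
move=> y _; rewrite -!EFinM lee_fin.
have := omega_sub y (y^-1 * x)%g; rewrite mulVKg => osub.
have := ler_wpM2l (mulr_ge0 (nf0 y) (ng0 (y^-1 * x)%g)) osub.
move=> /le_trans; apply; rewrite le_eqVlt; apply/orP; left; apply/eqP; ring.
Qed.

End OrliczNorm.

(** * Comparison of the weighted Orlicz space with L^1 *)

Section OrliczAlgebraL1.
Variables (R : realType) (G : topologicalGroupType).
Variable mu : {measure set (borel G) -> \bar R}.
Hypothesis G_le : locally_elliptic G.
Hypothesis mu_haar : haar_measure mu.
Variables (Phi Psi : R -> \bar R) (omega : G -> R).
Hypothesis PhiPsi : complementary_pair Phi Psi.
Hypothesis Womega : weight omega.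
Local Notation normc := (@Normc.normc R).
Local Notation A := (orlicz_algebra mu Phi Psi omega).
Local Notation wnorm := (weighted_norm mu Psi omega).
Implicit Types f g h : G -> R[i].
Local Open Scope ereal_scope.

(** Young's inequality [a y <= Psi y + Phi a] bounds the integral of a test
    function over a compact set. *)
Lemma bounded_memA (K : set G) : compact K -> exists2 C : R, (0 <= C)%R &
  forall f (b : R), (0 <= b)%R -> cmeasurable f ->
    (forall x, normc (f x) <= b * \1_K x)%R ->
    mem_alg A f /\ wnorm f <= (C * b)%:E.
Proof.
move=> cK; have [a a0 afin] := young_finite PhiPsi.
have [M KM] := weight_bounded Womega cK.
have mK : measurable (K : set (borel G)).
  exact: (compact_borel (le_hausdorff G_le)).
have Koo : mu K < +oo by exact: (haar_compact mu_haar).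
have Kfin : mu K \is a fin_num by rewrite ge0_fin_numE.
have YPhi := Phi_young PhiPsi; have YPsi := Psi_young PhiPsi.
have Pfin : Phi a \is a fin_num by rewrite ge0_fin_numE// (young_ge0 YPhi).
pose p := fine (Phi a).
have p0 : (0 <= p)%R by rewrite fine_ge0// (young_ge0 YPhi).
have pE : Phi a = p%:E by rewrite fineK.
pose k := fine (mu K).
have k0 : (0 <= k)%R by rewrite fine_ge0.
have kE : mu K = k%:E by rewrite fineK.
have mindK : measurable_fun [set: borel G] (fun x : borel G => (\1_K x : R)%:E).
  by apply/measurable_EFinP; exact: measurable_indic.
exists (`|M| / a * (1 + p * k))%R; first by rewrite mulr_ge0 ?divr_ge0 ?addr_ge0 ?mulr_ge0 ?(ltW a0).
move=> f b b0 mf fb.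
have q0 : (0 <= b * `|M| / a)%R by rewrite divr_ge0 ?mulr_ge0 ?(ltW a0).
have fle : wnorm f <= (`|M| / a * (1 + p * k) * b)%:E.
  apply: wnorm_le => // h [mh hle].
  have mPh := cmeasurable_young YPsi mh.
  have mpK : measurable_fun [set: borel G] (fun x : borel G => p%:E * (\1_K x : R)%:E).
    exact: measurable_funeM.
  have Ph0 x : 0 <= Psi (normc (h x)) by exact: (young_ge0 YPsi).
  have pK0 x : 0 <= p%:E * (\1_K x : R)%:E by rewrite mule_ge0 ?lee_fin.
  apply: (@le_trans _ _ (\int[mu]_x ((b * `|M| / a)%:E *
      (Psi (normc (h x)) + p%:E * (\1_K x)%:E)))).
    apply: ge0_le_integral; first exact: measurableT.
    - by move=> x _; rewrite lee_fin !mulr_ge0 ?normc_ge0 ?(omega_ge0 Womega).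
    - apply/measurable_EFinP; apply: measurable_funM; last exact: cmfun_normc.
      apply: measurable_funM; first exact: cmfun_normc.
      exact: weight_measurable.
    - by apply: measurable_funeM; exact: emeasurable_funD.
    move=> x _; have [xK|xK] := boolP (x \in K); last first.
      have := fb x; rewrite indicE (negbTE xK) mulr0 => fx0.
      have -> : normc (f x) = 0%R by apply/eqP; rewrite eq_le fx0 normc_ge0.
      rewrite !mul0r; apply: mule_ge0; first by rewrite lee_fin.
      by apply: adde_ge0 => //; apply: mule_ge0; rewrite lee_fin.
    have ax := complementary_ge (normc (h x)) PhiPsi (ltW a0) afin.
    rewrite ger0_norm ?normc_ge0// in ax.
    rewrite indicE xK mule1 -pE; apply: le_trans (lee_wpmul2l _ ax); last by rewrite lee_fin.
    rewrite -EFinM lee_fin.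
    have -> : (b * `|M| / a * (a * normc (h x)) = b * `|M| * normc (h x))%R.
      by rewrite mulrA divfK// gt_eqF.
    apply: ler_wpM2r; first exact: normc_ge0.
    apply: ler_pM; [exact: normc_ge0|exact: (omega_ge0 Womega)| |].
      by have := fb x; rewrite indicE xK mulr1.
    by apply: le_trans (ler_norm _); apply: KM; exact: set_mem.
  rewrite ge0_integralZl; [|exact: measurableT|exact: emeasurable_funD
    |by move=> x _; rewrite adde_ge0|by rewrite lee_fin].
  rewrite ge0_integralD; [|exact: measurableT|by []|exact: mPh|by []|exact: mpK].
  rewrite ge0_integralZl; [|exact: measurableT|exact: mindK
    |by move=> x _; rewrite lee_fin|by rewrite lee_fin].
  rewrite integral_indic// setIT kE.
  rewrite (_ : (`|M| / a * (1 + p * k) * b)%:E = (b * `|M| / a)%:E * (1 + p%:E * k%:E)); last first.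
    by rewrite -!EFinM; congr EFin; ring.
  by apply: lee_wpmul2l; [rewrite lee_fin|exact: leeD2r].
split => //; split; last by apply: le_lt_trans fle _; exact: ltry.
split => //; have b1 : (0 < b + 1)%R by rewrite ltr_wpDl.
exists (a / (b + 1))%R; first by rewrite divr_gt0.
have alpha0 : (0 <= a / (b + 1))%R by rewrite divr_ge0 ?(ltW a0) ?(ltW b1).
apply: (@le_lt_trans _ _ (\int[mu]_x (p%:E * (\1_K x)%:E))).
  apply: ge0_le_integral; first exact: measurableT.
  - by move=> x _; exact: (young_ge0 YPhi).
  - have maf : cmeasurable (fun x => (a / (b + 1))%:C%C * f x)%R.
      by apply: cmfunM => //; exact: cmfun_cst.
    have := cmeasurable_young YPhi maf.
    by under eq_fun do rewrite normcM normc_real ger0_norm//.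
  - exact: measurable_funeM.
  move=> x _; have := fb x; rewrite indicE; case: (x \in K) => /=.
    rewrite mulr1 mule1 -pE => fxb; apply: (young_le YPhi).
      by rewrite mulr_ge0 ?normc_ge0.
    rewrite mulrAC ler_pdivrMr// ler_pM2l//.
    by rewrite (le_trans fxb)// lerDl.
  rewrite mulr0 mule0 => fx0.
  have -> : normc (f x) = 0%R by apply/eqP; rewrite eq_le fx0 normc_ge0.
  by rewrite mulr0 (young0 YPhi).
rewrite ge0_integralZl; [|exact: measurableT|exact: mindK
  |by move=> x _; rewrite lee_fin|by rewrite lee_fin].
by rewrite integral_indic// setIT kE -EFinM ltry.
Qed.

(** Test the norm of [f] against a small multiple of [1 / omega]. *)
Lemma L1_le_wnorm : orlicz_space mu Psi (fun x : G => ((omega x)^-1)%:C%C) ->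
  exists2 C : R, (0 <= C)%R &
  forall f, cmeasurable f -> \int[mu]_x (normc (f x))%:E <= C%:E * wnorm f.
Proof.
move=> [mw' [a a0 aoo]].
have YPsi := Psi_young PhiPsi.
have normw x : normc ((omega x)^-1)%:C%C = (omega x)^-1%R.
  by rewrite normc_real ger0_norm// invr_ge0 (omega_ge0 Womega).
set I := \int[mu]_x _ in aoo.
have I0 : 0 <= I by apply: integral_ge0 => x _; exact: (young_ge0 YPsi).
have IE : I = (fine I)%:E by rewrite fineK// ge0_fin_numE.
have i0 : (0 <= fine I)%R by rewrite fine_ge0.
have d0 : (0 < 1 + fine I)%R by rewrite ltr_pwDl.
pose t := ((1 + fine I)^-1)%R.
have t0 : (0 < t)%R by rewrite invr_gt0.
have t1 : (0 <= t <= 1)%R by rewrite ltW//= invf_le1// lerDl.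
pose h : G -> R[i] := fun x => ((t * a)%:C%C * ((omega x)^-1)%:C%C)%R.
have mh : cmeasurable h by apply: cmfunM => //; exact: cmfun_cst.
have hE x : normc (h x) = (t * (a * normc ((omega x)^-1)%:C%C))%R.
  by rewrite /h normcM normc_real ger0_norm ?mulrA// mulr_ge0// ltW.
have hball : dual_ball mu Psi h.
  split => //.
  apply: (@le_trans _ _ (t%:E * I)).
    rewrite -ge0_integralZl; [|exact: measurableT| |
      by move=> x _; exact: (young_ge0 YPsi)|by rewrite lee_fin ltW].
    - apply: ge0_le_integral; first exact: measurableT.
      + by move=> x _; exact: (young_ge0 YPsi).
      + exact: (cmeasurable_young YPsi mh).
      + apply: measurable_funeM.
        have maw : cmeasurable (fun x => a%:C%C * ((omega x)^-1)%:C%C)%R.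
          by apply: cmfunM => //; exact: cmfun_cst.
        have := cmeasurable_young YPsi maw.
        by under eq_fun do rewrite normcM normc_real ger0_norm ?(ltW a0)//.
      + by move=> x _; rewrite hE; exact: young_scale.
    - have maw : cmeasurable (fun x => a%:C%C * ((omega x)^-1)%:C%C)%R.
        by apply: cmfunM => //; exact: cmfun_cst.
      have := cmeasurable_young YPsi maw.
      by under eq_fun do rewrite normcM normc_real ger0_norm ?(ltW a0)//.
  by rewrite IE -EFinM lee_fin mulrC ler_pdivrMr// mul1r lerDr.
exists ((t * a)^-1)%R; first by rewrite invr_ge0 mulr_ge0 ?(ltW a0) ?(ltW t0).
move=> f mf; have := wnorm_ge Womega f hball.
have ta0 : (0 < t * a)%R by rewrite mulr_gt0.
have integrandE x : (normc (f x) * omega x * normc (h x) = t * a * normc (f x))%R.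
  rewrite hE normw; have := omega_gt0 Womega x => /gt_eqF/negbT w0.
  by field.
under eq_integral do rewrite integrandE EFinM.
rewrite ge0_integralZl; [|exact: measurableT|exact: cmfun_enormc
  |by move=> x _; rewrite lee_fin normc_ge0|by rewrite lee_fin ltW].
by rewrite lee_pdivlMl.
Qed.

(** Truncation of the values and of the support. *)
Lemma L1_truncation k (e : R) : cintegrable mu k -> (0 < e)%R ->
  exists h (K : set G) (b : R), [/\ compact K, cmeasurable h, (0 <= b)%R,
    (forall x, normc (h x) <= b * \1_K x)%R &
    \int[mu]_x (normc (k x - h x)%R)%:E < e%:E].
Proof.
move=> [mk ki] e0.
have [H [HP Hnd HT]] := le_union G_le.
have ndH : nondecreasing_seq H := exhaustion_nondecreasing Hnd.
pose E n : set (borel G) := H n `&` [set x | normc (k x) <= n%:R]%R.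
have mE n : measurable (E n).
  apply: measurableI; first by apply: borel_open; have [] := HP n.
  have := cmfun_normc mk => /(_ measurableT [set` `]-oo, n%:R]] (measurable_itv _)).
  by rewrite setTI; congr measurable; apply/seteqP; split => x /=; rewrite in_itv.
have ndE : nondecreasing_seq E.
  move=> m n mn; apply/subsetPset => x [Hx kx]; split.
    by have /subsetPset := ndH _ _ mn; exact.
  by apply: (le_trans kx); rewrite ler_nat.
have ET : \bigcup_n E n = setT.
  apply/seteqP; split => // x _.
  have [n _ Hnx] : (\bigcup_n H n) x by rewrite HT.
  have [m km] : exists m : nat, (normc (k x) <= m%:R)%R.
    exists (Num.bound (normc (k x))); apply: ltW.
    by apply: le_lt_trans (archi_boundP (normc_ge0 _)); rewrite lexx.
  exists (maxn n m) => //; split.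
    by have /subsetPset := ndH _ _ (leq_maxl n m); exact.
  by apply: (le_trans km); rewrite ler_nat leq_maxr.
have mnk : measurable_fun [set: borel G] (fun x : borel G => (normc (k x))%:E).
  exact: cmfun_enormc.
have nk0 x : 0 <= (normc (k x))%:E by rewrite lee_fin normc_ge0.
pose I := \int[mu]_x (normc (k x))%:E.
have Ifin : I \is a fin_num by rewrite ge0_fin_numE//; exact: integral_ge0.
have cE : \int[mu]_(x in E n) (normc (k x))%:E @[n --> \oo] --> I.
  have := @ge0_nondecreasing_set_cvg_integral _ _ R E (fun x => (normc (k x))%:E) mu ndE mE.
  rewrite ET; apply => //.
  by move=> n; exact: measurable_funTS.
have [n In] : exists n, I - e%:E < \int[mu]_(x in E n) (normc (k x))%:E.
  apply: contrapT => /forallNP noI.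
  suff : I <= I - e%:E by rewrite leNgt lte_subel_addr// lteDl// lte_fin e0.
  rewrite -[X in X <= _](cvg_lim _ cE)//; apply: lime_le; first by apply/cvg_ex; exists I.
  by apply: nearW => n; rewrite leNgt; apply/negP/noI.
pose h x := ((\1_(E n) x : R)%:C%C * k x)%R.
have mh : cmeasurable h.
  by apply: cmfunM => //; apply: cmfun_real; exact: measurable_indic.
have hE x : normc (h x) = (\1_(E n) x * normc (k x))%R.
  by rewrite normcM normc_real ger0_norm.
exists h, (H n), n%:R; split => //.
- by have [] := HP n.
- move=> x; rewrite hE !indicE; have [xE|xE] := boolP (x \in E n).
    by have [Hx kx] := set_mem xE; rewrite mem_set// mul1r mulr1.
  by rewrite mul0r mulr_ge0.
have mkh : cmeasurable (fun x => k x - h x)%R.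
  have := cmfunD mk (cmfunM (@cmfun_cst _ (borel G) R (-1)%R) mh).
  by under eq_fun do rewrite mulN1r.
have nh : \int[mu]_x (normc (h x))%:E = \int[mu]_(x in E n) (normc (k x))%:E.
  rewrite [RHS]integral_mkcond; apply: eq_integral => x _.
  by rewrite hE patchE indicE; case: (x \in E n); rewrite ?mul1r ?mul0r.
have split_int : \int[mu]_x (normc (k x - h x)%R)%:E + \int[mu]_x (normc (h x))%:E = I.
  rewrite -ge0_integralD; [|exact: measurableT|by move=> x _; rewrite lee_fin normc_ge0
    |exact: (cmfun_enormc mkh)|by move=> x _; rewrite lee_fin normc_ge0|exact: (cmfun_enormc mh)].
  apply: eq_integral => x _; rewrite -EFinD /h indicE.
  by case: (x \in E n); rewrite ?mul1r ?mul0r ?subrr ?subr0 ?normc0 ?add0r ?addr0.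
have hI : \int[mu]_x (normc (h x))%:E <= I.
  by rewrite -split_int leeDr//; apply: integral_ge0 => x _; rewrite lee_fin normc_ge0.
have hfin : \int[mu]_x (normc (h x))%:E \is a fin_num.
  apply: ge0_le_fin_num hI ki; apply: integral_ge0 => x _.
  by rewrite lee_fin normc_ge0.
rewrite (_ : \int[mu]_x _ = I - \int[mu]_x (normc (h x))%:E); last first.
  by rewrite -split_int addeK.
by rewrite lteBlDr// -lteBlDl// nh.
Qed.

End OrliczAlgebraL1.

(** * Quasi-inverses and spectra *)

Section ConvolutionAlgebra.
Variables (R : realType) (G : topologicalGroupType).
Variable mu : {measure set (borel G) -> \bar R}.
Local Notation "f \conv g" := (convolution mu f g) (at level 40).
Local Notation "f =ae g" := (aeeq mu f g) (at level 70).
Implicit Types (f g h : G -> R[i]) (a l : R[i]) (M : set (G -> R[i])).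

Lemma aeeq_refl f : f =ae f.
Proof. exact: aeW. Qed.

Lemma aeeq_sym f g : f =ae g -> g =ae f.
Proof. by apply: filterS => x ->. Qed.

Lemma aeeq_trans f g h : f =ae g -> g =ae h -> f =ae h.
Proof. by apply: filterS2 => x -> ->. Qed.

(** The part of the axioms that relates quasi-inverses to spectra. It holds in
    [L^1] by Young's inequality and in the weighted Orlicz algebra by the
    axioms of Banach algebras. *)
Record convolution_algebra M : Prop := {
  ca_0 : M (0 : G -> R[i]);
  ca_D : forall a f g, M f -> M g -> M (a *: f + g);
  ca_M : forall f g, M f -> M g -> M (f \conv g);
  ca_linear_l : forall a f g h, M f -> M g -> M h ->
    (a *: f + g) \conv h =ae a *: (f \conv h) + g \conv h;
  ca_linear_r : forall a f g h, M f -> M g -> M h ->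
    h \conv (a *: f + g) =ae a *: (h \conv f) + h \conv g
}.

Section Bilinear.
Variable M : set (G -> R[i]).
Hypothesis CM : convolution_algebra M.

Lemma ca_Z a f : M f -> M (a *: f).
Proof. by move=> Mf; rewrite -[a *: f]addr0; apply: ca_D => //; exact: ca_0. Qed.

Lemma ca_add f g : M f -> M g -> M (f + g).
Proof. by move=> Mf Mg; rewrite -[f]scale1r; exact: ca_D. Qed.

Lemma ca_N f : M f -> M (- f).
Proof. by move=> Mf; rewrite -scaleN1r; exact: ca_Z. Qed.

Lemma ca_sub f g : M f -> M g -> M (f - g).
Proof. by move=> Mf Mg; apply: ca_add => //; exact: ca_N. Qed.

Lemma conv0l h : M h -> 0 \conv h =ae 0.
Proof.
move=> Mh; have M0 := ca_0 CM; have := ca_linear_l CM (-1) M0 M0 Mh.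
rewrite scaler0 addr0; apply: filterS => x ->.
by rewrite scaleN1r addNr.
Qed.

Lemma conv0r h : M h -> h \conv 0 =ae 0.
Proof.
move=> Mh; have M0 := ca_0 CM; have := ca_linear_r CM (-1) M0 M0 Mh.
rewrite scaler0 addr0; apply: filterS => x ->.
by rewrite scaleN1r addNr.
Qed.

Lemma convZl a f h : M f -> M h ->
  {ae mu, forall x : borel G, ((a *: f) \conv h) x = a * (f \conv h) x}.
Proof.
move=> Mf Mh; have M0 := ca_0 CM.
have := ca_linear_l CM a Mf M0 Mh; rewrite addr0.
by apply: filterS2 (conv0l Mh) => x h0 ->; rewrite -[LHS]/(a * (f \conv h) x + (0 \conv h) x) h0 addr0.
Qed.

Lemma convZr a f h : M f -> M h ->
  {ae mu, forall x : borel G, (h \conv (a *: f)) x = a * (h \conv f) x}.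
Proof.
move=> Mf Mh; have M0 := ca_0 CM.
have := ca_linear_r CM a Mf M0 Mh; rewrite addr0.
by apply: filterS2 (conv0r Mh) => x h0 ->; rewrite -[LHS]/(a * (h \conv f) x + (h \conv 0) x) h0 addr0.
Qed.

Lemma convDl f g h : M f -> M g -> M h ->
  {ae mu, forall x : borel G, ((f + g) \conv h) x = (f \conv h) x + (g \conv h) x}.
Proof.
move=> Mf Mg Mh; have := ca_linear_l CM 1 Mf Mg Mh; rewrite scale1r.
by apply: filterS => x ->; rewrite scale1r.
Qed.

Lemma convDr f g h : M f -> M g -> M h ->
  {ae mu, forall x : borel G, (h \conv (f + g)) x = (h \conv f) x + (h \conv g) x}.
Proof.
move=> Mf Mg Mh; have := ca_linear_r CM 1 Mf Mg Mh; rewrite scale1r.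
by apply: filterS => x ->; rewrite scale1r.
Qed.

Lemma convNl f h : M f -> M h ->
  {ae mu, forall x : borel G, ((- f) \conv h) x = - (f \conv h) x}.
Proof.
move=> Mf Mh; have := convZl (-1) Mf Mh; rewrite scaleN1r.
by apply: filterS => x ->; rewrite mulN1r.
Qed.

Lemma convNr f h : M f -> M h ->
  {ae mu, forall x : borel G, (h \conv (- f)) x = - (h \conv f) x}.
Proof.
move=> Mf Mh; have := convZr (-1) Mf Mh; rewrite scaleN1r.
by apply: filterS => x ->; rewrite mulN1r.
Qed.

Lemma convBl f g h : M f -> M g -> M h ->
  {ae mu, forall x : borel G, ((f - g) \conv h) x = (f \conv h) x - (g \conv h) x}.
Proof.
move=> Mf Mg Mh; have := convDl Mf (ca_N Mg) Mh; apply: filterS2 (convNl Mg Mh).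
by move=> x -> ->.
Qed.

Lemma convBr f g h : M f -> M g -> M h ->
  {ae mu, forall x : borel G, (h \conv (f - g)) x = (h \conv f) x - (h \conv g) x}.
Proof.
move=> Mf Mg Mh; have := convDr Mf (ca_N Mg) Mh; apply: filterS2 (convNr Mg Mh).
by move=> x -> ->.
Qed.

End Bilinear.

(** [(l - f) (1 + p) = l = (1 + p) (l - f)]: this form of the invertibility of
    [l - f] makes sense with or without an identity. *)
Definition quasi_inverse l f p : Prop :=
  l *: p - f \conv p =ae f /\ l *: p - p \conv f =ae f.

Definition quasi_invertible M l f : Prop := exists2 p, M p & quasi_inverse l f p.

Section Spectrum.
Variable M : set (G -> R[i]).
Hypothesis CM : convolution_algebra M.
Variables (st : (G -> R[i]) -> (G -> R[i])) (nm : (G -> R[i]) -> \bar R).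
Let B : star_algebra R :=
  @StarAlgebra R (G -> R[i]) M (aeeq mu) (convolution mu) st nm.

(** The inverse of [l - f] is [l^-1 (1 + p)], where [p] is the
    quasi-inverse. *)
Lemma unitization_invertibleP l f : M f -> l != 0 ->
  invertible (A := unitization B) (1, 0) (l *: ((1, 0) : unitization B) - (0, f)) <->
  quasi_invertible M l f.
Proof.
move=> Mf l0.
have -> : l *: ((1, 0) : unitization B) - (0, f) = (l, - f).
  by rewrite -[RHS]/((l, - f) : (R[i]^o * (G -> R[i]))%type); congr pair; [rewrite /= subr0; exact: mulr1|rewrite /= scaler0 sub0r].
split.
- move=> [[c q] /= Mq [[/= lc +] [/= _ +]]].
  have Nl := convNl CM Mf Mq; have Nr := convNr CM Mf Mq.
  have Zl := convZl CM l Mq Mf; have Zr := convZr CM l Mq Mf.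
  move=> Hl Hr; exists (l *: q); first exact: ca_Z.
  have lin (u v w : R[i]) : l * u + c * - v - w = 0 -> l * (l * u) - l * w = v.
    move=> e; transitivity (l * (l * u + c * - v - w) + l * c * v); first by ring.
    by rewrite e lc mulr0 add0r mul1r.
  split; near=> x.
  + rewrite -[LHS]/(l * (l * q x) - (f \conv (l *: q)) x).
    rewrite (_ : (f \conv (l *: q)) x = l * (f \conv q) x); last by near: x.
    apply: lin; rewrite -(_ : ((- f) \conv q) x = - (f \conv q) x); last by near: x.
    by near: x.
  + rewrite -[LHS]/(l * (l * q x) - ((l *: q) \conv f) x).
    rewrite (_ : ((l *: q) \conv f) x = l * (q \conv f) x); last by near: x.
    apply: lin; rewrite -(_ : (q \conv (- f)) x = - (q \conv f) x); last by near: x.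
    rewrite [l * _ + _]addrC.
    by near: x.
- move=> [p Mp [Hl Hr]].
  have Mq := ca_Z CM l^-1 Mp.
  have Nl := convNl CM Mf Mq; have Nr := convNr CM Mf Mq.
  have Zl := convZl CM l^-1 Mp Mf; have Zr := convZr CM l^-1 Mp Mf.
  have ll : l * l^-1 = 1 by rewrite mulfV.
  have lin (u v w : R[i]) : l * u - w = v -> l * (l^-1 * u) + l^-1 * - v - l^-1 * w = 0.
    by move=> <-; field.
  exists (l^-1, l^-1 *: p) => //; split; split => //=; [|by rewrite mulrC|]; near=> x.
  + rewrite -[LHS]/(l * (l^-1 * p x) + l^-1 * - f x + ((- f) \conv (l^-1 *: p)) x).
    rewrite (_ : ((- f) \conv (l^-1 *: p)) x = - (f \conv (l^-1 *: p)) x); last by near: x.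
    rewrite (_ : (f \conv (l^-1 *: p)) x = l^-1 * (f \conv p) x); last by near: x.
    by apply: lin; near: x.
  + rewrite -[LHS]/(l^-1 * - f x + l * (l^-1 * p x) + ((l^-1 *: p) \conv (- f)) x).
    rewrite (_ : ((l^-1 *: p) \conv (- f)) x = - ((l^-1 *: p) \conv f) x); last by near: x.
    rewrite (_ : ((l^-1 *: p) \conv f) x = l^-1 * (p \conv f) x); last by near: x.
    rewrite [l^-1 * _ + _]addrC.
    by apply: lin; near: x.
Unshelve. all: by end_near. Qed.

(** As in the unitization, with the identity [e] in place of [1]. *)
Lemma invertible_identityP e l f : is_identity (A := B) e -> M f -> l != 0 ->
  invertible (A := B) e (l *: e - f) <-> quasi_invertible M l f.
Proof.
move=> [Me idM] Mf l0.
have Mle := ca_Z CM l Me; have Mlef := ca_sub CM Mle Mf.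
have ll : l * l^-1 = 1 by rewrite mulfV.
have [fe1 fe2] := idM f Mf.
split.
- move=> [y My [yl yr]].
  have [ye1 ye2] := idM y My.
  have Mly := ca_Z CM l My.
  have Dl := convBl CM Mle Mf My; have Dr := convBr CM Mle Mf My.
  have Zl := convZl CM l Me My; have Zr := convZr CM l Me My.
  have Bl := convBl CM Mly Me Mf; have Br := convBr CM Mly Me Mf.
  have Zl' := convZl CM l My Mf; have Zr' := convZr CM l My Mf.
  exists (l *: y - e); first exact: ca_sub.
  have lin (u v w z : R[i]) : l * u - w = v -> l * (l * u - v) - (l * w - z) = z.
    by move=> <-; ring.
  split; near=> x.
  + rewrite -[LHS]/(l * (l * y x - e x) - (f \conv (l *: y - e)) x).
    rewrite (_ : (f \conv (l *: y - e)) x = (f \conv (l *: y)) x - (f \conv e) x); last by near: x.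
    rewrite (_ : (f \conv (l *: y)) x = l * (f \conv y) x); last by near: x.
    rewrite (_ : (f \conv e) x = f x); last by near: x.
    apply: lin; rewrite -(_ : ((l *: e - f) \conv y) x = e x); last by near: x.
    rewrite (_ : ((l *: e - f) \conv y) x = ((l *: e) \conv y) x - (f \conv y) x); last by near: x.
    rewrite (_ : ((l *: e) \conv y) x = l * (e \conv y) x); last by near: x.
    by rewrite (_ : (e \conv y) x = y x); last by near: x.
  + rewrite -[LHS]/(l * (l * y x - e x) - ((l *: y - e) \conv f) x).
    rewrite (_ : ((l *: y - e) \conv f) x = ((l *: y) \conv f) x - (e \conv f) x); last by near: x.
    rewrite (_ : ((l *: y) \conv f) x = l * (y \conv f) x); last by near: x.
    rewrite (_ : (e \conv f) x = f x); last by near: x.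
    apply: lin; rewrite -(_ : (y \conv (l *: e - f)) x = e x); last by near: x.
    rewrite (_ : (y \conv (l *: e - f)) x = (y \conv (l *: e)) x - (y \conv f) x); last by near: x.
    rewrite (_ : (y \conv (l *: e)) x = l * (y \conv e) x); last by near: x.
    by rewrite (_ : (y \conv e) x = y x); last by near: x.
- move=> [p Mp [Hl Hr]].
  have [pe1 pe2] := idM p Mp; have [ee1 _] := idM e Me.
  have Mep := ca_add CM Me Mp; have My := ca_Z CM l^-1 Mep.
  have lin (u v w z : R[i]) : l * u - w = v -> l * (l^-1 * (z + u)) - l^-1 * (v + w) = z.
    by move=> <-; field.
  exists (l^-1 *: (e + p)) => //.
  have Dl := convBl CM Mle Mf My; have Dr := convBr CM Mle Mf My.
  have Zl := convZl CM l Me My; have Zr := convZr CM l Me My.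
  have [ye1 ye2] := idM _ My.
  have Zl' := convZl CM l^-1 Mep Mf; have Zr' := convZr CM l^-1 Mep Mf.
  have Dl' := convDl CM Me Mp Mf; have Dr' := convDr CM Me Mp Mf.
  split; near=> x.
  + rewrite -[LHS]/(((l *: e - f) \conv (l^-1 *: (e + p))) x).
    rewrite (_ : ((l *: e - f) \conv (l^-1 *: (e + p))) x = ((l *: e) \conv (l^-1 *: (e + p))) x - (f \conv (l^-1 *: (e + p))) x); last by near: x.
    rewrite (_ : ((l *: e) \conv (l^-1 *: (e + p))) x = l * (e \conv (l^-1 *: (e + p))) x); last by near: x.
    rewrite (_ : (e \conv (l^-1 *: (e + p))) x = l^-1 * (e x + p x)); last by near: x.
    rewrite (_ : (f \conv (l^-1 *: (e + p))) x = l^-1 * (f \conv (e + p)) x); last by near: x.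
    rewrite (_ : (f \conv (e + p)) x = (f \conv e) x + (f \conv p) x); last by near: x.
    rewrite (_ : (f \conv e) x = f x); last by near: x.
    by apply: lin; near: x.
  + rewrite -[LHS]/(((l^-1 *: (e + p)) \conv (l *: e - f)) x).
    rewrite (_ : ((l^-1 *: (e + p)) \conv (l *: e - f)) x = ((l^-1 *: (e + p)) \conv (l *: e)) x - ((l^-1 *: (e + p)) \conv f) x); last by near: x.
    rewrite (_ : ((l^-1 *: (e + p)) \conv (l *: e)) x = l * ((l^-1 *: (e + p)) \conv e) x); last by near: x.
    rewrite (_ : ((l^-1 *: (e + p)) \conv e) x = l^-1 * (e x + p x)); last by near: x.
    rewrite (_ : ((l^-1 *: (e + p)) \conv f) x = l^-1 * ((e + p) \conv f) x); last by near: x.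
    rewrite (_ : ((e + p) \conv f) x = (e \conv f) x + (p \conv f) x); last by near: x.
    rewrite (_ : (e \conv f) x = f x); last by near: x.
    by apply: lin; near: x.
Unshelve. all: by end_near. Qed.

Lemma spectrum_neq0P l f : M f -> l != 0 ->
  spectrum B f l <-> ~ quasi_invertible M l f.
Proof.
move=> Mf l0; split.
- move=> [[e ide ninv] qi|[noid ninv] qi]; apply: ninv.
    exact/(invertible_identityP ide Mf l0).
  exact/unitization_invertibleP.
- move=> nqi; have [[e ide]|noid] := pselect (exists e, is_identity (A := B) e).
    by left; exists e => // inv; apply: nqi; exact/(invertible_identityP ide Mf l0).
  by right; split => // inv; apply: nqi; exact/(unitization_invertibleP Mf l0).
Qed.

(** [- f = 1 - (1 + f)] moves the spectral value [0] to [1]. *)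
Lemma spectrum0_unitalP e f : is_identity (A := B) e -> M f ->
  spectrum B f 0 <-> ~ quasi_invertible M 1 (e + f).
Proof.
move=> ide Mf; have [Me eM] := ide.
have Mef := ca_add CM Me Mf.
have ef e' : 0 *: e' - f = 1 *: e - (e + f).
  by rewrite scale0r scale1r opprD addrA subrr.
split.
- move=> [[e' [Me' e'M] ninv] /(invertible_identityP ide Mef (oner_neq0 _)) inv|[noid]]; last first.
    by move=> _ _; apply: noid; exists e.
  apply: ninv; have [y My [ye1 ye2]] := inv.
  have ee' : e =ae e'.
    exact: aeeq_trans (aeeq_sym (e'M _ Me).1) (eM _ Me').2.
  by exists y => //; rewrite ef; split; apply: aeeq_trans ee'.
- move=> nqi; left; exists e => // -[y My]; rewrite ef => inv; apply: nqi.
  by apply/(invertible_identityP ide Mef (oner_neq0 _)); exists y.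
Qed.

(** In the unitization [- f] lies in a proper ideal. *)
Lemma spectrum0_nonunital f : ~ (exists e, is_identity (A := B) e) -> spectrum B f 0.
Proof.
move=> noid; right; split => // -[[c q] _ [[/= lc _] _]].
move: lc; rewrite scale0r subr0 mul0r => /eqP; rewrite eq_sym; apply/negP.
exact: oner_neq0.
Qed.

End Spectrum.

(** Nonzero spectral values are characterized by quasi-inverses. For the value
    [0], the shift by the identity of the smaller algebra, also an identity of
    the larger one, applies to both. *)
Lemma eq_spectrum M1 M2 st1 st2 nm1 nm2 f :
  convolution_algebra M1 -> convolution_algebra M2 -> M1 `<=` M2 ->
  (forall l g, l != 0 -> M1 g -> quasi_invertible M2 l g -> quasi_invertible M1 l g) ->
  let B1 := @StarAlgebra R (G -> R[i]) M1 (aeeq mu) (convolution mu) st1 nm1 in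
  let B2 := @StarAlgebra R (G -> R[i]) M2 (aeeq mu) (convolution mu) st2 nm2 in
  (forall e, is_identity (A := B1) e -> is_identity (A := B2) e) ->
  ((exists e, is_identity (A := B2) e) -> exists e, is_identity (A := B1) e) ->
  M1 f -> spectrum B1 f = spectrum B2 f.
Proof.
move=> C1 C2 M12 qi21 B1 B2 id12 id21 M1f.
have qi l g : l != 0 -> M1 g -> quasi_invertible M1 l g <-> quasi_invertible M2 l g.
  by move=> l0 M1g; split; [move=> [p M1p pP]; exists p => //; exact: M12|exact: qi21].
apply/seteqP; split => l.
all: have [->|l0] := eqVneq l 0; last first.
- move=> /(spectrum_neq0P C1 _ _ M1f l0) nqi; apply/(spectrum_neq0P C2 _ _ (M12 _ M1f) l0).
  by move=> /(qi _ _ l0 M1f).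
- have [[e id1]|noid] := pselect (exists e, is_identity (A := B1) e); last first.
    by move=> _; apply: spectrum0_nonunital => /id21.
  have M1ef : M1 (e + f) by apply: (ca_add C1) => //; case: id1.
  move=> /(spectrum0_unitalP C1 id1 M1f) nqi.
  apply/(spectrum0_unitalP C2 (id12 _ id1) (M12 _ M1f)).
  by move=> /(qi _ _ (oner_neq0 _) M1ef).
- move=> /(spectrum_neq0P C2 _ _ (M12 _ M1f) l0) nqi; apply/(spectrum_neq0P C1 _ _ M1f l0).
  by move=> /(qi _ _ l0 M1f).
- have [[e id1]|noid] := pselect (exists e, is_identity (A := B1) e); last first.
    by move=> _; exact: spectrum0_nonunital.
  have M1ef : M1 (e + f) by apply: (ca_add C1) => //; case: id1.
  move=> /(spectrum0_unitalP C2 (id12 _ id1) (M12 _ M1f)) nqi.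
  apply/(spectrum0_unitalP C1 id1 M1f).
  by move=> /(qi _ _ (oner_neq0 _) M1ef).
Qed.

End ConvolutionAlgebra.

(** * Neumann series *)

Section NeumannSeries.
Variables (R : realType) (G : topologicalGroupType).
Variable mu : {measure set (borel G) -> \bar R}.
Local Notation "f \conv g" := (convolution mu f g) (at level 40).
Local Notation "f =ae g" := (aeeq mu f g) (at level 70).
Local Notation normc := (@Normc.normc R).
Variable M : set (G -> R[i]).
Variables (st : (G -> R[i]) -> (G -> R[i])) (nm : (G -> R[i]) -> \bar R).
Let B : star_algebra R :=
  @StarAlgebra R (G -> R[i]) M (aeeq mu) (convolution mu) st nm.
Hypothesis HB : banach_star_algebra B.
Implicit Types (f g h : G -> R[i]) (a l : R[i]).

Lemma banach_convolution_algebra : convolution_algebra mu M.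
Proof.
split.
- exact: (bsa_mem0 HB).
- exact: (bsa_memD HB).
- exact: (bsa_memM HB).
- exact: (bsa_mulDl HB).
- exact: (bsa_mulDr HB).
Qed.

Let CM := banach_convolution_algebra.

Definition rnm f : R := fine (nm f).

Lemma rnmE f : M f -> nm f = (rnm f)%:E.
Proof. by move=> /(bsa_norm_fin HB)/andP[n0 noo]; rewrite fineK// ge0_fin_numE. Qed.

Lemma rnm_ge0 f : M f -> 0 <= rnm f.
Proof. by move=> /(bsa_norm_fin HB)/andP[n0 noo]; exact: fine_ge0. Qed.

Lemma rnmD f g : M f -> M g -> rnm (f + g) <= rnm f + rnm g.
Proof.
move=> Mf Mg; have := bsa_normD HB Mf Mg.
by rewrite /= (rnmE Mf) (rnmE Mg) (rnmE (ca_add CM Mf Mg)) -EFinD lee_fin.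
Qed.

Lemma rnmZ a f : M f -> rnm (a *: f) = normc a * rnm f.
Proof.
move=> Mf; have := bsa_normZ HB a Mf.
by rewrite /= (rnmE Mf) (rnmE (ca_Z CM a Mf)) -EFinM => -[].
Qed.

Lemma rnmN f : M f -> rnm (- f) = rnm f.
Proof. by move=> Mf; rewrite -scaleN1r rnmZ// normcN normc1 mul1r. Qed.

Lemma rnmB f g : M f -> M g -> rnm (f - g) <= rnm f + rnm g.
Proof. by move=> Mf Mg; rewrite -(rnmN Mg); apply: rnmD => //; exact: (ca_N CM). Qed.

Lemma rnm_eq f g : M f -> M g -> f =ae g -> rnm f = rnm g.
Proof. by move=> Mf Mg fg; congr fine; exact: (bsa_eqv_norm HB Mf Mg fg). Qed.

Lemma rnm_eq0 f : M f -> rnm f = 0 -> f =ae 0.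
Proof. by move=> Mf f0; apply/(bsa_norm_eq0 HB Mf); rewrite /= rnmE// f0. Qed.

Lemma rnmM : exists2 c : R, 0 <= c & forall f g, M f -> M g ->
  rnm (f \conv g) <= c * (rnm f * rnm g).
Proof.
have [c cP] := bsa_normM HB; exists (Num.max 0 c); first by rewrite le_max lexx.
move=> f g Mf Mg; have := cP f g Mf Mg.
rewrite /= (rnmE Mf) (rnmE Mg) (rnmE (ca_M CM Mf Mg)) -!EFinM lee_fin => /le_trans; apply.
by rewrite ler_wpM2r ?mulr_ge0 ?rnm_ge0// le_max lexx orbT.
Qed.

Section Series.
Variables (a : G -> R[i]) (alpha : R[i]) (w : nat -> G -> R[i]) (D theta : R).
Hypothesis Ma : M a.
Hypothesis w0 : w 0%N = a.
Hypothesis wS : forall k, w k.+1 = alpha *: w k + a \conv w k.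
Hypothesis theta01 : 0 <= theta < 1.
Hypothesis wle : forall k, rnm (w k) <= D * theta ^+ k.

Let S n := \sum_(k < n) w k.

Lemma neumann_mem k : M (w k).
Proof.
elim: k => [|k IHk]; first by rewrite w0.
by rewrite wS; apply: (ca_D CM) => //; exact: (ca_M CM).
Qed.

Lemma neumann_commute k : a \conv w k =ae w k \conv a.
Proof.
elim: k => [|k IHk]; first by rewrite w0; exact: aeeq_refl.
have Mw := neumann_mem k; have Maw := ca_M CM Ma Mw; have Mwa := ca_M CM Mw Ma.
rewrite wS; have H1 := ca_linear_r CM alpha Mw Maw Ma.
have H2 := ca_linear_l CM alpha Mw Maw Ma.
have H3 : (a \conv w k) \conv a =ae a \conv (a \conv w k).
  apply: aeeq_trans (aeeq_sym (bsa_mulA HB Ma Mw Ma)) _.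
  by apply: (bsa_eqvM HB) => //; [exact: aeeq_refl|exact: aeeq_sym].
near=> x.
transitivity (alpha * (a \conv w k) x + (a \conv (a \conv w k)) x); first by near: x.
rewrite -(_ : ((a \conv w k) \conv a) x = (a \conv (a \conv w k)) x); last by near: x.
rewrite (_ : (a \conv w k) x = (w k \conv a) x); last by near: x.
by apply/esym; near: x.
Unshelve. all: by end_near. Qed.

Lemma neumann_partial_mem n : M (S n).
Proof.
rewrite /S; elim/big_ind : _; [exact: (ca_0 CM)|exact: (ca_add CM)|].
by move=> k _; exact: neumann_mem.
Qed.

Lemma neumann_partial_l n : S n - alpha *: S n - a \conv S n =ae a - w n.
Proof.
elim: n => [|n IHn].
  rewrite /S big_ord0 scaler0 subr0 w0 subrr sub0r.
  by apply: filterS (conv0r CM Ma) => x e; rewrite -[LHS]/(- (a \conv 0) x) e oppr0.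
have MS := neumann_partial_mem n; have Mw := neumann_mem n.
have H := convDr CM MS Mw Ma.
have -> : S n.+1 = S n + w n by rewrite /S big_ord_recr.
rewrite wS; near=> x.
rewrite -[LHS]/(S n x + w n x - alpha * (S n x + w n x) - (a \conv (S n + w n)) x).
rewrite (_ : (a \conv (S n + w n)) x = (a \conv S n) x + (a \conv w n) x); last by near: x.
rewrite -[RHS]/(a x - (alpha * w n x + (a \conv w n) x)).
have e : S n x - alpha * S n x - (a \conv S n) x = a x - w n x by near: x.
transitivity (S n x - alpha * S n x - (a \conv S n) x + (w n x - alpha * w n x - (a \conv w n) x)); first by ring.
by rewrite e; ring.
Unshelve. all: by end_near. Qed.

Lemma neumann_partial_r n : S n - alpha *: S n - S n \conv a =ae a - w n.
Proof.
elim: n => [|n IHn].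
  rewrite /S big_ord0 scaler0 subr0 w0 subrr sub0r.
  by apply: filterS (conv0l CM Ma) => x e; rewrite -[LHS]/(- (0 \conv a) x) e oppr0.
have MS := neumann_partial_mem n; have Mw := neumann_mem n.
have H := convDl CM MS Mw Ma.
have C := neumann_commute n.
have -> : S n.+1 = S n + w n by rewrite /S big_ord_recr.
rewrite wS; near=> x.
rewrite -[LHS]/(S n x + w n x - alpha * (S n x + w n x) - ((S n + w n) \conv a) x).
rewrite (_ : ((S n + w n) \conv a) x = (S n \conv a) x + (w n \conv a) x); last by near: x.
rewrite -[RHS]/(a x - (alpha * w n x + (a \conv w n) x)).
rewrite (_ : (a \conv w n) x = (w n \conv a) x); last by near: x.
have e : S n x - alpha * S n x - (S n \conv a) x = a x - w n x by near: x.
transitivity (S n x - alpha * S n x - (S n \conv a) x + (w n x - alpha * w n x - (w n \conv a) x)); first by ring.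
by rewrite e; ring.
Unshelve. all: by end_near. Qed.

Lemma neumann_tail n m : rnm (S (n + m) - S n) <= D * theta ^+ n * (1 - theta)^-1.
Proof.
have [t0 t1] := andP theta01.
have D0 : 0 <= D by have := wle 0; rewrite expr0 mulr1; apply: le_trans; exact/rnm_ge0/neumann_mem.
have -> : S (n + m) - S n = \sum_(k < m) w (n + k)%N.
  by rewrite /S big_split_ord /= addrAC subrr add0r.
apply: (@le_trans _ _ (\sum_(k < m) D * theta ^+ n * theta ^+ k)).
  elim: m => [|m IHm].
    rewrite !big_ord0; have -> : (0 : G -> R[i]) = 0 *: a by rewrite scale0r.
    by rewrite rnmZ// normc0 mul0r.
  rewrite !big_ord_recr /=; apply: le_trans (rnmD _ _) _.
  - elim/big_ind : _; [exact: (ca_0 CM)|exact: (ca_add CM)|].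
    by move=> k _; exact: neumann_mem.
  - exact: neumann_mem.
  - by apply: lerD => //; rewrite -mulrA -exprD.
rewrite -mulr_sumr ler_wpM2l ?mulr_ge0 ?exprn_ge0//.
rewrite -[leRHS]mul1r ler_pdivlMr ?subr_gt0// mulrC.
have -> : (1 - theta) * \sum_(k < m) theta ^+ k = 1 - theta ^+ m.
  by rewrite -[1 - theta]opprB mulNr -subrX1 opprB.
by rewrite gerBl exprn_ge0.
Qed.

(** In the unitization [w k] is [(alpha + a)^k a], and the series, which is
    Cauchy, sums to [(1 - alpha - a)^-1 a]. The constant [alpha] leaves room
    for a shift of the spectral parameter before the expansion. *)
Lemma neumann_series : exists2 v, M v &
  v - alpha *: v - a \conv v =ae a /\ v - alpha *: v - v \conv a =ae a.
Proof.
have [t0 t1] := andP theta01.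
have D0 : 0 <= D by have := wle 0; rewrite expr0 mulr1; apply: le_trans; exact/rnm_ge0/neumann_mem.
have geo (C e : R) : 0 < e -> exists N, forall n, (N <= n)%N -> C * theta ^+ n < e.
  move=> e0; have : (geometric C theta) @ \oo --> 0.
    by apply: cvg_geometric; rewrite ger0_norm.
  move=> /cvgr0Pnorm_lt/(_ _ e0)[N _ NP]; exists N => n /NP.
  exact: le_lt_trans (ler_norm _).
have MS := neumann_partial_mem.
have [|v Mv Sv] := bsa_complete HB (u := S) MS.
  move=> e e0; have [N NP] := geo (D * (1 - theta)^-1) e e0.
  exists N => m n Nm Nn.
  have dist p q : (N <= p)%N -> (p <= q)%N -> rnm (S q - S p) < e.
    move=> Np pq; rewrite -(subnKC pq); apply: le_lt_trans (neumann_tail _ _) _.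
    by rewrite mulrAC; exact: NP.
  rewrite /= rnmE ?lte_fin; last exact: (ca_sub CM).
  have [mn|/ltnW nm'] := leqP m n; last exact: dist.
  by rewrite -rnmN; [rewrite opprB; exact: dist|exact: (ca_sub CM)].
exists v => //.
have small e : 0 < e -> exists2 n, rnm (v - S n) < e & D * theta ^+ n < e.
  move=> e0; have [N NP] := geo D e e0.
  have /fine_cvgP[_ cv] := Sv.
  have : \forall n \near \oo, rnm (S n - v) < e by apply: (cvgr_lt 0 cv).
  move=> [N' _ N'P]; exists (maxn N N'); last by apply: NP; rewrite leq_maxl.
  have := N'P (maxn N N') (leq_maxr _ _).
  by rewrite -rnmN ?opprB//; exact: (ca_sub CM).
(* The identities for the partial sums pass to the limit; [L] stands for the left
   or the right convolution by [a]. *)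
have key (L : (G -> R[i]) -> G -> R[i]) (C : R) : 0 <= C -> (forall f, M f -> M (L f)) ->
    (forall f, M f -> rnm (L f) <= C * rnm f) ->
    (forall f g, M f -> M g -> {ae mu, forall x : borel G, L (f - g) x = L f x - L g x}) ->
    (forall n, S n - alpha *: S n - L (S n) =ae a - w n) ->
    v - alpha *: v - L v =ae a.
  move=> C0 ML LC LB LS.
  set X := v - alpha *: v - L v - a.
  have MZ f : M f -> M (f - alpha *: f - L f).
    by move=> Mf; apply: (ca_sub CM); [apply: (ca_sub CM) => //; exact: (ca_Z CM)|exact: ML].
  have MX : M X by apply: (ca_sub CM) => //; exact: MZ.
  suff X0 : rnm X = 0.
    apply: filterS (rnm_eq0 MX X0) => x; rewrite -[X x]/((v - alpha *: v - L v) x - a x).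
    by move=> /eqP; rewrite subr_eq0 => /eqP.
  apply/eqP; rewrite eq_le rnm_ge0// andbT; apply/ler_addgt0Pr => e e0; rewrite add0r.
  have K0 : 0 < 2 + normc alpha + C by rewrite -addrA ltr_pwDl// addr_ge0// normc_ge0.
  have [n nv Dn] := small _ (divr_gt0 e0 K0).
  have Md : M (v - S n) by exact: (ca_sub CM).
  have Mw := neumann_mem n.
  have XE : X =ae (v - S n) - alpha *: (v - S n) - L (v - S n) - w n.
    have := LS n; have := LB v (S n) Mv (MS n); apply: filterS2 => x e1 e2.
    rewrite -[RHS]/(v x - S n x - alpha * (v x - S n x) - L (v - S n) x - w n x) e1.
    rewrite -[LHS]/(v x - alpha * v x - L v x - a x).
    have {}e2 : S n x - alpha * S n x - L (S n) x = a x - w n x := e2.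
    transitivity (v x - alpha * v x - L v x - (a x - w n x) - w n x); first by ring.
    by rewrite -e2; ring.
  rewrite (rnm_eq MX _ XE); last by apply: (ca_sub CM) => //; exact: MZ.
  apply: (le_trans (rnmB (MZ _ Md) Mw)).
  apply: (@le_trans _ _ ((1 + normc alpha + C) * rnm (v - S n) + D * theta ^+ n)).
    apply: lerD (wle n).
    apply: (le_trans (rnmB _ (ML _ Md))); first by apply: (ca_sub CM) => //; exact: (ca_Z CM).
    rewrite mulrDl; apply: lerD (LC _ Md).
    apply: (le_trans (rnmB Md (ca_Z CM _ Md))).
    by rewrite rnmZ// mulrDl mul1r.
  apply: (@le_trans _ _ ((1 + normc alpha + C) * (e / (2 + normc alpha + C)) + e / (2 + normc alpha + C))).
    apply: lerD; last exact: ltW.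
    by apply: ler_wpM2l; [rewrite !addr_ge0// normc_ge0|exact: ltW].
  by rewrite le_eqVlt; apply/orP; left; apply/eqP; field; rewrite gt_eqF.
have [c c0 cP] := rnmM.
split.
- apply: (key (fun f => a \conv f) (c * rnm a)).
  + by rewrite mulr_ge0// rnm_ge0.
  + by move=> f Mf; exact: (ca_M CM).
  + by move=> f Mf; rewrite -mulrA; exact: cP.
  + by move=> f g Mf Mg; exact: (convBr CM).
  + exact: neumann_partial_l.
- apply: (key (fun f => f \conv a) (c * rnm a)).
  + by rewrite mulr_ge0// rnm_ge0.
  + by move=> f Mf; exact: (ca_M CM).
  + by move=> f Mf; rewrite -mulrA [rnm a * _]mulrC; exact: cP.
  + by move=> f g Mf Mg; exact: (convBl CM).
  + exact: neumann_partial_r.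
Qed.

End Series.

End NeumannSeries.

(** * Corrections of approximate quasi-inverses *)

(** Any ratio strictly between [theta] and [1] absorbs the factor [k] in the
    solution [k theta^k] of the recursion. *)
Lemma geometric_growth (R : realType) (b : nat -> R) (theta c : R) :
  0 <= theta < 1 -> 0 <= c ->
  (forall k, b k.+1 <= theta * b k + c * theta ^+ k) ->
  exists D theta', 0 <= theta' < 1 /\ forall k, b k <= D * theta' ^+ k.
Proof.
move=> /andP[t0 t1] c0 bS.
pose t' := (1 + theta) / 2; pose d := (1 - theta) / 2.
have d0 : 0 < d by rewrite /d divr_gt0// subr_gt0.
have t'E : t' = theta + d by rewrite /t' /d; field.
have tt' : theta <= t' by rewrite t'E lerDl ltW.
have t'0 : 0 <= t' by exact: le_trans tt'.
exists (`|b 0%N| + c / d), t'; split.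
  by rewrite t'0 /t' ltr_pdivrMr// mul1r -[ltRHS]/(1 + 1)%R ltrD2l.
elim=> [|k IHk].
  by rewrite expr0 mulr1 (le_trans (ler_norm _))// lerDl divr_ge0// ltW.
apply: (le_trans (bS k)); rewrite exprS.
have tk : theta ^+ k <= t' ^+ k by rewrite lerXn2r ?nnegrE.
apply: (@le_trans _ _ (theta * ((`|b 0%N| + c / d) * t' ^+ k) + c * t' ^+ k)).
  by apply: lerD; [exact: ler_wpM2l|exact: ler_wpM2l].
set K := _ + c / d; set T := t' ^+ k.
have -> : theta * (K * T) + c * T = (K * theta + c) * T by ring.
rewrite [leRHS]mulrA; apply: ler_wpM2r; first exact: exprn_ge0.
rewrite t'E mulrDr lerD2l /K mulrDl divfK ?gt_eqF//.
by rewrite lerDr mulr_ge0// ltW.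
Qed.

Section QuasiInverse.
Variables (R : realType) (G : topologicalGroupType).
Variable mu : {measure set (borel G) -> \bar R}.
Local Notation "f \conv g" := (convolution mu f g) (at level 40).
Local Notation "f =ae g" := (aeeq mu f g) (at level 70).
Variable M : set (G -> R[i]).
Variables (st : (G -> R[i]) -> (G -> R[i])) (nm : (G -> R[i]) -> \bar R).
Let B : star_algebra R :=
  @StarAlgebra R (G -> R[i]) M (aeeq mu) (convolution mu) st nm.
Hypothesis HB : banach_star_algebra B.
Implicit Types (f g h : G -> R[i]) (a l : R[i]).
Let CM := banach_convolution_algebra HB.

Lemma convA f g h : M f -> M g -> M h ->
  {ae mu, forall x : borel G, ((f \conv g) \conv h) x = (f \conv (g \conv h)) x}.
Proof. by move=> Mf Mg Mh; exact: aeeq_sym (bsa_mulA HB Mf Mg Mh). Qed.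

Lemma conv_eq f f' g g' : M f -> M f' -> M g -> M g' -> f =ae f' -> g =ae g' ->
  {ae mu, forall x : borel G, (f \conv g) x = (f' \conv g') x}.
Proof. by move=> *; exact: (bsa_eqvM HB). Qed.

(** One-sided quasi-inverses agree, as one-sided inverses do. *)
Lemma quasi_invertible_lr l f p1 p2 : l != 0 -> M f -> M p1 -> M p2 ->
  l *: p1 - f \conv p1 =ae f -> l *: p2 - p2 \conv f =ae f ->
  quasi_invertible mu M l f.
Proof.
move=> l0 Mf M1 M2 H1 H2.
have Mf1 := ca_M CM Mf M1; have M2f := ca_M CM M2 Mf.
have Ml1 := ca_Z CM l M1; have Ml2 := ca_Z CM l M2.
have E1 := conv_eq M2 M2 (ca_sub CM Ml1 Mf1) Mf (aeeq_refl _ _) H1.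
have E2 := conv_eq (ca_sub CM Ml2 M2f) Mf M1 M1 H2 (aeeq_refl _ _).
have B1 := convBr CM Ml1 Mf1 M2; have B2 := convBl CM Ml2 M2f M1.
have Z1 := convZr CM l M1 M2; have Z2 := convZl CM l M2 M1.
have A12 := convA M2 Mf M1.
have comm : p2 \conv f =ae f \conv p1.
  near=> x.
  rewrite -(_ : (p2 \conv (l *: p1 - f \conv p1)) x = (p2 \conv f) x); last by near: x.
  rewrite -(_ : ((l *: p2 - p2 \conv f) \conv p1) x = (f \conv p1) x); last by near: x.
  rewrite (_ : (p2 \conv (l *: p1 - f \conv p1)) x = (p2 \conv (l *: p1)) x - (p2 \conv (f \conv p1)) x); last by near: x.
  rewrite (_ : ((l *: p2 - p2 \conv f) \conv p1) x = ((l *: p2) \conv p1) x - ((p2 \conv f) \conv p1) x); last by near: x.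
  rewrite (_ : (p2 \conv (l *: p1)) x = l * (p2 \conv p1) x); last by near: x.
  rewrite (_ : ((l *: p2) \conv p1) x = l * (p2 \conv p1) x); last by near: x.
  by rewrite (_ : ((p2 \conv f) \conv p1) x = (p2 \conv (f \conv p1)) x)//; near: x.
have p12 : p1 =ae p2.
  near=> x; apply: (mulfI l0).
  have e1 : l * p1 x - (f \conv p1) x = f x by near: x.
  have e2 : l * p2 x - (p2 \conv f) x = f x by near: x.
  have e3 : (p2 \conv f) x = (f \conv p1) x by near: x.
  transitivity (f x + (f \conv p1) x); first by rewrite -e1 subrK.
  by rewrite -e2 e3 subrK.
have p1f := conv_eq M1 M2 Mf Mf p12 (aeeq_refl _ _).
exists p1 => //; split => //; near=> x.
rewrite -[LHS]/(l * p1 x - (p1 \conv f) x).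
rewrite (_ : (p1 \conv f) x = (p2 \conv f) x); last by near: x.
rewrite (_ : p1 x = p2 x); last by near: x.
by near: x.
Unshelve. all: by end_near. Qed.

(** If [(l - f) (1 + h) = l (1 - u)] and [(1 - u) (1 + v) = 1] then
    [(1 + h) (1 + v)] is a right inverse of [l - f], up to the factor [l]. *)
Lemma right_quasi_inverse l f h u v : l != 0 -> M f -> M h -> M v ->
  u = l^-1 *: (f - (l *: h - f \conv h)) -> v - u \conv v =ae u ->
  l *: (h + v + h \conv v) - f \conv (h + v + h \conv v) =ae f.
Proof.
move=> l0 Mf Mh Mv uE uv.
have Mfh := ca_M CM Mf Mh; have Mhv := ca_M CM Mh Mv; have Mlh := ca_Z CM l Mh.
have MX := ca_sub CM Mlh Mfh; have MY := ca_sub CM Mf MX; have MD := ca_add CM Mh Mv.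
have D1 := convDr CM MD Mhv Mf; have D2 := convDr CM Mh Mv Mf.
have A1 := convA Mf Mh Mv.
have Z1 := convZl CM l^-1 MY Mv; have B1 := convBl CM Mf MX Mv.
have B2 := convBl CM Mlh Mfh Mv; have Z2 := convZl CM l Mh Mv.
near=> x.
rewrite -[LHS]/(l * (h x + v x + (h \conv v) x) - (f \conv (h + v + h \conv v)) x).
rewrite (_ : (f \conv (h + v + h \conv v)) x = (f \conv (h + v)) x + (f \conv (h \conv v)) x); last by near: x.
rewrite (_ : (f \conv (h + v)) x = (f \conv h) x + (f \conv v) x); last by near: x.
rewrite -(_ : ((f \conv h) \conv v) x = (f \conv (h \conv v)) x); last by near: x.
have e : v x - (u \conv v) x = l^-1 * (f x - (l * h x - (f \conv h) x)).
  by transitivity (u x); [near: x|rewrite uE].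
have e2 : (u \conv v) x = l^-1 * ((f \conv v) x - (l * (h \conv v) x - ((f \conv h) \conv v) x)).
  rewrite uE (_ : ((l^-1 *: (f - (l *: h - f \conv h))) \conv v) x = l^-1 * ((f - (l *: h - f \conv h)) \conv v) x); last by near: x.
  rewrite (_ : ((f - (l *: h - f \conv h)) \conv v) x = (f \conv v) x - ((l *: h - f \conv h) \conv v) x); last by near: x.
  rewrite (_ : ((l *: h - f \conv h) \conv v) x = ((l *: h) \conv v) x - ((f \conv h) \conv v) x); last by near: x.
  by rewrite (_ : ((l *: h) \conv v) x = l * (h \conv v) x)//; near: x.
have {}e : l * v x = f x - (l * h x - (f \conv h) x) + ((f \conv v) x - (l * (h \conv v) x - ((f \conv h) \conv v) x)).
  transitivity (l * ((v x - (u \conv v) x) + (u \conv v) x)); first by ring.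
  by rewrite e e2; field.
by rewrite !mulrDr e; ring.
Unshelve. all: by end_near. Qed.

Lemma left_quasi_inverse l f h u v : l != 0 -> M f -> M h -> M v ->
  u = l^-1 *: (f - (l *: h - h \conv f)) -> v - v \conv u =ae u ->
  l *: (h + v + v \conv h) - (h + v + v \conv h) \conv f =ae f.
Proof.
move=> l0 Mf Mh Mv uE uv.
have Mhf := ca_M CM Mh Mf; have Mvh := ca_M CM Mv Mh; have Mlh := ca_Z CM l Mh.
have MX := ca_sub CM Mlh Mhf; have MY := ca_sub CM Mf MX; have MD := ca_add CM Mh Mv.
have D1 := convDl CM MD Mvh Mf; have D2 := convDl CM Mh Mv Mf.
have A1 := convA Mv Mh Mf.
have Z1 := convZr CM l^-1 MY Mv; have B1 := convBr CM Mf MX Mv.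
have B2 := convBr CM Mlh Mhf Mv; have Z2 := convZr CM l Mh Mv.
near=> x.
rewrite -[LHS]/(l * (h x + v x + (v \conv h) x) - ((h + v + v \conv h) \conv f) x).
rewrite (_ : ((h + v + v \conv h) \conv f) x = ((h + v) \conv f) x + ((v \conv h) \conv f) x); last by near: x.
rewrite (_ : ((h + v) \conv f) x = (h \conv f) x + (v \conv f) x); last by near: x.
rewrite (_ : ((v \conv h) \conv f) x = (v \conv (h \conv f)) x); last by near: x.
have e : v x - (v \conv u) x = l^-1 * (f x - (l * h x - (h \conv f) x)).
  by transitivity (u x); [near: x|rewrite uE].
have e2 : (v \conv u) x = l^-1 * ((v \conv f) x - (l * (v \conv h) x - (v \conv (h \conv f)) x)).
  rewrite uE (_ : (v \conv (l^-1 *: (f - (l *: h - h \conv f)))) x = l^-1 * (v \conv (f - (l *: h - h \conv f))) x); last by near: x.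
  rewrite (_ : (v \conv (f - (l *: h - h \conv f))) x = (v \conv f) x - (v \conv (l *: h - h \conv f)) x); last by near: x.
  rewrite (_ : (v \conv (l *: h - h \conv f)) x = (v \conv (l *: h)) x - (v \conv (h \conv f)) x); last by near: x.
  by rewrite (_ : (v \conv (l *: h)) x = l * (v \conv h) x)//; near: x.
have {}e : l * v x = f x - (l * h x - (h \conv f) x) + ((v \conv f) x - (l * (v \conv h) x - (v \conv (h \conv f)) x)).
  transitivity (l * ((v x - (v \conv u) x) + (v \conv u) x)); first by ring.
  by rewrite e e2; field.
by rewrite !mulrDr e; ring.
Unshelve. all: by end_near. Qed.

Lemma quasi_invertible_eq l f g : M f -> M g -> f =ae g ->
  quasi_invertible mu M l f -> quasi_invertible mu M l g.
Proof.
move=> Mf Mg fg [p Mp [Hl Hr]]; exists p => //.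
have E1 := conv_eq Mf Mg Mp Mp fg (aeeq_refl _ _).
have E2 := conv_eq Mp Mp Mf Mg (aeeq_refl _ _) fg.
split; near=> x.
- rewrite -[LHS]/(l * p x - (g \conv p) x) -(_ : (f \conv p) x = (g \conv p) x); last by near: x.
  by rewrite -(_ : f x = g x); near: x.
- rewrite -[LHS]/(l * p x - (p \conv g) x) -(_ : (p \conv f) x = (p \conv g) x); last by near: x.
  by rewrite -(_ : f x = g x); near: x.
Unshelve. all: by end_near. Qed.

End QuasiInverse.

(** * Quasi-inverses in L^1 and in the weighted algebra *)

Section L1Algebra.
Variables (R : realType) (G : topologicalGroupType).
Variable mu : {measure set (borel G) -> \bar R}.
Hypothesis G_le : locally_elliptic G.
Hypothesis mu_haar : haar_measure mu.
Local Notation "f \conv g" := (convolution mu f g) (at level 40).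
Local Notation "f =ae g" := (aeeq mu f g) (at level 70).
Local Notation normc := (@Normc.normc R).
Local Notation L1 := [set f : G -> R[i] | cintegrable mu f].
Implicit Types (f g h : G -> R[i]) (a l : R[i]).

Lemma cintegrable0 : cintegrable mu (0 : G -> R[i]).
Proof.
split; first by split; exact: measurable_cst.
by rewrite integral0_eq// => x _; rewrite -[X in (normc X)%:E]/(0 : R[i]) normc0.
Qed.

Lemma cintegrable_linear a f g : cintegrable mu f -> cintegrable mu g ->
  cintegrable mu (a *: f + g).
Proof. by move=> fi gi; exact: (cintableD (cintableZ a fi) gi). Qed.

Lemma L1_convolution_algebra : convolution_algebra mu L1.
Proof.
split.
- exact: cintegrable0.
- exact: cintegrable_linear.
- by move=> f g; exact: conv_cintegrable.
- by move=> a f g h; exact: conv_linear_l.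
- by move=> a f g h; exact: conv_linear_r.
Qed.

Let C1 := L1_convolution_algebra.

Definition norm1 f : R := fine (\int[mu]_x (normc (f x))%:E).

Lemma norm1E f : cintegrable mu f -> (\int[mu]_x (normc (f x))%:E = (norm1 f)%:E)%E.
Proof.
move=> [_ fi]; rewrite fineK// ge0_fin_numE//.
by apply: integral_ge0 => x _; rewrite lee_fin normc_ge0.
Qed.

Lemma norm1_ge0 f : 0 <= norm1 f.
Proof. by apply/fine_ge0/integral_ge0 => x _; rewrite lee_fin normc_ge0. Qed.

Lemma norm1D f g : cintegrable mu f -> cintegrable mu g ->
  norm1 (f + g) <= norm1 f + norm1 g.
Proof.
move=> fi gi; have fgi := ca_add C1 fi gi.
rewrite -lee_fin EFinD -!norm1E// -ge0_integralD; [|exact: measurableT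
  |by move=> x _; rewrite lee_fin normc_ge0|exact: (cmfun_enormc fi.1)
  |by move=> x _; rewrite lee_fin normc_ge0|exact: (cmfun_enormc gi.1)].
apply: ge0_le_integral; first exact: measurableT.
- by move=> x _; rewrite lee_fin normc_ge0.
- exact: (cmfun_enormc fgi.1).
- by apply: emeasurable_funD; [exact: (cmfun_enormc fi.1)|exact: (cmfun_enormc gi.1)].
- by move=> x _; rewrite -EFinD lee_fin; exact: normcD.
Qed.

Lemma norm1Z a f : cintegrable mu f -> norm1 (a *: f) = normc a * norm1 f.
Proof.
move=> fi; have afi := ca_Z C1 a fi.
apply: EFin_inj; rewrite EFinM -!norm1E//.
rewrite -ge0_integralZl; [|exact: measurableT|exact: (cmfun_enormc fi.1)
  |by move=> x _; rewrite lee_fin normc_ge0|by rewrite lee_fin normc_ge0].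
by apply: eq_integral => x _; rewrite -EFinM -normcM.
Qed.

Lemma norm1N f : cintegrable mu f -> norm1 (- f) = norm1 f.
Proof. by move=> fi; rewrite -scaleN1r norm1Z// normcN normc1 mul1r. Qed.

Lemma norm1B f g : cintegrable mu f -> cintegrable mu g ->
  norm1 (f - g) <= norm1 f + norm1 g.
Proof. by move=> fi gi; rewrite -(norm1N gi); apply: norm1D => //; exact: (ca_N C1). Qed.

Lemma norm1M f g : cintegrable mu f -> cintegrable mu g ->
  norm1 (f \conv g) <= norm1 f * norm1 g.
Proof.
move=> fi gi; have fgi := ca_M C1 fi gi.
rewrite -lee_fin EFinM -!norm1E//.
exact: (conv_L1_le G_le mu_haar fi.1 gi.1).
Qed.

Lemma norm1_eq f g : cintegrable mu f -> cintegrable mu g -> f =ae g ->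
  norm1 f = norm1 g.
Proof.
move=> fi gi fg; apply: EFin_inj; rewrite -!norm1E//.
apply: ge0_ae_eq_integral => //.
- exact: (cmfun_enormc fi.1).
- exact: (cmfun_enormc gi.1).
- by move=> x _; rewrite lee_fin normc_ge0.
- by move=> x _; rewrite lee_fin normc_ge0.
- by apply: filterS fg => x -> _.
Qed.

Lemma norm1_eq0 f : cintegrable mu f -> norm1 f = 0 -> f =ae 0.
Proof.
move=> fi f0; have := norm1E fi; rewrite f0 => int0.
have : ae_eq mu setT (fun x => (normc (f x))%:E) (cst 0%E).
  apply/(ae_eq_integral_abs _ measurableT (cmfun_enormc fi.1)).
  rewrite -[RHS]int0; apply: eq_integral => x _.
  by rewrite gee0_abs// lee_fin normc_ge0.
apply: filterS => x /(_ Logic.I) [] /normc_eq0 fx0.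
by rewrite fx0.
Qed.

End L1Algebra.

Section InverseClosed.
Variables (R : realType) (G : topologicalGroupType).
Variable mu : {measure set (borel G) -> \bar R}.
Variables (Phi Psi : R -> \bar R) (omega : G -> R).
Hypothesis G_le : locally_elliptic G.
Hypothesis mu_haar : haar_measure mu.
Hypothesis PhiPsi : complementary_pair Phi Psi.
Hypothesis omega_weight : orlicz_weight mu Phi Psi omega.
Hypothesis omega_inv : orlicz_space mu Psi (fun x : G => ((omega x)^-1)%:C%C).
Local Notation "f \conv g" := (convolution mu f g) (at level 40).
Local Notation "f =ae g" := (aeeq mu f g) (at level 70).
Local Notation normc := (@Normc.normc R).
Local Notation A := (orlicz_algebra mu Phi Psi omega).
Local Notation L1 := [set f : G -> R[i] | cintegrable mu f].
Local Notation wnorm := (weighted_norm mu Psi omega).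
Implicit Types (f g h u v : G -> R[i]) (a l : R[i]).

Let Womega := ow_weight omega_weight.
Let HB := ow_banach omega_weight.
Let CA : convolution_algebra mu (mem_alg A) := banach_convolution_algebra HB.
Let C1 := L1_convolution_algebra G_le mu_haar.
Local Notation rwnorm := (rnm wnorm).

Lemma orlicz_sub_L1 : mem_alg A `<=` L1.
Proof.
move=> f Af; have mf := memA_measurable Af; split => //.
have [C C0 fC] := L1_le_wnorm PhiPsi Womega omega_inv.
apply: (le_lt_trans (fC _ mf)).
have /(bsa_norm_fin HB)/= /andP[n0 noo] := Af.
by rewrite lte_mul_pinfty// ge0_fin_numE.
Qed.

Lemma orlicz_dense q (e : R) : cintegrable mu q -> 0 < e ->
  exists2 h, mem_alg A h & norm1 mu (q - h) < e.
Proof.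
move=> qi e0; have [h [K [b [cK mh b0 hb le]]]] := L1_truncation G_le qi e0.
have [C C0 /(_ h b b0 mh hb)[Ah _]] := bounded_memA G_le mu_haar PhiPsi Womega cK.
exists h => //; rewrite -lte_fin -norm1E//.
by apply: (ca_sub C1) => //; exact: orlicz_sub_L1.
Qed.

Section Subadditive.
Variable c : R.
Hypothesis c0 : 0 < c.
Hypothesis omega_sub : forall x y, omega (x * y)%g <= c * (omega x + omega y).

Lemma rwnorm_conv_le f g : mem_alg A f -> mem_alg A g ->
  rwnorm (f \conv g) <= c * (rwnorm f * norm1 mu g + norm1 mu f * rwnorm g).
Proof.
move=> Af Ag; have fi := orlicz_sub_L1 Af; have gi := orlicz_sub_L1 Ag.
have := wnorm_conv_le G_le mu_haar PhiPsi Womega (ltW c0) omega_sub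
  (memA_measurable Af) (memA_measurable Ag).
rewrite (norm1E fi) (norm1E gi) (rnmE HB Af) (rnmE HB Ag) (rnmE HB (ca_M CA Af Ag)).
by rewrite -!EFinM lee_fin.
Qed.

(** When the L^1 norm of [u] is small, the differential inequality makes the
    weighted norms of its powers decrease geometrically. *)
Lemma small_quasi_inverse : exists2 rho : R, 0 < rho &
  forall u, mem_alg A u -> norm1 mu u <= rho -> exists2 v, mem_alg A v &
    v - u \conv v =ae u /\ v - v \conv u =ae u.
Proof.
(* [rho <= 1/2] makes the L^1 norms of the powers of [u] geometric, and
   [c * rho <= 1/2] makes the recursion for their weighted norms contracting. *)
pose rho : R := (2 * (c + 1))^-1.
have rho0 : 0 < rho by rewrite invr_gt0 mulr_gt0// addr_gt0.
have rho2 : rho <= 2^-1.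
  by rewrite lef_pV2 ?posrE ?mulr_gt0 ?addr_gt0// ler_peMr// lerDr ltW.
have crho : c * rho <= 2^-1.
  rewrite /rho invfM mulrCA -[leRHS]mulr1 ler_wpM2l ?invr_ge0//.
  by rewrite ler_pdivrMr ?addr_gt0// mul1r lerDl.
exists rho => // u Au urho.
pose w k := iter k (fun g => 0 *: g + u \conv g) u.
have Aw k : mem_alg A (w k).
  elim: k => [|k IHk]; first exact: Au.
  exact: (ca_D CA 0 IHk (ca_M CA Au IHk)).
have wi k : cintegrable mu (w k) := orlicz_sub_L1 (Aw k).
have ui := orlicz_sub_L1 Au.
have wS k : w k.+1 = u \conv w k by rewrite -[LHS]/(0 *: w k + u \conv w k) scale0r add0r.
have w1 k : norm1 mu (w k) <= 2^-1 ^+ k.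
  elim: k => [|k IHk]; first by rewrite expr0; apply: (le_trans urho); apply: (le_trans rho2); lra.
  rewrite wS exprS; apply: (le_trans (norm1M G_le mu_haar ui (wi k))).
  by apply: ler_pM => //; [exact: norm1_ge0|exact: norm1_ge0|exact: le_trans rho2].
have [D [theta [theta01 wD]]] : exists D theta', 0 <= theta' < 1 /\
    forall k, rwnorm (w k) <= D * theta' ^+ k.
  apply: (@geometric_growth _ _ 2^-1 (c * rwnorm u)).
  - by apply/andP; split; lra.
  - by rewrite mulr_ge0 ?(ltW c0)//; exact: (rnm_ge0 HB Au).
  move=> k; rewrite wS; apply: (le_trans (rwnorm_conv_le Au (Aw k))).
  rewrite mulrDr addrC mulrA [c * (_ * norm1 _ _)]mulrA; apply: lerD.
    apply: ler_wpM2r; first exact: (rnm_ge0 HB (Aw k)).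
    by apply: le_trans crho; rewrite ler_wpM2l// ltW.
  by apply: ler_wpM2l => //; rewrite mulr_ge0 ?(ltW c0)//; exact: (rnm_ge0 HB Au).
have [v Av [v1 v2]] := @neumann_series _ _ _ _ _ _ HB u 0 w D theta Au erefl
  (fun k => erefl) theta01 wD.
by exists v => //; rewrite scale0r subr0 in v1 v2.
Qed.

(** An element [h] of the weighted algebra that is close in L^1 to the
    quasi-inverse [q] inverts [l - f] up to an error [u] which lies in the
    weighted algebra and is small in L^1. By [small_quasi_inverse] the error
    can be corrected inside the weighted algebra. *)
Lemma quasi_invertible_descent l f : l != 0 -> mem_alg A f ->
  quasi_invertible mu L1 l f -> quasi_invertible mu (mem_alg A) l f.
Proof.
move=> l0 Af [q qi [qr ql]].
have [rho rho0 small] := small_quasi_inverse.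
have fi := orlicz_sub_L1 Af.
have K0 : 0 < normc l^-1 * (normc l + norm1 mu f) + 1.
  by rewrite ltr_wpDl// mulr_ge0 ?addr_ge0 ?normc_ge0 ?norm1_ge0.
have [h Ah qh] := orlicz_dense qi (divr_gt0 rho0 K0).
have hi := orlicz_sub_L1 Ah.
have di : cintegrable mu (q - h) by exact: (ca_sub C1).
have est u : mem_alg A u -> forall k, cintegrable mu k ->
    norm1 mu k <= norm1 mu f * norm1 mu (q - h) ->
    u =ae l^-1 *: (l *: (q - h) - k) -> norm1 mu u <= rho.
  move=> Au k ki kle uE; have ui := orlicz_sub_L1 Au.
  have ldi := ca_Z C1 l di; have ldki := ca_sub C1 ldi ki.
  rewrite (norm1_eq ui _ uE); last exact: (ca_Z C1).
  rewrite (norm1Z G_le mu_haar _ ldki).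
  apply: (@le_trans _ _ ((normc l^-1 * (normc l + norm1 mu f)) * norm1 mu (q - h))).
    rewrite -mulrA ler_wpM2l ?normc_ge0// (le_trans (norm1B G_le mu_haar ldi ki))//.
    by rewrite (norm1Z G_le mu_haar _ di) mulrDl lerD2l.
  apply: (@le_trans _ _ ((normc l^-1 * (normc l + norm1 mu f) + 1) * (rho / (normc l^-1 * (normc l + norm1 mu f) + 1)))).
    apply: ler_pM; [|exact: norm1_ge0|by rewrite lerDl|exact: ltW].
    by rewrite mulr_ge0 ?addr_ge0 ?normc_ge0 ?norm1_ge0.
  by rewrite mulrC divfK// gt_eqF.
have Alh := ca_Z CA l Ah.
have [v1 Av1 [v1r _]] : exists2 v, mem_alg A v & let u := l^-1 *: (f - (l *: h - f \conv h)) in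
    v - u \conv v =ae u /\ v - v \conv u =ae u.
  have Afh := ca_M CA Af Ah.
  have Au : mem_alg A (l^-1 *: (f - (l *: h - f \conv h))).
    exact: (ca_Z CA _ (ca_sub CA Af (ca_sub CA Alh Afh))).
  apply: small => //; apply: (est _ Au (f \conv (q - h))).
  - exact: (ca_M C1).
  - exact: norm1M.
  have B1 := convBr C1 qi hi fi; near=> x.
  rewrite -[LHS]/(l^-1 * (f x - (l * h x - (f \conv h) x))).
  rewrite -[RHS]/(l^-1 * (l * (q x - h x) - (f \conv (q - h)) x)).
  rewrite (_ : (f \conv (q - h)) x = (f \conv q) x - (f \conv h) x); last by near: x.
  rewrite -(_ : l * q x - (f \conv q) x = f x); last by near: x.
  by congr (_ * _); ring.
have [v2 Av2 [_ v2l]] : exists2 v, mem_alg A v & let u := l^-1 *: (f - (l *: h - h \conv f)) in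
    v - u \conv v =ae u /\ v - v \conv u =ae u.
  have Ahf := ca_M CA Ah Af.
  have Au : mem_alg A (l^-1 *: (f - (l *: h - h \conv f))).
    exact: (ca_Z CA _ (ca_sub CA Af (ca_sub CA Alh Ahf))).
  apply: small => //; apply: (est _ Au ((q - h) \conv f)).
  - exact: (ca_M C1).
  - by rewrite mulrC; exact: norm1M.
  have B1 := convBl C1 qi hi fi; near=> x.
  rewrite -[LHS]/(l^-1 * (f x - (l * h x - (h \conv f) x))).
  rewrite -[RHS]/(l^-1 * (l * (q x - h x) - ((q - h) \conv f) x)).
  rewrite (_ : ((q - h) \conv f) x = (q \conv f) x - (h \conv f) x); last by near: x.
  rewrite -(_ : l * q x - (q \conv f) x = f x); last by near: x.
  by congr (_ * _); ring.
apply: (quasi_invertible_lr HB l0 Af _ _ (right_quasi_inverse HB l0 Af Ah Av1 erefl v1r)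
  (left_quasi_inverse HB l0 Af Ah Av2 erefl v2l)).
- by apply: (ca_add CA); [exact: (ca_add CA)|exact: (ca_M CA)].
- by apply: (ca_add CA); [exact: (ca_add CA)|exact: (ca_M CA)].
Unshelve. all: by end_near. Qed.

End Subadditive.

End InverseClosed.

(** * Identities of L^1 *)

Section PointMass.
Variables (R : realType) (G : topologicalGroupType).
Variable mu : {measure set (borel G) -> \bar R}.
Hypothesis G_le : locally_elliptic G.
Hypothesis mu_haar : haar_measure mu.
Local Notation "f \conv g" := (convolution mu f g) (at level 40).
Local Notation "f =ae g" := (aeeq mu f g) (at level 70).
Local Notation normc := (@Normc.normc R).
Local Notation L1 := [set f : G -> R[i] | cintegrable mu f].
Implicit Types (f g h u v : G -> R[i]) (a l : R[i]).

Lemma cintegrable_indic (A : set (borel G)) : measurable A -> (mu A < +oo)%E ->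
  cintegrable mu (fun x => (\1_A x : R)%:C%C).
Proof.
move=> mA Aoo; split; first by apply: cmfun_real; exact: measurable_indic.
under eq_integral do rewrite normc_real ger0_norm//.
by rewrite integral_indic// setIT.
Qed.

Lemma measurable_one : measurable ([set 1%g] : set (borel G)).
Proof. exact: (compact_borel (le_hausdorff G_le) (@compact_set1 _ _)). Qed.

(** The only candidate for an identity, the normalized indicator of the point
    [1], for a measure charging points. *)
Definition point_mass : G -> R[i] :=
  fun x => (\1_[set (1%g : G)] x / fine (mu [set 1%g]))%:C%C.

Section Charged.
Hypothesis mu1 : (0 < mu [set 1%g])%E.

Let m := fine (mu [set 1%g]).

Let mE : mu [set 1%g] = m%:E.
Proof.
by rewrite fineK// ge0_fin_numE//; apply: (haar_compact mu_haar); exact: compact_set1.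
Qed.

Let m_gt0 : 0 < m.
Proof. by rewrite -lte_fin -mE. Qed.

Let r (x : borel G) : R := \1_[set (1%g : G)] x / m.

Let mr : measurable_fun [set: borel G] r.
Proof.
by apply: measurable_funM => //; apply: measurable_indic; exact: measurable_one.
Qed.

Let r0 x : 0 <= r x.
Proof. by rewrite divr_ge0// ltW. Qed.

Let intr : (\int[mu]_x (r x)%:E = 1)%E.
Proof.
under eq_integral do rewrite EFinM.
rewrite ge0_integralZr; [|exact: measurableT
  |by apply/measurable_EFinP; apply: measurable_indic; exact: measurable_one
  |by move=> x _; rewrite lee_fin|by rewrite lee_fin invr_ge0 ltW].
rewrite integral_indic//; last exact: measurable_one.
by rewrite setIT mE -EFinM divff// gt_eqF.
Qed.

Let cint_real (s : borel G -> R) c : measurable_fun [set: borel G] s ->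
  (forall x, 0 <= s x) -> (\int[mu]_x (s x)%:E = 1)%E ->
  cintegral mu (fun x => c * (s x)%:C%C) = c.
Proof.
move=> ms s0 ints.
have si : cintegrable mu (fun x => (s x)%:C%C).
  split; first exact: cmfun_real.
  by under eq_integral do rewrite normc_real ger0_norm//; rewrite ints ltry.
rewrite -[LHS]/(cint mu (fun x => c * (s x)%:C%C)) cintZ//.
rewrite (_ : cint mu _ = 1) ?mulr1//; apply: eqcP => /=.
  by rewrite /Rintegral ints.
by rewrite /Rintegral integral0_eq.
Qed.

Lemma point_mass_conv_l g : point_mass \conv g = g.
Proof.
apply/funext => x; rewrite -[RHS](cint_real (g x) mr r0 intr).
congr cintegral; apply/funext => y; rewrite /point_mass -/(r y) mulrC.
have [y1|y1] := pselect (y = 1%g); first by rewrite y1 invg1 mul1g.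
by rewrite /r indicE memNset// !mul0r !mulr0.
Qed.

Lemma point_mass_conv_r g : g \conv point_mass = g.
Proof.
apply/funext => x.
have ints : (\int[mu]_y (r (y^-1 * x)%g)%:E = 1)%E.
  rewrite (le_integral_inv G_le mu_haar (f := fun y => (r (y * x)%g)%:E)); last 2 first.
  - by apply/measurable_EFinP; exact: (borel_comp_right mr x).
  - by move=> y; rewrite lee_fin.
  rewrite (le_integral_right G_le mu_haar x (f := fun y => (r y)%:E))//.
  exact/measurable_EFinP.
rewrite -[RHS](cint_real (g x) (borel_comp_inv (borel_comp_right mr x)) _ ints)//.
congr cintegral; apply/funext => y; rewrite /point_mass -/(r (y^-1 * x)%g).
have [y1|y1] := pselect ((y^-1 * x)%g = 1%g).
  by congr (g _ * _); rewrite -(mulVKg y x) y1 mulg1.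
by rewrite /r indicE memNset// !mul0r !mulr0.
Qed.

End Charged.

(** If points had measure zero, [e] would have little mass on a small
    neighbourhood [U] of [1], and [e * 1_W] would be small on [W] whenever [W
    W^-1] is contained in [U]. *)
Lemma identity_charges_points e : cintegrable mu e ->
  (forall g, cintegrable mu g -> e \conv g =ae g) -> (0 < mu [set 1%g])%E.
Proof.
move=> ei eid; rewrite lt_neqAle measure_ge0 andbT eq_sym; apply/eqP => mu1.
have [h [K [b [cK mh b0 hb eh]]]] := L1_truncation G_le ei (ltac:(lra) : 0 < 4^-1 :> R).
have b1 : 0 < 4 * (b + 1) by rewrite mulr_gt0// ltr_wpDl.
have [U [oU U1 Ub]] : exists U : set G, [/\ open U, U 1%g & (mu U < ((4 * (b + 1))^-1)%:E)%E].
  have : (mu [set 1%g] < ((4 * (b + 1))^-1)%:E)%E by rewrite mu1 lte_fin invr_gt0.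
  rewrite (haar_outer_regular mu_haar measurable_one) => /ereal_inf_lt[_ [U [oU U1] <-] Ub].
  by exists U; split => //; exact: U1.
have [H [HP Hnd HT]] := le_union G_le.
have [HS cH oH] := HP 0%N.
have [W [oW W1 WH WU]] : exists W : set G, [/\ open W, W 1%g, W `<=` H 0%N &
    forall x z, W x -> W z -> U (x * z^-1)%g].
  have : nbhs ((1%g, 1%g) : G * G) ((fun p : G * G => (p.1 * p.2^-1)%g) @^-1` U).
    apply: (@rdiv_continuous G (1%g, 1%g)); apply: open_nbhs_nbhs; split => //=.
    by rewrite invg1 mulg1.
  move=> [[V1 V2] [/= n1 n2] V12].
  have : nbhs (1%g : G) (V1 `&` V2 `&` H 0%N).
    apply: filterI; first exact: filterI.
    by apply: open_nbhs_nbhs; split => //; exact: subgroup1.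
  rewrite nbhsE => -[W [oW W1] WV]; exists W; split => //.
    by move=> x /WV[].
  by move=> x z /WV[[V1x _] _] /WV[[_ V2z] _]; exact: (V12 (x, z)).
have mW : measurable (W : set (borel G)) by exact: borel_open.
have mU : measurable (U : set (borel G)) by exact: borel_open.
have Woo : (mu W < +oo)%E.
  apply: (@le_lt_trans _ _ (mu (H 0%N))); last exact: (haar_compact mu_haar).
  by apply: le_measure; rewrite ?inE//; exact: borel_open.
have /eid [N [mN N0 eN]] := cintegrable_indic mW Woo.
have [x Wx Nx] : exists2 x, W x & ~ N x.
  apply: contrapT => /forall2NP WN.
  have WsubN : W `<=` N by move=> x Wx; have [|/contrapT] := WN x.
  have := haar_open mu_haar oW (ex_intro _ _ W1).
  rewrite ltNge => /negP; apply; rewrite -N0; apply: le_measure; rewrite ?inE//.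
have eWx : (e \conv (fun x => (\1_W x : R)%:C%C)) x = 1.
  have : ~ ~ ((e \conv (fun x => (\1_W x : R)%:C%C)) x = (\1_W x : R)%:C%C).
    by move=> ne; apply: Nx; apply: eN.
  by move=> /contrapT ->; rewrite indicE mem_set.
have mnd : measurable_fun [set: borel G] (fun y : borel G => normc (e y - h y)).
  apply: (@cmfun_normc _ _ R (fun y : borel G => e y - h y)).
  have := cmfunD ei.1 (cmfunM (@cmfun_cst _ (borel G) R (-1)) mh).
  by under eq_fun do rewrite mulN1r.
have : (1 <= 4^-1%:E + b%:E * mu U :> \bar R)%E.
  apply: (@le_trans _ _ (normc ((e \conv (fun x => (\1_W x : R)%:C%C)) x))%:E).
    by rewrite eWx normc1.
  apply: (le_trans (normc_conv _ x ei.1 (cintegrable_indic mW Woo).1)).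
  apply: (@le_trans _ _ (\int[mu]_y ((normc (e y - h y))%:E + b%:E * (\1_U y)%:E))%E).
    apply: ge0_le_integral; first exact: measurableT.
    - by move=> y _; rewrite lee_fin mulr_ge0 ?normc_ge0.
    - apply/measurable_EFinP; apply: measurable_funM; first exact: (cmfun_normc ei.1).
      have mi : measurable_fun [set: borel G] (fun y : borel G => normc (\1_W y : R)%:C%C).
        exact: (cmfun_normc (cintegrable_indic mW Woo).1).
      exact: (borel_comp_inv (borel_comp_right mi x)).
    - apply: emeasurable_funD; first exact/measurable_EFinP.
      by apply: measurable_funeM; apply/measurable_EFinP; exact: measurable_indic.
    move=> y _; rewrite -EFinM -EFinD lee_fin normc_real ger0_norm//.
    rewrite indicE; have [Wyx|Wyx] := boolP ((y^-1 * x)%g \in W); last first.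
      by rewrite mulr0 addr_ge0 ?normc_ge0 ?mulr_ge0.
    have Uy : U y.
      have := WU x (y^-1 * x)%g Wx (set_mem Wyx).
      by rewrite invgM invgK mulgA mulgV mul1g.
    rewrite mulr1 indicE mem_set// mulr1.
    apply: (@le_trans _ _ (normc (e y - h y) + normc (h y))).
      by rewrite -[in X in X <= _](subrK (h y) (e y)) normcD.
    by rewrite lerD2l (le_trans (hb y))// ler_piMr// indicE lern1 leq_b1.
  rewrite ge0_integralD; [|exact: measurableT|by move=> y _; rewrite lee_fin normc_ge0
    |exact/measurable_EFinP|by move=> y _; rewrite -EFinM lee_fin mulr_ge0
    |by apply: measurable_funeM; apply/measurable_EFinP; exact: measurable_indic].
  rewrite ge0_integralZl; [|exact: measurableT
    |by apply/measurable_EFinP; exact: measurable_indic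
    |by move=> y _; rewrite lee_fin|by rewrite lee_fin].
  by rewrite integral_indic// setIT; apply: leeD2r; exact: ltW.
apply/negP; rewrite -ltNge.
have Ufin : mu U \is a fin_num by rewrite ge0_fin_numE// (lt_trans Ub)// ltry.
rewrite -(fineK Ufin) in Ub *.
rewrite -EFinM -EFinD lte_fin; rewrite lte_fin in Ub.
have u0 : 0 <= fine (mu U) by rewrite fine_ge0.
have := Ub; rewrite -[X in _ < X]div1r ltr_pdivlMr// => Ub'.
nra.
Qed.

End PointMass.

(** * Equality of the spectra *)

Section SpectralInvariance.
Variables (R : realType) (G : topologicalGroupType).
Variable mu : {measure set (borel G) -> \bar R}.
Variables (Phi Psi : R -> \bar R) (omega : G -> R).
Hypothesis G_le : locally_elliptic G.
Hypothesis mu_haar : haar_measure mu.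
Hypothesis PhiPsi : complementary_pair Phi Psi.
Hypothesis omega_weight : orlicz_weight mu Phi Psi omega.
Hypothesis omega_inv : orlicz_space mu Psi (fun x : G => ((omega x)^-1)%:C%C).
Local Notation "f \conv g" := (convolution mu f g) (at level 40).
Local Notation "f =ae g" := (aeeq mu f g) (at level 70).
Local Notation normc := (@Normc.normc R).
Local Notation A := (orlicz_algebra mu Phi Psi omega).
Local Notation L1 := [set f : G -> R[i] | cintegrable mu f].
Implicit Types (f g h u v : G -> R[i]) (a l : R[i]).

Let Womega := ow_weight omega_weight.
Let HB := ow_banach omega_weight.
Let CA : convolution_algebra mu (mem_alg A) := banach_convolution_algebra HB.
Let C1 := L1_convolution_algebra G_le mu_haar.
Let AL1 := orlicz_sub_L1 PhiPsi omega_weight omega_inv.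

(** Multiplication by [e] is continuous on L^1 and fixes the elements of a
    dense subspace. *)
Lemma orlicz_identity_L1 e : is_identity (A := A) e -> is_identity (A := group_algebra mu) e.
Proof.
move=> [Ae eA]; have ei : cintegrable mu e := AL1 Ae; split => // g gi.
have gi' : cintegrable mu g := gi.
have key (L : (G -> R[i]) -> G -> R[i]) : (forall f, cintegrable mu f -> cintegrable mu (L f)) ->
    (forall f, cintegrable mu f -> norm1 mu (L f) <= norm1 mu e * norm1 mu f) ->
    (forall f h, cintegrable mu f -> cintegrable mu h ->
      {ae mu, forall x : borel G, L (f - h) x = L f x - L h x}) ->
    (forall h, mem_alg A h -> L h =ae h) -> L g =ae g.
  move=> Li Ln LB LA.
  have Xi : cintegrable mu (L g - g) by apply: (ca_sub C1) => //; exact: Li.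
  suff X0 : norm1 mu (L g - g) = 0.
    apply: filterS (norm1_eq0 Xi X0) => x.
    by rewrite -[(L g - g) x]/(L g x - g x) => /eqP; rewrite subr_eq0 => /eqP.
  apply/eqP; rewrite eq_le norm1_ge0 andbT; apply/ler_addgt0Pr => d d0; rewrite add0r.
  have K0 : 0 < norm1 mu e + 1 by rewrite ltr_wpDl// norm1_ge0.
  have [h Ah gh] := orlicz_dense G_le mu_haar PhiPsi omega_weight omega_inv gi' (divr_gt0 d0 K0).
  have hi : cintegrable mu h := AL1 Ah.
  have di : cintegrable mu (g - h) by exact: (ca_sub C1).
  have XE : L g - g =ae L (g - h) - (g - h).
    have := LA h Ah; apply: filterS2 (LB g h gi' hi) => x e1 e2.
    by rewrite -[RHS]/(L (g - h) x - (g x - h x)) e1 e2 -[LHS]/(L g x - g x); ring.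
  rewrite (norm1_eq Xi _ XE); last by apply: (ca_sub C1) => //; exact: Li.
  apply: (le_trans (norm1B G_le mu_haar (Li _ di) di)).
  apply: (@le_trans _ _ ((norm1 mu e + 1) * norm1 mu (g - h))).
    by rewrite mulrDl mul1r; apply: lerD => //; exact: Ln.
  by rewrite mulrC -ler_pdivlMr//; exact: ltW.
split.
- apply: (key (fun f => e \conv f)).
  + by move=> f fi; exact: (ca_M C1).
  + by move=> f fi; exact: norm1M.
  + by move=> f h fi hi; exact: (convBr C1).
  + by move=> h Ah; have [] := eA h Ah.
- apply: (key (fun f => f \conv e)).
  + by move=> f fi; exact: (ca_M C1).
  + by move=> f fi; rewrite mulrC; exact: norm1M.
  + by move=> f h fi hi; exact: (convBl C1).
  + by move=> h Ah; have [] := eA h Ah.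
Qed.

(** The identity can only be the point mass, which is bounded with compact
    support. *)
Lemma L1_identity_orlicz : (exists e, is_identity (A := group_algebra mu) e) ->
  exists e, is_identity (A := A) e.
Proof.
move=> [e [ei eid]].
have mu1 : (0 < mu [set 1%g])%E.
  by apply: (identity_charges_points G_le mu_haar (e := e)) => // g /eid[].
have cK := @compact_set1 G 1%g.
have [C C0 CP] := bounded_memA G_le mu_haar PhiPsi Womega cK.
have m0 : 0 <= (fine (mu [set 1%g]))^-1 by rewrite invr_ge0 fine_ge0.
exists (point_mass mu); split.
  apply: (CP _ _ m0 _ _).1.
    apply: cmfun_real; apply: measurable_funM => //.
    by apply: measurable_indic; exact: measurable_one.
  move=> x; rewrite /point_mass normc_real ger0_norm ?divr_ge0//.
  by rewrite mulrC.
move=> g Ag; split.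
  rewrite -[mul_alg _ _]/(point_mass mu \conv g) (point_mass_conv_l G_le mu_haar mu1).
  exact: aeeq_refl.
rewrite -[mul_alg _ _]/(g \conv point_mass mu) (point_mass_conv_r G_le mu_haar mu1).
exact: aeeq_refl.
Qed.

Lemma orlicz_spectrumE f : subadditive_weight omega -> mem_alg A f ->
  spectrum A f = spectrum (group_algebra mu) f.
Proof.
move=> [c c0 omega_sub] Af.
apply: (@eq_spectrum _ _ mu (mem_alg A) L1) => //.
- move=> l g l0 Ag; exact: (quasi_invertible_descent G_le mu_haar PhiPsi omega_weight omega_inv c0 omega_sub l0 Ag).
- exact: orlicz_identity_L1.
- exact: L1_identity_orlicz.
Qed.

End SpectralInvariance.

(** * L^2 estimates on a compact open subgroup *)

Section L2Estimate.
Variables (R : realType) (G : topologicalGroupType).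
Variable mu : {measure set (borel G) -> \bar R}.
Hypothesis G_le : locally_elliptic G.
Hypothesis mu_haar : haar_measure mu.
Local Notation "f \conv g" := (convolution mu f g) (at level 40).
Local Notation normc := (@Normc.normc R).
Implicit Types (f g h : G -> R[i]).
Variable H : set G.
Hypothesis HS : subgroup H.
Hypothesis cH : compact H.
Hypothesis oH : open H.

(** These functions are stable under convolution ([conv_bounded_on]), and on
    them the bound [b] controls the norms of L^1, of L^2 and of the weighted
    algebra. *)
Definition bounded_on (b : R) g : Prop :=
  [/\ 0 <= b, cmeasurable g & forall x, normc (g x) <= b * \1_H x].

Let mH : measurable (H : set (borel G)).
Proof. exact: borel_open. Qed.

Let m : R := fine (mu H).

Let mE : mu H = m%:E.
Proof. by rewrite fineK// ge0_fin_numE//; exact: (haar_compact mu_haar). Qed.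

Let m_gt0 : 0 < m.
Proof.
rewrite -lte_fin -mE; apply: (haar_open mu_haar oH).
by exists 1%g; exact: subgroup1.
Qed.

Lemma integral_bounded_on (b : R) : 0 <= b ->
  (\int[mu]_x (b * \1_H x)%:E = (b * m)%:E)%E.
Proof.
move=> b0; under eq_integral do rewrite EFinM.
rewrite ge0_integralZl; [|exact: measurableT
  |by apply/measurable_EFinP; exact: measurable_indic
  |by move=> x _; rewrite lee_fin|by rewrite lee_fin].
by rewrite integral_indic// setIT mE.
Qed.

Lemma bounded_on_cintegrable b g : bounded_on b g -> cintegrable mu g.
Proof.
move=> [b0 mg gb]; split => //.
apply: (@le_lt_trans _ _ (\int[mu]_x (b * \1_H x)%:E)%E).
  apply: ge0_le_integral; first exact: measurableT.
  - by move=> x _; rewrite lee_fin normc_ge0.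
  - exact: (cmfun_enormc mg).
  - by apply/measurable_EFinP; apply: measurable_funM => //; exact: measurable_indic.
  - by move=> x _; rewrite lee_fin.
by rewrite integral_bounded_on// ltry.
Qed.

(** The square of the L^2 norm. *)
Definition norm2 g : \bar R := (\int[mu]_x (normc (g x) ^+ 2)%:E)%E.

Lemma measurable_normc_sqr g : cmeasurable g ->
  measurable_fun [set: borel G] (fun x : borel G => (normc (g x) ^+ 2)%:E).
Proof. by move=> mg; apply/measurable_EFinP; apply: measurable_funX; exact: cmfun_normc. Qed.

Lemma norm2_ge0 g : (0 <= norm2 g)%E.
Proof. by apply: integral_ge0 => x _; rewrite lee_fin sqr_ge0. Qed.

Lemma norm2_bounded_on b g : bounded_on b g -> (norm2 g <= (b ^+ 2 * m)%:E)%E.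
Proof.
move=> [b0 mg gb]; rewrite -integral_bounded_on ?sqr_ge0//.
apply: ge0_le_integral; first exact: measurableT.
- by move=> x _; rewrite lee_fin sqr_ge0.
- exact: measurable_normc_sqr.
- by apply/measurable_EFinP; apply: measurable_funM => //; exact: measurable_indic.
move=> x _; rewrite lee_fin.
have -> : b ^+ 2 * \1_H x = (b * \1_H x) ^+ 2.
  by rewrite exprMn indicE; case: (x \in H); rewrite ?expr1n ?expr0n.
by rewrite lerXn2r ?nnegrE ?normc_ge0 ?mulr_ge0.
Qed.

(** The Cauchy-Schwarz inequality against the indicator of [H]. *)
Lemma norm1_sqr_le b g : bounded_on b g ->
  norm1 mu g ^+ 2 <= m * fine (norm2 g).
Proof.
move=> gb; have gi := bounded_on_cintegrable gb; have [b0 mg gb'] := gb.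
have n2E : norm2 g = (fine (norm2 g))%:E.
  rewrite fineK// ge0_fin_numE ?norm2_ge0//.
  by apply: le_lt_trans (norm2_bounded_on gb) _; exact: ltry.
set s := norm1 mu g; have s0 : 0 <= s by exact: norm1_ge0.
(* This [t] gives the best bound on [s] that the inequality
   [2 t |g| <= |g|^2 + t^2] yields after integration over [H]. *)
pose t := s / m; have t0 : 0 <= t by rewrite divr_ge0// ltW.
have t20 : 0 <= 2 * t by rewrite mulr_ge0.
have : ((2 * t * s)%:E <= norm2 g + (t ^+ 2 * m)%:E)%E.
  rewrite EFinM -(norm1E gi) -ge0_integralZl; [|exact: measurableT|exact: (cmfun_enormc mg)
    |by move=> x _; rewrite lee_fin normc_ge0|by rewrite lee_fin mulr_ge0].
  rewrite -(integral_bounded_on (sqr_ge0 t)) -ge0_integralD; [|exact: measurableT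
    |by move=> x _; rewrite lee_fin sqr_ge0|exact: measurable_normc_sqr
    |by move=> x _; rewrite lee_fin mulr_ge0 ?sqr_ge0
    |by apply/measurable_EFinP; apply: measurable_funM => //; exact: measurable_indic].
  apply: ge0_le_integral; first exact: measurableT.
  - by move=> x _; apply: mule_ge0; rewrite lee_fin ?normc_ge0.
  - by apply: measurable_funeM; exact: (cmfun_enormc mg).
  - apply: emeasurable_funD; first exact: measurable_normc_sqr.
    by apply/measurable_EFinP; apply: measurable_funM => //; exact: measurable_indic.
  move=> x _; rewrite -EFinM -EFinD lee_fin indicE.
  have := gb' x; rewrite indicE; case: (x \in H) => /=.
    move=> _; rewrite mulr1; have := sqr_ge0 (normc (g x) - t).
    by rewrite sqrrB; lra.
  rewrite !mulr0 addr0 => g0; have -> : normc (g x) = 0 by apply/eqP; rewrite eq_le g0 normc_ge0.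
  by rewrite mulr0 expr0n /= lexx.
rewrite n2E -EFinD lee_fin => ineq.
have tm : t * m = s by rewrite /t divfK// gt_eqF.
have e : t ^+ 2 * m = t * s by rewrite expr2 -mulrA tm.
have : t * s <= fine (norm2 g) by move: ineq; rewrite e; lra.
move=> /(ler_wpM2l (ltW m_gt0)); apply: le_trans.
by rewrite mulrA [m * t]mulrC tm expr2.
Qed.

Lemma conv_bounded_on bf bg f g : bounded_on bf f -> bounded_on bg g ->
  bounded_on (bf * norm1 mu g) (f \conv g).
Proof.
move=> fb gb; have gi := bounded_on_cintegrable gb.
have [bf0 mf fb'] := fb; have [bg0 mg gb'] := gb.
split; [by rewrite mulr_ge0// norm1_ge0|exact: conv_measurable|move=> x].
have mnf := cmfun_normc mf; have mng := cmfun_normc mg.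
have := normc_conv mu x mf mg.
have [xH|xH] := boolP (x \in H); rewrite indicE ?xH ?(negbTE xH).
- rewrite mulr1 (nonneg_conv_flip G_le mu_haar mnf mng (fun=> normc_ge0 _) (fun=> normc_ge0 _)).
  move=> /le_trans le; rewrite -lee_fin; apply: le.
  rewrite EFinM -(norm1E gi) -ge0_integralZl; [|exact: measurableT|exact: (cmfun_enormc mg)
    |by move=> y _; rewrite lee_fin normc_ge0|by rewrite lee_fin].
  apply: ge0_le_integral; first exact: measurableT.
  + by move=> y _; rewrite lee_fin mulr_ge0 ?normc_ge0.
  + apply/measurable_EFinP; apply: measurable_funM => //.
    exact: (borel_comp_inv (borel_comp_left mnf x)).
  + by apply: measurable_funeM; exact: (cmfun_enormc mg).
  move=> y _; rewrite -EFinM lee_fin; apply: ler_wpM2r; first exact: normc_ge0.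
  by apply: (le_trans (fb' _)); rewrite ler_piMr// indicE lern1 leq_b1.
- rewrite mulr0 integral0_eq ?lee_fin// => y _.
  have [yH|yH] := boolP (y \in H); last first.
    have := fb' y; rewrite indicE (negbTE yH) mulr0 => f0.
    have -> : normc (f y) = 0 by apply/eqP; rewrite eq_le f0 normc_ge0.
    by rewrite mul0r.
  have : (y^-1 * x)%g \notin H.
    apply/negP => yx; move/negP: xH; apply; rewrite -(mulVKg y x) inE.
    by apply: subgroupM => //; exact: set_mem.
  move=> yx; have := gb' (y^-1 * x)%g; rewrite indicE (negbTE yx) mulr0 => g0.
  have -> : normc (g (y^-1 * x)%g) = 0 by apply/eqP; rewrite eq_le g0 normc_ge0.
  by rewrite mulr0.
Qed.

(** By way of the uniform bound on the convolution, as the measure of [H] is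
    finite. *)
Lemma conv_norm2_le bf bg f g : bounded_on bf f -> bounded_on bg g ->
  (norm2 (f \conv g) <= ((bf * m) ^+ 2)%:E * norm2 g)%E.
Proof.
move=> fb gb; have n2E : norm2 g = (fine (norm2 g))%:E.
  rewrite fineK// ge0_fin_numE ?norm2_ge0//.
  by apply: le_lt_trans (norm2_bounded_on gb) _; exact: ltry.
apply: (le_trans (norm2_bounded_on (conv_bounded_on fb gb))).
rewrite n2E -EFinM lee_fin.
have := norm1_sqr_le gb; move=> /(ler_wpM2l (sqr_ge0 bf))/(ler_wpM2r (ltW m_gt0)).
by rewrite !exprMn => /le_trans; apply; rewrite le_eqVlt; apply/orP; left; apply/eqP; ring.
Qed.

End L2Estimate.

(** * Self-adjoint kernels *)

Section SelfAdjointKernel.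
Variables (R : realType) (G : topologicalGroupType).
Variable mu : {measure set (borel G) -> \bar R}.
Hypothesis G_le : locally_elliptic G.
Hypothesis mu_haar : haar_measure mu.
Local Notation "f \conv g" := (convolution mu f g) (at level 40).
Local Notation normc := (@Normc.normc R).
Implicit Types (f g h : G -> R[i]).
Variable H : set G.
Hypothesis HS : subgroup H.
Hypothesis cH : compact H.
Hypothesis oH : open H.

Lemma ge0_integral_flip x (u : G -> \bar R) :
  measurable_fun [set: borel G] (u : borel G -> \bar R) -> (forall y, 0 <= u y)%E ->
  (\int[mu]_y u (x * y^-1)%g = \int[mu]_y u y)%E.
Proof.
move=> mu0 u0; rewrite (le_integral_inv G_le mu_haar (f := fun y => u (x * y)%g))//.
  by rewrite (haar_integral_left mu_haar x).
exact: (borel_comp_left mu0 x).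
Qed.

Lemma integral_flip x (u : G -> \bar R) :
  measurable_fun [set: borel G] (u : borel G -> \bar R) ->
  (\int[mu]_y u (x * y^-1)%g = \int[mu]_y u y)%E.
Proof.
move=> mu0; rewrite integralE [RHS]integralE; congr (_ - _)%E.
  rewrite -(@ge0_integral_flip x (u^\+)%E)//; first by apply: eq_integral => y _; rewrite !funeposE.
  exact: measurable_funepos.
rewrite -(@ge0_integral_flip x (u^\-)%E)//; first by apply: eq_integral => y _; rewrite !funenegE.
exact: measurable_funeneg.
Qed.

Variables (f : G -> R[i]) (bf : R).
Hypothesis fb : bounded_on H bf f.
Hypothesis f_sa : forall x, f (x^-1)%g = (f x)^*%C.
Variables (g : G -> R[i]) (bg : R).
Hypothesis gb : bounded_on H bg g.
Variable s : R.

Let P (p : G * G) : R := s * complex.Im ((g p.1)^*%C * (f (p.1 * p.2^-1)%g * g p.2)).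

(** The kernel [f (x y^-1)] being Hermitian, [P] is antisymmetric; as a bounded
    function on [H * H], its iterated integral vanishes. *)
Let P_antisym x y : P (y, x) = - P (x, y).
Proof.
rewrite /P /= -mulrN; congr (s * _).
have -> : f (x * y^-1)%g = (f (y * x^-1)%g)^*%C by rewrite -f_sa invgM invgK.
by case: (f _) => a b; case: (g x) => c d; case: (g y) => p q /=; ring.
Qed.

Let mP : measurable_fun [set: borel (G * G)%type] (P : borel (G * G)%type -> R).
Proof.
have [_ mf _] := fb; have [_ mg _] := gb.
apply: measurable_funM => //.
have cP : @cmfun _ (borel (G * G)%type) R
    (fun p => (g p.1)^*%C * (f (p.1 * p.2^-1)%g * g p.2)).
  apply: cmfunM.
    by apply: cmfunJ; split; [exact: (borel_comp_fst mg.1)|exact: (borel_comp_fst mg.2)].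
  apply: cmfunM.
    by split; [exact: (borel_comp_rdiv mf.1)|exact: (borel_comp_rdiv mf.2)].
  by split; [exact: (borel_comp_snd mg.1)|exact: (borel_comp_snd mg.2)].
exact: cP.2.
Qed.

Let Pp (p : G * G) : \bar R := (Num.max (P p) 0)%:E.
Let Pn (p : G * G) : \bar R := (Num.max (- P p) 0)%:E.

Let TP : tonelli mu Pp.
Proof.
apply: (le_tonelli G_le mu_haar) => [|p]; last by rewrite lee_fin le_max lexx orbT.
by apply/measurable_EFinP; apply: measurable_maxr.
Qed.

Let TN : tonelli mu Pn.
Proof.
apply: (le_tonelli G_le mu_haar) => [|p]; last by rewrite lee_fin le_max lexx orbT.
by apply/measurable_EFinP; apply: measurable_maxr => //; exact: measurable_funN.
Qed.

Let PnE x y : Pn (x, y) = Pp (y, x).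
Proof. by rewrite /Pn /Pp (P_antisym x y). Qed.

Let c := `|s| * (bg * (bf * bg)).

Let c0 : 0 <= c.
Proof.
have [bf0 _ _] := fb; have [bg0 _ _] := gb.
by rewrite /c; apply: mulr_ge0 => //; apply: mulr_ge0 => //; exact: mulr_ge0.
Qed.

Let Pp_le x y : (Pp (x, y) <= (c * \1_H x * \1_H y)%:E)%E.
Proof.
have [bf0 _ fb'] := fb; have [bg0 _ gb'] := gb.
rewrite lee_fin ge_max !mulr_ge0// andbT.
apply: (le_trans (ler_norm _)); rewrite /P normrM /=.
apply: (@le_trans _ _ (`|s| * ((bg * \1_H x) * (bf * (bg * \1_H y))))); last first.
  by rewrite le_eqVlt; apply/orP; left; apply/eqP; rewrite /c; ring.
apply: ler_wpM2l => //; apply: (le_trans (normc_geIm _)).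
rewrite !normcM normc_conj; apply: ler_pM; [exact: normc_ge0|by rewrite mulr_ge0 ?normc_ge0|exact: gb'|].
apply: ler_pM; [exact: normc_ge0|exact: normc_ge0| |exact: gb'].
by apply: (le_trans (fb' _)); rewrite ler_piMr// indicE lern1 leq_b1.
Qed.

Let A x := (\int[mu]_y Pp (x, y))%E.
Let B x := (\int[mu]_y Pn (x, y))%E.

Let A0 x : (0 <= A x)%E.
Proof. by apply: integral_ge0 => y _; exact: (tonelli_ge0 TP). Qed.

Let B0 x : (0 <= B x)%E.
Proof. by apply: integral_ge0 => y _; exact: (tonelli_ge0 TN). Qed.

Let int_AB : (\int[mu]_x A x = \int[mu]_x B x)%E.
Proof.
rewrite /A (tonelliE TP); apply: eq_integral => y _.
by apply: eq_integral => x _; rewrite PnE.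
Qed.

Let m := fine (mu H).

Let A_le x : (A x <= (c * m * \1_H x)%:E)%E.
Proof.
apply: (@le_trans _ _ (\int[mu]_y ((c * \1_H x) * \1_H y)%:E)%E).
  apply: ge0_le_integral; first exact: measurableT.
  - by move=> y _; exact: (tonelli_ge0 TP).
  - exact: (tonelli_secl TP x).
  - apply/measurable_EFinP; apply: measurable_funM; first exact: measurable_cst.
    by apply: measurable_indic; exact: borel_open.
  - by move=> y _; exact: Pp_le.
rewrite (integral_bounded_on mu_haar cH oH); first by rewrite lee_fin mulrAC.
exact: mulr_ge0.
Qed.

Let A_fin x : A x \is a fin_num.
Proof. exact: ge0_le_fin_num (A0 x) (A_le x) (ltry _). Qed.

Let int_A_fin : (\int[mu]_x A x)%E \is a fin_num.
Proof.
apply: (@ge0_le_fin_num _ _ (\int[mu]_x (c * m * \1_H x)%:E)%E).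
- exact: integral_ge0.
- apply: ge0_le_integral; first exact: measurableT.
  + by [].
  + exact: (tonelli_intl TP).
  + apply/measurable_EFinP; apply: measurable_funM; first exact: measurable_cst.
    by apply: measurable_indic; exact: borel_open.
  + by move=> x _; exact: A_le.
- by rewrite (integral_bounded_on mu_haar cH oH); [exact: ltry|apply: mulr_ge0 => //; exact: fine_ge0].
Qed.

Let B_fin x : B x \is a fin_num.
Proof.
apply: (@ge0_le_fin_num _ _ (\int[mu]_y ((c * \1_H x) * \1_H y)%:E)%E); [exact: B0| |].
  apply: ge0_le_integral; first exact: measurableT.
  - by move=> y _; exact: (tonelli_ge0 TN).
  - exact: (tonelli_secl TN x).
  - apply/measurable_EFinP; apply: measurable_funM; first exact: measurable_cst.
    by apply: measurable_indic; exact: borel_open.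
  - by move=> y _; rewrite PnE (le_trans (Pp_le y x))// mulrAC.
by rewrite (integral_bounded_on mu_haar cH oH); [exact: ltry|exact: mulr_ge0].
Qed.

Lemma conv_integrand_cintegrable x : cintegrable mu (fun y => f y * g (y^-1 * x)%g).
Proof.
have [bf0 mf fb'] := fb; have [bg0 mg gb'] := gb.
have bfg0 : 0 <= bf * bg by exact: mulr_ge0.
apply: (bounded_on_cintegrable mu_haar cH oH (b := bf * bg)); split; [exact: bfg0| |].
  exact: conv_integrand_measurable.
move=> y; rewrite normcM mulrAC; apply: ler_pM; [exact: normc_ge0|exact: normc_ge0|exact: fb'|].
by apply: (le_trans (gb' _)); rewrite ler_piMr// indicE lern1 leq_b1.
Qed.

Let Im_conv x : (s * complex.Im ((g x)^*%C * (f \conv g) x))%:E = (A x - B x)%E.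
Proof.
have qi := cintableZ (g x)^*%C (conv_integrand_cintegrable x).
have qI := cintable_Im qi.
have PE : (\int[mu]_y (P (x, y))%:E = A x - B x)%E.
  rewrite integralE; congr (_ - _)%E; apply: eq_integral => y _.
    by rewrite funeposE /Pp EFin_max.
  by rewrite funenegE /Pn EFin_max.
rewrite -PE.
have -> : (f \conv g) x = cint mu (fun y => f y * g (y^-1 * x)%g) by [].
rewrite -cintZ; last exact: conv_integrand_cintegrable.
rewrite -[X in (s * X)%:E]/(\int[mu]_y (complex.Im ((g x)^*%C * (f y * g (y^-1 * x)%g)))).
rewrite -RintegralZl; [|exact: measurableT|exact: qI]; rewrite /Rintegral.
pose q y := (s * complex.Im ((g x)^*%C * (f y * g (y^-1 * x)%g)))%:E.
have mq : measurable_fun [set: borel G] (q : borel G -> \bar R).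
  by apply/measurable_EFinP; apply: measurable_funM; [exact: measurable_cst|exact: qi.1.2].
rewrite -[X in fine X]/(\int[mu]_y q y)%E -(integral_flip x mq).
rewrite (_ : (\int[mu]_y q (x * y^-1)%g)%E = (\int[mu]_y (P (x, y))%:E)%E); last first.
  apply: eq_integral => y _; rewrite /q /P /=.
  by rewrite invgM invgK -mulgA mulVg mulg1.
by rewrite PE fineK// fin_numB A_fin B_fin.
Qed.

Let norm_shift x : ((normc ((0 +i* s)%C * g x + (f \conv g) x) ^+ 2)%:E + 2%:E * B x =
  (s ^+ 2)%:E * (normc (g x) ^+ 2)%:E + (normc ((f \conv g) x) ^+ 2)%:E + 2%:E * A x)%E.
Proof.
have AE := fineK (A_fin x); have BE := fineK (B_fin x).
have := Im_conv x; rewrite -AE -BE -EFinB => -[e].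
rewrite -!EFinM -!EFinD; congr EFin.
have {}e : fine (A x) = s * complex.Im ((g x)^*%C * (f \conv g) x) + fine (B x).
  by rewrite e subrK.
rewrite e !normc_sqr; case: (g x) => a b; case: (_ x) => p q /=; ring.
Qed.

(** The cross term in the square of [i s g + f * g] is twice the iterated
    integral of [P], which vanishes: convolution by a self-adjoint [f] behaves
    as a symmetric operator on L^2. *)
Lemma norm2_shift :
  norm2 mu (fun x => (0 +i* s)%C * g x + (f \conv g) x) =
  ((s ^+ 2)%:E * norm2 mu g + norm2 mu (f \conv g))%E.
Proof.
have [bf0 mf _] := fb; have [bg0 mg _] := gb.
have mF := conv_measurable G_le mu_haar mf mg.
have mS : cmeasurable (fun x => (0 +i* s)%C * g x + (f \conv g) x).
  by apply: cmfunD mF; apply: cmfunM mg; exact: cmfun_cst.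
have m2A : measurable_fun [set: borel G] (fun x : borel G => 2%:E * A x)%E.
  by apply: measurable_funeM; exact: (tonelli_intl TP).
have m2B : measurable_fun [set: borel G] (fun x : borel G => 2%:E * B x)%E.
  by apply: measurable_funeM; exact: (tonelli_intl TN).
have msg : measurable_fun [set: borel G]
    (fun x : borel G => (s ^+ 2)%:E * (normc (g x) ^+ 2)%:E)%E.
  by apply: measurable_funeM; exact: measurable_normc_sqr.
have mnF := measurable_normc_sqr mF; have mnS := measurable_normc_sqr mS.
have A20 x : (0 <= 2%:E * A x)%E by rewrite mule_ge0// lee_fin.
have B20 x : (0 <= 2%:E * B x)%E by rewrite mule_ge0// lee_fin.
have sg0 x : (0 <= (s ^+ 2)%:E * (normc (g x) ^+ 2)%:E)%E.
  by rewrite -EFinM lee_fin mulr_ge0 ?sqr_ge0.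
have key : (norm2 mu (fun x => ((0 +i* s)%C * g x + (f \conv g) x)%R) + 2%:E * \int[mu]_x A x =
    (s ^+ 2)%:E * norm2 mu g + norm2 mu (f \conv g) + 2%:E * \int[mu]_x A x)%E.
  rewrite {1}int_AB /norm2.
  rewrite -[X in (_ + X = _)%E]ge0_integralZl; [|exact: measurableT
    |exact: (tonelli_intl TN)|by []|by rewrite lee_fin].
  rewrite -[X in (_ = _ + X)%E]ge0_integralZl; [|exact: measurableT
    |exact: (tonelli_intl TP)|by []|by rewrite lee_fin].
  rewrite -[X in (_ = X + _ + _)%E]ge0_integralZl; [|exact: measurableT
    |exact: measurable_normc_sqr|by move=> x _; rewrite lee_fin sqr_ge0|by rewrite lee_fin sqr_ge0].
  rewrite -ge0_integralD; [|exact: measurableT|by move=> x _; rewrite lee_fin sqr_ge0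
    |exact: mnS|by []|exact: m2B].
  rewrite -[X in (_ = X + _)%E]ge0_integralD; [|exact: measurableT|by []|exact: msg
    |by move=> x _; rewrite lee_fin sqr_ge0|exact: mnF].
  rewrite -[RHS]ge0_integralD; [|exact: measurableT
    |by move=> x _; rewrite adde_ge0// lee_fin sqr_ge0|exact: emeasurable_funD
    |by []|exact: m2A].
  by apply: eq_integral => x _; exact: norm_shift.
have fin2A : (2%:E * \int[mu]_x A x)%E \is a fin_num by rewrite fin_numM.
by rewrite -[LHS](addeK _ fin2A) key addeK.
Qed.

End SelfAdjointKernel.

(** * Spectra of bounded self-adjoint functions *)

Section CompactlySupported.
Variables (R : realType) (G : topologicalGroupType).
Variable mu : {measure set (borel G) -> \bar R}.
Variables (Phi Psi : R -> \bar R) (omega : G -> R).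
Hypothesis G_le : locally_elliptic G.
Hypothesis mu_haar : haar_measure mu.
Hypothesis PhiPsi : complementary_pair Phi Psi.
Hypothesis omega_weight : orlicz_weight mu Phi Psi omega.
Local Notation "f \conv g" := (convolution mu f g) (at level 40).
Local Notation "f =ae g" := (aeeq mu f g) (at level 70).
Local Notation normc := (@Normc.normc R).
Local Notation A := (orlicz_algebra mu Phi Psi omega).
Local Notation wnorm := (weighted_norm mu Psi omega).
Implicit Types (f g h u v : G -> R[i]) (l : R[i]).

Let Womega := ow_weight omega_weight.
Let HB := ow_banach omega_weight.
Let CA : convolution_algebra mu (mem_alg A) := banach_convolution_algebra HB.

Section SelfAdjoint.
Variable H : set G.
Hypothesis HS : subgroup H.
Hypothesis cH : compact H.
Hypothesis oH : open H.
Variables (f : G -> R[i]) (bf : R).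
Hypothesis fb : bounded_on H bf f.
Hypothesis f_sa : forall x, f (x^-1)%g = (f x)^*%C.
Variable l : R[i].
Hypothesis l_nonreal : complex.Im l != 0.

Let m := fine (mu H).
Let m0 : 0 <= m. Proof. exact: fine_ge0. Qed.
Let bf0 : 0 <= bf. Proof. by have [] := fb. Qed.
Let N := bf * m.
(* With [s Im l = N^2], the number [|l + i s|^2 = |l|^2 + 2 s Im l + s^2] exceeds
   [s^2 + N^2], which bounds the square of the norm of [i s + f] on [L^2]. *)
Let s := N ^+ 2 / complex.Im l.
Let z := l + (0 +i* s)%C.
Let theta := Num.sqrt ((s ^+ 2 + N ^+ 2) / normc z ^+ 2).

Let zE : normc z ^+ 2 = complex.Re l ^+ 2 + complex.Im l ^+ 2 + 2 * N ^+ 2 + s ^+ 2.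
Proof.
have bs : complex.Im l * s = N ^+ 2 by rewrite /s mulrC divfK.
rewrite normc_sqr /z ReD ImD /= addr0 sqrrD.
rewrite -mulr_natl bs; ring.
Qed.

Let Im2_gt0 : 0 < complex.Im l ^+ 2.
Proof. by rewrite lt_neqAle eq_sym sqrf_eq0 l_nonreal sqr_ge0. Qed.

Let z_gt0 : 0 < normc z.
Proof.
have : 0 < normc z ^+ 2.
  rewrite zE; have := sqr_ge0 (complex.Re l); have := sqr_ge0 N; have := sqr_ge0 s.
  by have := Im2_gt0; lra.
move=> z2; rewrite lt_neqAle normc_ge0 andbT eq_sym -sqrf_eq0.
exact: lt0r_neq0.
Qed.

Let z0 : z != 0.
Proof. by apply/eqP => e; move: z_gt0; rewrite e normc0 ltxx. Qed.

Let theta2 : theta ^+ 2 = (s ^+ 2 + N ^+ 2) / normc z ^+ 2.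
Proof. by rewrite sqr_sqrtr// divr_ge0 ?sqr_ge0// addr_ge0 ?sqr_ge0. Qed.

Let theta0 : 0 <= theta. Proof. exact: sqrtr_ge0. Qed.

Let theta1 : theta < 1.
Proof.
rewrite -(@ltr_pXn2r _ 2) ?nnegrE// expr1n theta2 ltr_pdivrMr ?exprn_gt0// mul1r zE.
have := sqr_ge0 (complex.Re l); have := sqr_ge0 N; have := Im2_gt0; lra.
Qed.

Let s_le : normc z^-1 * `|s| <= theta.
Proof.
rewrite -(@ler_pXn2r _ 2) ?nnegrE ?mulr_ge0 ?normc_ge0// exprMn theta2 Normc.normcV exprVn.
rewrite real_normK ?num_real// mulrC ler_wpM2r ?invr_ge0 ?sqr_ge0//.
by rewrite lerDl sqr_ge0.
Qed.

(* [l - f = z (1 - alpha - a)], and [alpha + a = (i s + f) / z] contracts L^2. *)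
Let a : G -> R[i] := z^-1 *: f.
Let alpha := z^-1 * (0 +i* s)%C.
Let w k := iter k (fun g => alpha *: g + a \conv g) a.

Let wSE k b x : bounded_on H b (w k) ->
  w k.+1 x = z^-1 * ((0 +i* s)%C * w k x + (f \conv w k) x).
Proof.
move=> wb; rewrite mulrDr mulrA.
rewrite -[LHS]/(alpha * w k x + (a \conv w k) x); congr (_ + _).
rewrite -[RHS]/(z^-1 * cint mu (fun y => f y * w k (y^-1 * x)%g)) -cintZ.
  by apply: eq_cint => y; rewrite mulrA.
exact: (conv_integrand_cintegrable mu_haar cH oH fb wb).
Qed.

Let norm2_fin b g : bounded_on H b g -> norm2 mu g = (fine (norm2 mu g))%:E.
Proof.
move=> gb; rewrite fineK// ge0_fin_numE ?norm2_ge0//.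
by apply: le_lt_trans (norm2_bounded_on mu_haar cH oH gb) _; exact: ltry.
Qed.

Let n0 := fine (norm2 mu a).
Let c := normc z^-1 * bf * Num.sqrt (m * n0).
(* Uniform bounds for the [w k]: that of [f * w k] only involves the L^1 norm of
   [w k], which is at most [sqrt m] times its L^2 norm. *)
Let b := fix b k := if k is k'.+1 then theta * b k' + c * theta ^+ k' else normc z^-1 * bf.

Let c0 : 0 <= c.
Proof. by rewrite !mulr_ge0 ?normc_ge0 ?sqrtr_ge0. Qed.

Let b0 k : 0 <= b k.
Proof.
elim: k => [|k IHk] /=; first by rewrite mulr_ge0 ?normc_ge0.
by apply: addr_ge0; [exact: mulr_ge0|apply: mulr_ge0 => //; exact: exprn_ge0].
Qed.

Let w_bound k : bounded_on H (b k) (w k) /\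
  fine (norm2 mu (w k)) <= (theta ^+ k) ^+ 2 * n0.
Proof.
elim: k => [|k [wb wn]].
  have [_ mf fb'] := fb; rewrite expr0 expr1n mul1r.
  split; [split; first exact: b0|exact: lexx].
  - by apply: cmfunM => //; exact: cmfun_cst.
  - move=> x; rewrite -[w 0%N x]/(z^-1 * f x) normcM -mulrA.
    by apply: ler_wpM2l (fb' x); exact: normc_ge0.
have [_ mw wb'] := wb; have [_ mf fb'] := fb.
have cb := conv_bounded_on G_le mu_haar HS cH oH fb wb.
have [cb0 mc cb'] := cb.
have wS x : w k.+1 x = z^-1 * ((0 +i* s)%C * w k x + (f \conv w k) x) by exact: (wSE _ wb).
have mshift : cmeasurable (fun x => (0 +i* s)%C * w k x + (f \conv w k) x).
  by apply: cmfunD => //; apply: cmfunM => //; exact: cmfun_cst.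
have mwS : cmeasurable (w k.+1).
  have -> : w k.+1 = (fun x => z^-1 * ((0 +i* s)%C * w k x + (f \conv w k) x)) by apply/funext.
  by apply: cmfunM => //; exact: cmfun_cst.
have normi : normc (0 +i* s)%C = `|s| by rewrite /= expr0n add0r sqrtr_sqr.
have w1 : norm1 mu (w k) <= theta ^+ k * Num.sqrt (m * n0).
  rewrite -(@ler_pXn2r _ 2) ?nnegrE ?norm1_ge0 ?mulr_ge0 ?sqrtr_ge0 ?exprn_ge0//.
  apply: (le_trans (norm1_sqr_le mu_haar HS cH oH wb)).
  rewrite exprMn sqr_sqrtr; last by rewrite mulr_ge0// fine_ge0// norm2_ge0.
  by rewrite mulrCA; apply: ler_wpM2l.
have wSb : bounded_on H (b k.+1) (w k.+1).
  split => // x; rewrite wS normcM.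
  apply: (@le_trans _ _ (normc z^-1 * (`|s| * (b k * \1_H x) + bf * (theta ^+ k * Num.sqrt (m * n0)) * \1_H x))).
    apply: ler_wpM2l; first exact: normc_ge0.
    apply: (le_trans (normcD _ _)); rewrite normcM normi; apply: lerD.
      by apply: ler_wpM2l.
    apply: (le_trans (cb' x)); apply: ler_wpM2r => //.
    exact: ler_wpM2l.
  rewrite (_ : _ * (_ + _) = normc z^-1 * `|s| * b k * \1_H x + c * theta ^+ k * \1_H x); last first.
    by rewrite /c; ring.
  by rewrite -mulrDl; apply: ler_wpM2r => //; apply: lerD => //; apply: ler_wpM2r.
split => //.
rewrite -lee_fin -(norm2_fin wSb).
have -> : norm2 mu (w k.+1) = ((normc z^-1 ^+ 2)%:E *
    norm2 mu (fun x => ((0 +i* s)%C * w k x + (f \conv w k) x)%R))%E.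
  rewrite /norm2 -ge0_integralZl; [|exact: measurableT|exact: measurable_normc_sqr
    |by move=> x _; rewrite lee_fin sqr_ge0|by rewrite lee_fin sqr_ge0].
  by apply: eq_integral => x _; rewrite wS normcM exprMn.
rewrite (norm2_shift G_le mu_haar cH oH fb f_sa wb).
have := conv_norm2_le G_le mu_haar HS cH oH fb wb.
rewrite (norm2_fin wb) (norm2_fin cb) -!EFinM !lee_fin => cn.
apply: (@le_trans _ _ (theta ^+ 2 * fine (norm2 mu (w k)))).
  rewrite theta2 Normc.normcV exprVn mulrC [X in _ <= X]mulrAC.
  apply: ler_wpM2r; first by rewrite invr_ge0 sqr_ge0.
  by rewrite mulrDl lerD2l.
rewrite [theta ^+ k.+1]exprS exprMn -[leRHS]mulrA.
apply: ler_wpM2l => //; exact: sqr_ge0.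
Qed.

(** The contraction in L^2 makes the uniform bounds of the [w k] decrease
    geometrically ([geometric_growth]), hence also their weighted norms, as
    [H] supports all of them. *)
Lemma bounded_selfadjoint_quasi_invertible : quasi_invertible mu (mem_alg A) l f.
Proof.
have [C C0 CP] := bounded_memA G_le mu_haar PhiPsi Womega cH.
have Abound g bg : bounded_on H bg g -> mem_alg A g /\ rnm wnorm g <= C * bg.
  move=> [bg0 mg gb]; have [Ag gle] := CP g bg bg0 mg gb; split => //.
  by rewrite -lee_fin -(rnmE HB Ag).
have Af := (Abound _ _ fb).1; have Aa : mem_alg A a by exact: (ca_Z CA).
have th : 0 <= theta < 1 by rewrite theta0 theta1.
have [D [theta' [th' bD]]] := geometric_growth th c0 (fun k => lexx (b k.+1)).
have wD k : rnm wnorm (w k) <= C * D * theta' ^+ k.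
  apply: (le_trans (Abound _ _ (w_bound k).1).2).
  by rewrite -mulrA; apply: ler_wpM2l.
have [v Av [vl vr]] := @neumann_series _ _ _ _ _ _ HB a alpha w (C * D) theta' Aa erefl
  (fun k => erefl) th' wD.
have l1 : z * (1 - alpha) = l.
  by rewrite /alpha mulrBr mulr1 mulrA mulfV// mul1r /z addrK.
have Zl := convZl CA z^-1 Af Av; have Zr := convZr CA z^-1 Af Av.
exists v => //; split; near=> x.
- rewrite -[LHS]/(l * v x - (f \conv v) x).
  have e : v x - alpha * v x - (a \conv v) x = z^-1 * f x by near: x.
  have e2 : (a \conv v) x = z^-1 * (f \conv v) x by near: x.
  transitivity (z * (v x - alpha * v x - (a \conv v) x)); last by rewrite e mulrA mulfV// mul1r.
  by rewrite e2 -l1; field.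
- rewrite -[LHS]/(l * v x - (v \conv f) x).
  have e : v x - alpha * v x - (v \conv a) x = z^-1 * f x by near: x.
  have e2 : (v \conv a) x = z^-1 * (v \conv f) x by near: x.
  transitivity (z * (v x - alpha * v x - (v \conv a) x)); last by rewrite e mulrA mulfV// mul1r.
  by rewrite e2 -l1; field.
Unshelve. all: by end_near. Qed.

End SelfAdjoint.

End CompactlySupported.

(** * Continuous functions of compact support *)

Section ContinuousFunctions.
Variables (R : realType) (G : topologicalGroupType).
Local Notation normc := (@Normc.normc R).
Implicit Types (f : G -> R[i]).

Lemma norm_normc (z : R[i]) : `|z| = (normc z)%:C%C.
Proof. by case: z. Qed.

(** Continuity for the topology of [R[i]^o], the one in the definition of
    [Cc]. *)
Lemma complex_lipschitz_continuous (phi : R[i] -> R) :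
  (forall z w, `|phi z - phi w| <= normc (z - w)) -> continuous (phi : R[i]^o -> R).
Proof.
move=> phi_lip z A [e /= e0 eA]; exists e%:C%C => /=; first by rewrite ltcR.
move=> w; rewrite /ball_ /= norm_normc ltcR => zw; apply: eA.
exact: le_lt_trans zw.
Qed.

Lemma continuous_cmeasurable f : continuous (f : G -> R[i]^o) -> cmeasurable f.
Proof.
move=> cf.
have cphi (phi : R[i] -> R) : (forall z w, `|phi z - phi w| <= normc (z - w)) ->
    measurable_fun [set: borel G] (fun x : borel G => phi (f x)).
  move=> phi_lip; apply: (@borel_continuousR R G (fun x => phi (f x))) => x.
  apply: (@continuous_comp _ R[i]^o _ f (phi : R[i]^o -> R)); first exact: cf.
  exact: complex_lipschitz_continuous.
split; apply: cphi => z w.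
- apply: le_trans (normc_geRe _); rewrite le_eqVlt; apply/orP; left.
  by case: z; case: w.
- apply: le_trans (normc_geIm _); rewrite le_eqVlt; apply/orP; left.
  by case: z; case: w.
Qed.

(** The compact support lies in one term of the increasing union of compact
    open subgroups. *)
Lemma Cc_bounded_on f : locally_elliptic G -> Cc R G f ->
  exists (H : set G) (b : R), [/\ subgroup H, compact H, open H & bounded_on H b f].
Proof.
move=> G_le [cf cK]; have [H [HP Hnd HT]] := le_union G_le.
set K := closure _ in cK.
have ndH := exhaustion_nondecreasing Hnd.
have [n KH] : exists n, K `<=` H n.
  have /compact_near_coveringP cov := cK.
  have : \forall n \near \oo, K `<=` (fun x => H n x).
    apply: (cov nat \oo (fun n x => H n x)) => x Kx.
    have [n _ Hnx] : (\bigcup_n H n) x by rewrite HT.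
    have [_ _ oH] := HP n.
    exists (H n, [set k | (n <= k)%N]); first by split; [exact: open_nbhs_nbhs|exists n].
    move=> [y k] [/= Hny nk].
    by have /subsetPset := ndH _ _ nk; exact.
  by move=> [n _ nK]; exists n; exact: (nK n (leqnn n)).
have [HS cH oH] := HP n.
have lip (z w : R[i]) : `|normc z - normc w| <= normc (z - w).
  rewrite ler_norml; apply/andP; split.
    rewrite lerNl opprB lerBlDr -(normcN (z - w)) opprB.
    by rewrite -[in X in X <= _](subrK z w) normcD.
  by rewrite lerBlDr -[in X in X <= _](subrK w z) normcD.
have cn : continuous (fun x : G => normc (f x)).
  move=> x; apply: (@continuous_comp _ R[i]^o _ f (normc : R[i]^o -> R)); first exact: cf.
  exact: (complex_lipschitz_continuous lip).
have [M [_ HM]] : bounded_set [set normc (f x) | x in H n].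
  apply: compact_bounded; apply: continuous_compact => //.
  exact: continuous_subspaceT.
exists (H n), (`|M| + 1); split => //; split.
- by rewrite addr_ge0.
- exact: continuous_cmeasurable.
move=> x; rewrite indicE; have [xH|xH] := boolP (x \in H n).
  rewrite mulr1; apply: le_trans (ler_norm _) _; apply: (HM (`|M| + 1)).
    by rewrite (le_lt_trans (ler_norm M))// ltrDl.
  by exists x => //; exact: set_mem.
rewrite mulr0; suff -> : f x = 0 by rewrite normc0.
apply/eqP; apply: contraNT xH => fx; rewrite inE; apply: KH.
exact: subset_closure.
Qed.

End ContinuousFunctions.

Theorem theorem1p2 (R : realType) (G : topologicalGroupType)
    (mu : {measure set (borel G) -> \bar R})
    (Phi Psi : R -> \bar R) (omega : G -> R)
    (G_le : locally_elliptic G) (mu_haar : haar_measure mu)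
    (PhiPsi : complementary_pair Phi Psi)
    (omega_weight : orlicz_weight mu Phi Psi omega)
    (omega_inv : orlicz_space mu Psi (fun x : G => ((omega x)^-1)%:C%C)) :
  quasi_hermitian (orlicz_algebra mu Phi Psi omega) (Cc R G) /\
  (hermitian_group mu -> subadditive_weight omega ->
    (forall f : G -> R[i], mem_alg (orlicz_algebra mu Phi Psi omega) f ->
      spectrum (orlicz_algebra mu Phi Psi omega) f =
      spectrum (group_algebra mu) f) /\
    hermitian_algebra (orlicz_algebra mu Phi Psi omega)).
Proof.
have HB := ow_banach omega_weight.
have CA : convolution_algebra mu (mem_alg (orlicz_algebra mu Phi Psi omega)).
  exact: banach_convolution_algebra HB.
have Womega := ow_weight omega_weight.
have Abound H b f : compact H -> bounded_on H b f -> mem_alg (orlicz_algebra mu Phi Psi omega) f.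
  move=> cH [b0 mf fb].
  by have [C _ CP] := bounded_memA G_le mu_haar PhiPsi Womega cH; have [] := CP f b b0 mf fb.
split.
- split=> [f fCc|f fCc fsa l].
    by have [H [b [_ cH _ fb]]] := Cc_bounded_on G_le fCc; exact: Abound fb.
  have [H [b [HS cH oH fb]]] := Cc_bounded_on G_le fCc.
  have Af := Abound H b f cH fb; have [b0 mf fb'] := fb.
  move=> lf; apply: contrapT => /eqP lreal.
  have l0 : l != 0 by apply: contraNneq lreal => ->.
  have /(spectrum_neq0P CA _ _ Af l0) := lf; apply.
  (* [fsa] only holds almost everywhere, whereas [f0 (x^-1)] is the conjugate of
     [f0 x] for every [x]. *)
  pose f0 : G -> R[i] := fun x => (2^-1 : R)%:C%C * (f x + involution f x).
  have f0b : bounded_on H b f0.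
    split => //.
      apply: cmfunM; first exact: cmfun_cst.
      apply: cmfunD => //; apply: cmfunJ.
      by split; [exact: (borel_comp_inv mf.1)|exact: (borel_comp_inv mf.2)].
    move=> x; rewrite normcM normc_real ger0_norm//.
    have fV : Normc.normc (involution f x) <= b * \1_H x.
      rewrite /involution normc_conj; apply: (le_trans (fb' _)).
      rewrite ler_wpM2l// !indicE ler_nat; have [|//] := boolP (x^-1%g \in H).
      by move=> /set_mem/(subgroupV HS); rewrite invgK => Hx; rewrite mem_set.
    have := normcD (f x) (involution f x); have := fb' x; lra.
  have f0sa x : f0 (x^-1)%g = (f0 x)^*%C.
    rewrite /f0 /involution invgK.
    by case: (f x) => p q; case: (f _) => p' q' /=; congr (_ +i* _)%C; ring.
  have ff0 : aeeq mu f0 f.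
    apply: filterS fsa => x fx; rewrite /f0.
    have -> : involution f x = f x by rewrite [RHS]fx.
    by case: (f x) => p q; apply: eqcP => /=; field.
  have Af0 := Abound H b f0 cH f0b.
  apply: (quasi_invertible_eq HB Af0 Af ff0).
  exact: (bounded_selfadjoint_quasi_invertible G_le mu_haar PhiPsi omega_weight HS cH oH f0b f0sa lreal).
- move=> G_herm omega_sub.
  have spE f : mem_alg (orlicz_algebra mu Phi Psi omega) f ->
      spectrum (orlicz_algebra mu Phi Psi omega) f = spectrum (group_algebra mu) f.
    exact: orlicz_spectrumE.
  split => // f Af fsa; rewrite spE//; apply: G_herm => //.
  exact: (orlicz_sub_L1 PhiPsi omega_weight omega_inv Af).
Qed.
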